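(* Let $0<\alpha<n$ and $1<p<q<\infty$, and suppose that $(u,\sigma)$ is a pair of weights on $\mathbb{R}^n$ with $(u,\sigma)\in A^\alpha_{p,q}$ and $u\in A_\infty$. Then $$\|I_\alpha(\,\cdot\,\sigma)\|_{L^p(\sigma)\to L^{q,\infty}(u)}\lesssim \sup_Q A^\alpha_{q',p'}(\sigma,u,Q)\,A^{\exp}_\infty(u,Q)^{\frac1{p'}}$$ and $$\|I_\alpha(\,\cdot\,\sigma)\|_{L^p(\sigma)\to L^{q,\infty}(u)}\lesssim [\sigma,u]_{A^\alpha_{q',p'}}\,[u]_{A^M_\infty}^{\frac1{p'}}.$$
   Context: A weight is a non-negative locally integrable function on $\mathbb{R}^n$; $r'=r/(r-1)$. All cubes have sides parallel to the axes, and all suprema $\sup_Q$ are over all cubes $Q$. The Riesz potential is $I_\alpha f(x)=\int_{\mathbb{R}^n}\frac{f(y)}{|x-y|^{n-\alpha}}\,dy$, and $M f(x)=\sup_{Q\ni x}\frac1{|Q|}\int_Q|f|\,dy$ is the Hardy–Littlewood maximal operator. For exponents $1<p\le q<\infty$ and weights $(u,\sigma)$, $A^\alpha_{p,q}(u,\sigma,Q)=|Q|^{\frac{\alpha}{n}+\frac1q-\frac1p}\left(\frac1{|Q|}\int_Q u\,dx\right)^{1/q}\left(\frac1{|Q|}\int_Q\sigma\,dx\right)^{1/p'}$, $[u,\sigma]_{A^\alpha_{p,q}}=\sup_Q A^\alpha_{p,q}(u,\sigma,Q)$, and $(u,\sigma)\in A^\alpha_{p,q}$ means $[u,\sigma]_{A^\alpha_{p,q}}<\infty$.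 (One has $A^\alpha_{p,q}(u,\sigma,Q)=A^\alpha_{q',p'}(\sigma,u,Q)$.) For a weight $w$, $A^{\exp}_\infty(w,Q)=\left(\frac1{|Q|}\int_Q w\,dx\right)\exp\left(-\frac1{|Q|}\int_Q\log w\,dx\right)$, $[w]_{A^{\exp}_\infty}=\sup_Q A^{\exp}_\infty(w,Q)$; $[w]_{A^M_\infty}=\sup_Q\frac{1}{w(Q)}\int_Q M(w\chi_Q)\,dx$, where $w(E)=\int_E w\,dx$. A (not identically zero) weight $w$ is in $A_\infty$ if $[w]_{A^{\exp}_\infty}<\infty$; equivalently, if $[w]_{A^M_\infty}<\infty$. $\|g\|_{L^{q,\infty}(u)}=\sup_{t>0}t\,u(\{|g|>t\})^{1/q}$, $\|f\|_{L^p(\sigma)}=(\int|f|^p\sigma\,dx)^{1/p}$, and $\|I_\alpha(\,\cdot\,\sigma)\|_{L^p(\sigma)\to L^{q,\infty}(u)}$ is the smallest $C\in[0,\infty]$ such that $\|I_\alpha(f\sigma)\|_{L^{q,\infty}(u)}\le C\|f\|_{L^p(\sigma)}$ for all (non-negative, by positivity) $f\in L^p(\sigma)$. $A\lesssim B$ means $A\le cB$ with $c$ depending only on $n,\alpha,p,q$. *)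

(* Defs.v *)
From HB Require Import structures.
From mathcomp Require Import all_boot all_order all_algebra.
From mathcomp Require Import all_classical all_reals all_analysis.

Set Implicit Arguments.
Unset Strict Implicit.
Unset Printing Implicit Defensive.

Import Order.TTheory GRing.Theory Num.Theory.
Import numFieldNormedType.Exports.

Local Open Scope classical_set_scope.
Local Open Scope ring_scope.

Section tuple_measure_step.
Context d (T : measurableType d) (R : realType) (n : nat).
Variable m1 : {sigma_finite_measure set T -> \bar R}.
Variable m2 : {sigma_finite_measure set (n.-tuple T) -> \bar R}.
Local Open Scope ereal_scope.

Definition tuple_cons (x : T * n.-tuple T) : n.+1.-tuple T :=
  [tuple of x.1 :: x.2].

Definition tuple_uncons (x : n.+1.-tuple T) : T * n.-tuple T :=
  (tnth x ord0, [tuple of behead x]).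

Lemma tuple_consK : cancel tuple_cons tuple_uncons.
Proof. by case=> a t; congr pair; exact/val_inj. Qed.

Lemma tuple_unconsK : cancel tuple_uncons tuple_cons.
Proof. by move=> x; apply/val_inj => /=; case/tupleP: x. Qed.

Lemma measurable_tuple_cons : measurable_fun [set: _] tuple_cons.
Proof. exact: measurable_cons. Qed.

Lemma measurable_tuple_uncons : measurable_fun [set: _] tuple_uncons.
Proof.
apply: measurable_fun_pair; first exact: measurable_tnth.
exact: measurable_behead.
Qed.

Definition tuple_measure_step : set (n.+1.-tuple T) -> \bar R :=
  pushforward (m1 \x m2) tuple_cons.

Let step0 : tuple_measure_step set0 = 0.
Proof. by rewrite /tuple_measure_step /pushforward preimage_set0 measure0. Qed.

Let step_ge0 A : 0 <= tuple_measure_step A.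
Proof. by apply: integral_ge0 => x _; exact: measure_ge0. Qed.

Let step_sigma_additive : semi_sigma_additive tuple_measure_step.
Proof.
move=> F mF tF mUF; rewrite /tuple_measure_step /pushforward preimage_bigcup.
have mc A : measurable A -> measurable (tuple_cons @^-1` A).
  by move=> mA; rewrite -[X in measurable X]setTI; exact: measurable_tuple_cons.
apply: measure_semi_sigma_additive.
- by move=> i; exact: mc.
- apply/trivIsetP => /= i j _ _ ij; rewrite -preimage_setI.
  by move/trivIsetP : tF => /(_ _ _ _ _ ij) ->//; rewrite preimage_set0.
- by rewrite -preimage_bigcup; exact: mc.
Qed.

HB.instance Definition _ := isMeasure.Build _ _ _ tuple_measure_step
  step0 step_ge0 step_sigma_additive.

Let step_sigma_finite : sigma_finite setT tuple_measure_step.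
Proof.
have /sigma_finiteP[F [TF ndF Foo]] := sigma_finiteT m1.
have /sigma_finiteP[G [TG ndG Goo]] := sigma_finiteT m2.
exists (fun i => tuple_uncons @^-1` (F i `*` G i)).
  apply/esym/seteqP; split => // x _.
  have [i _ Fi] : (\bigcup_i F i) (tuple_uncons x).1 by rewrite -TF.
  have [k _ Gk] : (\bigcup_i G i) (tuple_uncons x).2 by rewrite -TG.
  exists (maxn i k) => //; split.
  - by move: Fi; exact/subsetPset/ndF/leq_maxl.
  - by move: Gk; exact/subsetPset/ndG/leq_maxr.
move=> i; have [mF Fi] := Foo i; have [mG Gi] := Goo i; split.
  rewrite -[X in measurable X]setTI; apply: measurable_tuple_uncons => //.
  exact: measurableX.
rewrite /tuple_measure_step /pushforward.
rewrite (_ : _ @^-1` _ = F i `*` G i); last first.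
  by apply/seteqP; split => x; rewrite /preimage/= ?theadE/=; case: x => a t /=;
    rewrite (_ : [tuple of _] = t)//; exact/val_inj.
by rewrite product_measure1E// lte_mul_pinfty// ge0_fin_numE.
Qed.

HB.instance Definition _ := Measure_isSigmaFinite.Build _ _ _
  tuple_measure_step step_sigma_finite.

End tuple_measure_step.

Fixpoint tuple_measure d (T : measurableType d) (R : realType)
    (m : {sigma_finite_measure set T -> \bar R}) (n : nat) :
    {sigma_finite_measure set (n.-tuple T) -> \bar R} :=
  match n with
  | 0 => \d_[tuple]
  | k.+1 => tuple_measure_step m (tuple_measure m k)
  end.

Notation Rn R n := (n.-tuple (measurableTypeR R)).

Definition lebesgue (R : realType) (n : nat) :
    {sigma_finite_measure set (Rn R n) -> \bar R} :=
  tuple_measure (@lebesgue_measure R) n.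

Section definitions.
Context (R : realType) (n : nat).
Local Notation Rn := (Rn R n).
Local Notation mu := (lebesgue R n).
Implicit Types (Q E : set Rn) (w u sigma f : Rn -> R) (g : Rn -> \bar R).
Implicit Types alpha p q r : R.

Definition cube (a : Rn) (l : R) : set Rn :=
  [set x | forall i, tnth a i <= tnth x i <= tnth a i + l].

Definition cubes : set (set Rn) :=
  [set Q | exists a l, 0 < l /\ Q = cube a l].

Definition eucl_dist (x y : Rn) : R :=
  Num.sqrt (\sum_(i < n) (tnth x i - tnth y i) ^+ 2).

(* The sigma-algebra of Rn is the Borel one; a function is Lebesgue measurable
   iff it coincides with a Borel function off a null set. *)
Definition lebesgue_measurable f :=
  exists2 h : Rn -> R, measurable_fun setT h & {ae mu, forall x, f x = h x}.

Local Open Scope ereal_scope.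

Definition wmeas w E : \bar R := \int[mu]_(x in E) (w x)%:E.

(* Every compact set is contained in a cube, and cubes are compact. *)
Definition weight w :=
  [/\ lebesgue_measurable w, forall x, (0 <= w x)%R &
      forall Q, cubes Q -> wmeas w Q < +oo].

Definition avg w Q : \bar R := (mu Q)^-1 * \int[mu]_(x in Q) (w x)%:E.

(* For alpha < n the kernel takes the value 0 on the diagonal, a null set. *)
Definition riesz alpha f (x : Rn) : \bar R :=
  \int[mu]_y (f y / (eucl_dist x y `^ (n%:R - alpha)))%:E.

Definition HLmax f (x : Rn) : \bar R :=
  ereal_sup [set avg (fun y => `|f y|)%R Q | Q in [set Q | cubes Q /\ Q x]].

Definition conj_exp r : R := r / (r - 1).

Definition Apq alpha p q u sigma Q : \bar R :=
  mu Q `^ (alpha / n%:R + q^-1 - p^-1) * avg u Q `^ q^-1 *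
  avg sigma Q `^ (conj_exp p)^-1.

Definition Apq_const alpha p q u sigma : \bar R :=
  ereal_sup [set Apq alpha p q u sigma Q | Q in cubes].

(* Since lne 0 = -oo, Aexp w Q = +oo when log w is not integrable on Q and
   w is not null there. *)
Definition Aexp w Q : \bar R :=
  avg w Q * expeR (- ((mu Q)^-1 * \int[mu]_(x in Q) lne (w x)%:E)).

Definition Aexp_const w : \bar R := ereal_sup [set Aexp w Q | Q in cubes].

Definition AM_const w : \bar R :=
  ereal_sup [set (wmeas w Q)^-1 * \int[mu]_(x in Q) HLmax (w \* \1_Q)%R x |
             Q in cubes].

Definition Ainfty w :=
  [/\ weight w, ~ {ae mu, forall x, w x = 0%R} & Aexp_const w < +oo].

Definition Lp_norm p sigma f : \bar R :=
  (\int[mu]_x ((`|f x| `^ p) * sigma x)%:E) `^ p^-1.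

Definition weakLp_norm q u g : \bar R :=
  ereal_sup [set t%:E * wmeas u [set x | t%:E < `|g x|] `^ q^-1 |
             t in [set t : R | (0 < t)%R]].

Definition riesz_weak_norm alpha p q u sigma : \bar R :=
  ereal_inf [set C | 0 <= C /\
    forall f, lebesgue_measurable f -> (forall x, (0 <= f x)%R) ->
      Lp_norm p sigma f < +oo ->
      weakLp_norm q u (riesz alpha (f \* sigma)%R) <= C * Lp_norm p sigma f].

End definitions.

Lemma measurable_cube (R : realType) (n : nat) (a : Rn R n) (l : R) :
  measurable (cube a l).
Proof.
rewrite (_ : cube a l = \bigcap_(i in [set: 'I_n])
    ((fun x => tnth x i) @^-1` `[tnth a i, (tnth a i + l)%R]%classic)).
  apply: fin_bigcap_measurable => // i _; rewrite -[X in measurable X]setTI.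
  apply: measurable_tnth => //; exact: measurable_itv.
apply/seteqP; split => x xP i /=.
  by move=> _; rewrite in_itv/=; exact: xP.
by have := xP i Logic.I; rewrite /= in_itv.
Qed.

Lemma lebesgue_cube (R : realType) (n : nat) (a : Rn R n) (l : R) :
  0 <= l -> lebesgue R n (cube a l) = (l ^+ n)%:E.
Proof.
move=> l0; elim: n a => [|n ih] a.
  rewrite /lebesgue /= diracE expr0 mem_set//; first by case.
rewrite [LHS](_ : _ = (lebesgue_measure \x lebesgue R n)%E
    (`[tnth a ord0, (tnth a ord0 + l)%R]%classic `*`
     cube [tuple of behead a] l)).
  rewrite product_measure1E; [|exact: measurable_itv|exact: measurable_cube].
  rewrite ih exprS EFinM; congr (_ * _)%E.
  have := @lebesgue_measure_itv R `[tnth a ord0, tnth a ord0 + l]%R.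
  rewrite /= lte_fin ltrDl -EFinB (addrC (tnth a _)) addrK.
  by case: ltgtP l0 => // <-.
rewrite /lebesgue /= /tuple_measure_step /pushforward; congr product_measure1.
apply/seteqP; split => -[x t] /=.
  move=> xP; split; first by rewrite in_itv/=; have := xP ord0.
  move=> i; have := xP (lift ord0 i).
  by rewrite tnthS tnth_behead (_ : inord _ = lift ord0 i)//;
    apply/val_inj => /=; rewrite inordK// ltnS.
rewrite in_itv/= => -[xP tP] i.
have [->//|i0] := eqVneq i ord0.
have [j ->] : exists j, i = lift ord0 j.
  by case: (unliftP ord0 i) i0 => [j ->|-> /eqP//] _; exists j.
have := tP j; rewrite tnthS tnth_behead (_ : inord _ = lift ord0 j)//.
by apply/val_inj => /=; rewrite inordK// ltnS.
Qed.

(* Main.v *)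
Require Import Defs.
From HB Require Import structures.
From mathcomp Require Import all_boot all_order all_algebra.
From mathcomp Require Import all_classical all_reals all_analysis.
From mathcomp Require Import measurable_realfun.
From mathcomp Require Import ring lra zify.

Set Implicit Arguments.
Unset Strict Implicit.
Unset Printing Implicit Defensive.

Import Order.TTheory GRing.Theory Num.Theory.
Import numFieldNormedType.Exports.

Local Open Scope classical_set_scope.
Local Open Scope ring_scope.

(** Write [r = p'] and [w(Q) = l(Q)^(n - alpha)]. By duality the weak-type bound
    follows from testing the potential on sets: if
    [E = {I_alpha (f sigma) > t}], then [t u(E)] is at most the integral of
    [f I_alpha(u 1_E)] against [sigma], so by Hoelder's inequality it is enough
    that the integral of [I_alpha(u 1_E)^r] against [sigma] is
    [<= C u(E)^(r/q')]. The kernel at [(x, y)] is dominated by the sum of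
    [1/w(Q)] over the cubes containing both points in [2^n] dyadic grids, shifted
    by a third of the top side in some of the coordinates ([kernel_le]).
    Truncating to finitely many generations leaves inequalities between finite
    sums over a tree of cubes; [weak_type_borel] carries out this reduction and
    takes the limit.

    On a tree, put [g(Q) = u(E cap Q)] and [b = 1 + r/q]. A stopping-time
    argument reduces the sum of [g(Q)/w(Q)] to cubes that form a Carleson family
    for Lebesgue measure. The hypotheses on the pair say that
    [u(Q)^b sigma(Q) <= w(Q)^r mu(Q)], where [mu] has a Carleson property
    relative to [u] over such families: the sum of [mu(S)] over the chosen cubes
    [S] inside [Q] is [<= C u(Q)]. One expands the [r]-th power of
    the sum over the cubes containing a point as a sum over pairs [S' <= S].
    Splitting that sum by the size of the [A_infinity] constants of the cubes
    would lose a logarithm. Instead [mu(S)] is replaced by the sum of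
    [k^(2d) mu(S')] over the descendants [S'] of [S], [d] being the difference of
    generations ([discounted]); this quantity is additive over a generation up
    to a factor [k^(-2d)], and its total over all [S] is comparable with that of
    [mu]. Because [p < q], that is [b < r], an interpolation between the testing
    condition and the trivial bound gains a geometric factor in [d], which pays
    for the discount ([bump_level]), so the contributions of all [S'] inside [S]
    add up to the one of [S] itself. What is left is the Carleson sum of
    [mu(S) (g(S)/u(S))^b], of size [u(E)] ([carleson_ratio]). This is
    [tree_inequality].

    The two bounds differ only in [mu]. For the maximal function constant
    [mu = K^r u], and the Carleson property holds because the average of [u] on a
    cube is a lower bound for the maximal function on it ([carleson_maximal]). For
    the exponential constant [mu(Q)] is [K^r |Q|] times the squared average of
    [sqrt u], which by Jensen's inequality ([Aexp_ge]) dominates [K^r |Q|] times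
    the geometric mean of [u], and whose Carleson property is the [L^2] maximal
    inequality for [sqrt u] ([carleson_sqrt]). *)

(** * Finite trees *)

Section tree.
Context (T : finType) (lv : T -> nat) (le : rel T).

(** The combinatorics of dyadic cubes: [le Q S] is inclusion, [lv] the
    generation, and two cubes with a common descendant are nested. *)
Definition is_tree :=
  [/\ reflexive le, antisymmetric le, transitive le,
      (forall Q S, le Q S -> (lv S <= lv Q)%N) &
      forall Q S S', le Q S -> le Q S' -> (lv S <= lv S')%N -> le S' S].

Definition antichain (P : pred T) :=
  forall S S', P S -> P S' -> le S S' -> S = S'.

Definition chain (P : pred T) :=
  forall S S', P S -> P S' -> (lv S <= lv S')%N -> le S' S.

Definition upclosed (P : pred T) := forall S S', P S -> le S S' -> P S'.

Definition maximal (P : pred T) : pred T :=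
  fun S => P S && [forall S', P S' ==> le S S' ==> (S' == S)].

(** The trace on the cubes of a measure: superadditivity over disjoint cubes. *)
Definition submeasure (R : realType) (m : T -> R) :=
  (forall Q, 0 <= m Q) /\
  forall (P : pred T) Q, antichain P -> (forall S, P S -> le S Q) ->
    \sum_(S | P S) m S <= m Q.

Hypothesis tT : is_tree.

Lemma maximal_sub (P : pred T) S : maximal P S -> P S.
Proof. by case/andP. Qed.

Lemma maximal_antichain (P : pred T) : antichain (maximal P).
Proof.
move=> S S' /andP[PS /forallP mS] /andP[PS' _] SS'.
by have := mS S'; rewrite PS' SS' => /eqP.
Qed.

Lemma maximal_above (P : pred T) S : P S -> exists2 S', maximal P S' & le S S'.
Proof.
case: tT => rT aT trT lvT nT PS.
pose A := fun X => P X && le S X.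
have AS : A S by rewrite /A PS rT.
case: (arg_minnP (P := A) lv AS) => S' /andP[PS' SS'] minS'.
exists S' => //; rewrite /maximal PS' /=.
apply/forallP => X; apply/implyP => PX; apply/implyP => S'X.
have SX : le S X by exact: trT SS' S'X.
have h : le X S' by apply: (nT S) => //; apply: minS'; rewrite /A PX SX.
by apply/eqP/aT; rewrite h S'X.
Qed.

Lemma chain_lv_inj (P : pred T) S S' : chain P -> P S -> P S' -> lv S = lv S' -> S = S'.
Proof.
case: tT => rT aT trT lvT nT cP PS PS' e.
by apply: aT; apply/andP; split; apply: cP; rewrite ?e.
Qed.

Lemma level_antichain i : antichain (fun S => lv S == i).
Proof.
case: tT => rT aT trT lvT nT S S' /eqP e /eqP e' SS'; apply: aT.
by rewrite SS' /=; apply: (nT S) => //; rewrite e e'.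
Qed.

Lemma ancestors_chain Q : chain (le Q).
Proof. by case: tT => rT aT trT lvT nT S S' QS QS'; exact: nT QS QS'. Qed.

Lemma sub_chain (P P' : pred T) : (forall S, P' S -> P S) ->
  chain P -> chain P'.
Proof. by move=> s cP S S' /s PS /s PS'; exact: cP. Qed.

Lemma sub_antichain (P P' : pred T) : (forall S, P' S -> P S) ->
  antichain P -> antichain P'.
Proof. by move=> s cP S S' /s PS /s PS'; exact: cP. Qed.

End tree.

Section sums.
Context (R : realType) (T : finType).
Implicit Types (P A : pred T) (x : R).

Lemma ler_sum_subpred P A (F : T -> R) : (forall S, P S -> A S) ->
  (forall S, A S -> 0 <= F S) -> \sum_(S | P S) F S <= \sum_(S | A S) F S.
Proof.
move=> PA F0; rewrite (bigID P A)/= [leLHS](eq_bigl (fun S => A S && P S)).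
  by rewrite lerDl sumr_ge0// => S /andP[/F0].
by move=> S; case: (boolP (P S)) => [/PA ->//|]; rewrite andbF.
Qed.

Lemma ler_sum_union (I : finType) P (A : I -> pred T) (D : pred I) (F : T -> R) :
  (forall S, 0 <= F S) -> (forall S, P S -> exists2 i, D i & A i S) ->
  \sum_(S | P S) F S <= \sum_(i | D i) \sum_(S | A i S) F S.
Proof.
move=> F0 PA; rewrite (exchange_big_dep predT)//=.
rewrite [leRHS](bigID P)/= -[leLHS]addr0; apply: lerD; last first.
  by apply: sumr_ge0 => S _; apply: sumr_ge0.
apply: ler_sum => S /PA[i Di Ai].
rewrite (bigD1 i) ?Di ?Ai//= lerDl sumr_ge0//.
Qed.

Lemma ler_sum_at_most1 P (F : T -> R) (c : R) : 0 <= c ->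
  (forall S, P S -> F S <= c) -> (forall S S', P S -> P S' -> S = S') ->
  \sum_(S | P S) F S <= c.
Proof.
move=> c0 Fc u; case: (pickP P) => [S PS|P0]; last by rewrite big_pred0.
rewrite (bigD1 S)//= big1 ?addr0 ?Fc// => S' /andP[PS' /eqP SS'].
by case: SS'; exact: u.
Qed.

Lemma geometric_sum_le x N : 0 <= x < 1 -> \sum_(i < N) x ^+ i <= (1 - x)^-1.
Proof.
move=> /andP[x0 x1]; have d0 : 0 < 1 - x by rewrite subr_gt0.
rewrite -[leRHS]mul1r ler_pdivlMr// mulrC.
have := subrX1 x N; rewrite -opprB -[X in _ = X * _]opprB mulNr => /oppr_inj <-.
by rewrite gerBl exprn_ge0.
Qed.

Lemma sum_expr_inj P (f : T -> nat) x : 0 <= x < 1 ->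
  (forall S S', P S -> P S' -> f S = f S' -> S = S') ->
  \sum_(S | P S) x ^+ f S <= (1 - x)^-1.
Proof.
move=> x01 fI; have x0 : 0 <= x by case/andP: x01.
pose N := (\sum_S f S).+1.
have fN S : (f S < N)%N by rewrite ltnS /N (bigD1 S)//= leq_addr.
apply: le_trans (geometric_sum_le N x01).
apply: le_trans (_ : \sum_(i < N) \sum_(S | P S && (f S == i)) x ^+ f S <= _).
  apply: (ler_sum_union (D := predT) (A := fun (i : 'I_N) S => P S && (f S == i))).
    by move=> S; rewrite exprn_ge0.
  by move=> S PS; exists (Ordinal (fN S)) => //=; rewrite PS eqxx.
apply: ler_sum => i _; apply: ler_sum_at_most1; first by rewrite exprn_ge0.
  by move=> S /andP[_ /eqP ->].
by move=> S S' /andP[PS /eqP e] /andP[PS' /eqP e']; apply: fI => //; rewrite e e'.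
Qed.

(** Splitting [\sum a_i] as [\sum rho^-i (rho^i a_i)] compares it with its
    largest term [rho^i a_i], at the price of a geometric series; this replaces
    Minkowski's inequality and works for every exponent [b > 0]. *)
Lemma powR_sum_geometric P (f : T -> nat) (a : T -> R) (rho b : R) :
  1 < rho -> 0 < b -> (forall S, 0 <= a S) ->
  (forall S S', P S -> P S' -> f S = f S' -> S = S') ->
  (\sum_(S | P S) a S) `^ b <=
    (1 - rho^-1)^-1 `^ b *
      \sum_(S | P S) (rho ^+ f S * a S) `^ b.
Proof.
move=> rho1 b0 a0 fI; have rho0 : 0 < rho by apply: lt_trans rho1.
have r01 : 0 <= rho^-1 < 1 by rewrite invr_ge0 ltW//= invf_lt1.
have d0 : 0 <= (1 - rho^-1)^-1 by rewrite invr_ge0 subr_ge0 ltW//; case/andP: r01.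
case: (pickP P) => [S0 PS0|P0]; last first.
  by rewrite !big_pred0// powR0 ?gt_eqF// mulr0.
have [S PS maxS] := arg_maxP (fun S => rho ^+ f S * a S) PS0.
apply: (@le_trans _ _ (((1 - rho^-1)^-1 * (rho ^+ f S * a S)) `^ b)).
  have ra0 : 0 <= (1 - rho^-1)^-1 * (rho ^+ f S * a S).
    by rewrite !mulr_ge0 ?exprn_ge0// ltW.
  apply: ge0_ler_powR; rewrite ?nnegrE ?sumr_ge0 ?(ltW b0)//.
  apply: (@le_trans _ _ (\sum_(S' | P S') rho^-1 ^+ f S' * (rho ^+ f S * a S))).
    apply: ler_sum => S' PS'.
    apply: (@le_trans _ _ (rho^-1 ^+ f S' * (rho ^+ f S' * a S'))).
      by rewrite mulrA -exprMn mulVf ?gt_eqF// expr1n mul1r.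
    apply: ler_wpM2l; last exact: maxS.
    by rewrite exprn_ge0// invr_ge0 ltW.
  rewrite -mulr_suml ler_wpM2r ?sum_expr_inj//.
  by rewrite mulr_ge0// exprn_ge0// ltW.
rewrite powRM ?mulr_ge0 ?exprn_ge0 ?(ltW rho0)//.
apply: ler_wpM2l; rewrite ?powR_ge0//.
by rewrite (bigD1 S)//= lerDl sumr_ge0// => S' _; rewrite powR_ge0.
Qed.

End sums.

(** * Dyadic levels of a function on a tree *)

Lemma powR_gt1 (R : realType) (a x : R) : 1 < a -> 0 < x -> 1 < a `^ x.
Proof.
move=> a1 x0; have e : 1 `^ x = 1 :> R by rewrite powR1.
by rewrite -[ltLHS]e gt0_ltr_powR ?nnegrE// (le_trans _ (ltW a1)).
Qed.

Section levels.
Context (R : realType) (T : finType).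
Implicit Types (phi : T -> R) (b z g : R).

(** [b] and [M] exist because [T] is finite: only finitely many dyadic levels
    occur, and starting them at a small [b] makes the level a natural number. *)
Definition levels phi b M := 0 < b /\
  forall S, 0 < phi S -> exists2 i : 'I_M, b * 2 ^+ i < phi S & phi S <= b * 2 ^+ i.+1.

Lemma exists_levels phi : (forall S, 0 <= phi S) -> exists b M, levels phi b M.
Proof.
move=> phi0.
pose c := 1 + \sum_S (phi S)^-1; pose b := c^-1.
have c0 : 0 < c by rewrite ltr_pwDl// sumr_ge0// => S _; rewrite invr_ge0.
have b0 : 0 < b by rewrite invr_gt0.
have [M HM] : exists M, \sum_S phi S <= b * 2 ^+ M.
  have [k hk] : exists k : nat, (\sum_S phi S) / b < k%:R.
    by exists (Num.truncn ((\sum_S phi S) / b)).+1; rewrite truncnS_gt.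
  exists k; rewrite -ler_pdivrMl// mulrC; apply: le_trans (ltW hk) _.
  by rewrite -natrX ler_nat; apply/ltnW/ltn_expl.
exists b, M; split=> // S S0.
have bS : b * 2 ^+ 0 < phi S.
  rewrite expr0 mulr1 /b -[ltRHS]invrK ltf_pV2 ?posrE ?invr_gt0//.
  rewrite /c (bigD1 S)//= addrCA ltrDl ltr_pwDl// sumr_ge0// => i _.
  by rewrite invr_ge0.
have SM : phi S <= b * 2 ^+ M.
  by apply: le_trans HM; rewrite (bigD1 S)//= lerDl sumr_ge0.
pose p i := phi S <= b * 2 ^+ i; have pM : exists i, p i by exists M.
case: (ex_minnP pM); rewrite /p => -[|i]; first by rewrite leNgt bS.
move=> Si mini; have iM : (i < M)%N by exact: mini.
exists (Ordinal iM) => //=; rewrite ltNge; apply/negP => /mini.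
by rewrite ltnn.
Qed.

Lemma sum_levels_le b z g M : 0 < b -> 0 < g -> 0 <= z ->
  \sum_(i < M | b * 2 ^+ i < z) (b * 2 ^+ i) `^ g <=
    2 `^ g / (2 `^ g - 1) * z `^ g.
Proof.
move=> b0 g0 z0.
have tg : 1 < 2 `^ g :> R by rewrite powR_gt1// ltr1n.
have d0 : 0 < 2 `^ g - 1 :> R by rewrite subr_gt0.
have bn0 i : 0 <= b * 2 ^+ i by rewrite mulr_ge0 ?exprn_ge0 ?(ltW b0).
have step i : (b * 2 ^+ i.+1) `^ g = 2 `^ g * (b * 2 ^+ i) `^ g.
  by rewrite exprS mulrCA [LHS]powRM.
have bnd m : \sum_(i < m | b * 2 ^+ i < z) (b * 2 ^+ i) `^ g <=
    (2 `^ g - 1)^-1 * (b * 2 ^+ m) `^ g.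
  elim: m => [|m ih]; first by rewrite big_ord0 mulr_ge0 ?powR_ge0// invr_ge0 ltW.
  rewrite big_mkcond big_ord_recr -big_mkcond/=.
  apply: le_trans (_ : ((2 `^ g - 1)^-1 + 1) * (b * 2 ^+ m) `^ g <= _).
    rewrite mulrDl mul1r lerD//; case: ifP => // _; exact: powR_ge0.
  have e : (2 `^ g - 1)^-1 + 1 = (2 `^ g - 1)^-1 * 2 `^ g.
    by field; rewrite gt_eqF.
  by rewrite step mulrA e.
elim: M => [|m ih].
  by rewrite big_ord0 !mulr_ge0 ?powR_ge0// invr_ge0 ltW.
have [bz|bz] := ltP (b * 2 ^+ m) z; last first.
  by rewrite big_mkcond big_ord_recr -big_mkcond/= ltNge bz /= addr0.
apply: le_trans (bnd m.+1) _; rewrite step mulrA [X in X * _ <= _]mulrC.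
rewrite ler_wpM2l ?divr_ge0 ?powR_ge0 ?(ltW d0)//.
by apply: ge0_ler_powR; rewrite ?nnegrE ?(ltW g0) ?(ltW bz).
Qed.

Lemma sum_levels_ge b z M : 0 < b -> 0 <= z ->
  \sum_(i < M | z <= b * 2 ^+ i) z / (b * 2 ^+ i) <= 2.
Proof.
elim: M z => [|M ih] z b0 z0; first by rewrite big_ord0.
have bn0 i : 0 < b * 2 ^+ i by rewrite mulr_gt0 ?exprn_gt0.
have [zb|bz] := leP z b.
  apply: le_trans (_ : \sum_(i < M.+1) 2^-1 ^+ i <= 2).
    rewrite big_mkcond; apply: ler_sum => i _; case: ifP => _.
      rewrite ler_pdivrMr// exprVn mulrCA mulVf ?mulr1 ?expf_neq0//.
    by rewrite exprn_ge0// invr_ge0.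
  apply: le_trans (geometric_sum_le _ _) _; first by lra.
  by rewrite -[leRHS]invrK lef_pV2 ?posrE//; lra.
rewrite big_mkcond big_ord_recl/= expr0 mulr1 (lt_geF bz)/= add0r.
have z2 : 0 <= z / 2 by lra.
apply: le_trans (ih _ b0 z2); rewrite [leRHS]big_mkcond/=.
apply: ler_sum => i _; rewrite /bump/= exprS mulrCA ler_pdivrMr// [_ * 2]mulrC.
have -> : z / (2 * (b * 2 ^+ i)) = z / 2 / (b * 2 ^+ i) by rewrite invfM mulrA.
by [].
Qed.

End levels.

Section layers.
Context (R : realType) (T : finType) (lv : T -> nat) (le : rel T).
Hypothesis tT : is_tree lv le.
Implicit Types (phi mu m : T -> R) (P D : pred T).

(** Layer-cake form of the Carleson embedding: a Carleson measure [mu] of a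
    superlevel set of [phi] is controlled by [m] of its maximal cubes. *)
Lemma carleson_layers phi mu m P D (C t : R) b M :
  0 < t -> levels phi b M -> (forall S, 0 <= phi S) -> (forall S, 0 <= mu S) ->
  (forall Q, \sum_(S | P S && le S Q) mu S <= C * m Q) ->
  \sum_(S | P S && D S) mu S * phi S `^ t <=
    C * \sum_(i < M) (b * 2 ^+ i.+1) `^ t *
      \sum_(S | maximal le (fun S => D S && (b * 2 ^+ i < phi S)) S) m S.
Proof.
move=> t0 [b0 lev] phi0 mu0 Cm.
have bn0 i : 0 <= b * 2 ^+ i by rewrite mulr_ge0 ?exprn_ge0 ?(ltW b0).
apply: (@le_trans _ _ (\sum_(S | P S && D S) \sum_(i < M | b * 2 ^+ i < phi S)
    (b * 2 ^+ i.+1) `^ t * mu S)).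
  apply: ler_sum => S _; rewrite -mulr_suml mulrC ler_wpM2r//.
  have := phi0 S; rewrite le_eqVlt => /orP[/eqP <-|S0].
    by rewrite powR0 ?gt_eqF// sumr_ge0// => i _; rewrite powR_ge0.
  have [i bi ib] := lev _ S0.
  rewrite (bigD1 i)//= -[leLHS]addr0 lerD ?sumr_ge0//.
    by apply: ge0_ler_powR; rewrite ?nnegrE ?(ltW t0).
  by move=> j _; rewrite powR_ge0.
rewrite (exchange_big_dep predT)//= mulr_sumr; apply: ler_sum => i _.
rewrite -mulr_sumr mulrCA ler_wpM2l ?powR_ge0// mulr_sumr.
apply: (@le_trans _ _ (\sum_(S | maximal le (fun S => D S && (b * 2 ^+ i < phi S)) S)
    \sum_(S' | P S' && le S' S) mu S')).
  apply: ler_sum_union => // S /andP[/andP[PS DS] bS].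
  have DbS : D S && (b * 2 ^+ i < phi S) by rewrite DS.
  have [S' mS' SS'] :=
    maximal_above tT (P := fun S => D S && (b * 2 ^+ i < phi S)) DbS.
  by exists S' => //; rewrite PS.
by apply: ler_sum => S _; exact: Cm.
Qed.

(** Along a chain, at least half of the total mass sits on nodes whose tail
    still carries half of it. *)
Lemma chain_sum_powR (C : pred T) (a : T -> R) (r : R) :
  chain lv le C -> 1 < r -> (forall S, 0 <= a S) ->
  (\sum_(S | C S) a S) `^ r <=
    2 `^ r * \sum_(S | C S) a S * (\sum_(S' | C S' && le S' S) a S') `^ (r - 1).
Proof.
case: (tT) => rT aT trT lvT nT cC r1 a0.
set A := \sum_(S | C S) a S; pose t S := \sum_(S' | C S' && le S' S) a S'.
have A0 : 0 <= A by rewrite sumr_ge0.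
have t0 S : 0 <= t S by rewrite sumr_ge0.
have half : A / 2 <= \sum_(S | C S && (A / 2 <= t S)) a S.
  suff : \sum_(S | C S && ~~ (A / 2 <= t S)) a S <= A / 2.
    have : A = \sum_(S | C S && (A / 2 <= t S)) a S +
        \sum_(S | C S && ~~ (A / 2 <= t S)) a S.
      by rewrite -bigID.
    move: (\sum_(S | C S && (A / 2 <= t S)) a S)
      (\sum_(S | C S && ~~ (A / 2 <= t S)) a S) => X Y.
    by move: (A) => B e h; lra.
  case: (pickP (fun S => C S && ~~ (A / 2 <= t S))) => [S1 PS1|P0]; last first.
    by rewrite big_pred0// divr_ge0.
  case: (arg_minnP (P := fun S => C S && ~~ (A / 2 <= t S)) lv PS1) => S /andP[CS nS] minS.
  apply: le_trans (_ : t S <= _); last by rewrite ltW// ltNge.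
  apply: ler_sum_subpred => // S' /andP[CS' nS']; rewrite CS' cC// minS//.
  by rewrite CS'.
apply: (@le_trans _ _ (2 `^ r * \sum_(S | C S && (A / 2 <= t S)) a S * (A / 2) `^ (r - 1))).
  rewrite -mulr_suml.
  apply: (@le_trans _ _ (2 `^ r * (A / 2 * (A / 2) `^ (r - 1)))).
    have A20 : 0 <= A / 2 by rewrite divr_ge0.
    rewrite mulr_powRB1 ?(lt_trans _ r1)// -powRM//.
    by rewrite mulrCA divff ?mulr1.
  by rewrite ler_wpM2l ?powR_ge0// ler_wpM2r ?powR_ge0.
rewrite ler_wpM2l ?powR_ge0//.
apply: (@le_trans _ _ (\sum_(S | C S && (A / 2 <= t S)) a S * t S `^ (r - 1))).
  apply: ler_sum => S /andP[_ AS]; rewrite ler_wpM2l//.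
  by apply: ge0_ler_powR; rewrite ?nnegrE ?subr_ge0 ?(ltW r1) ?divr_ge0.
apply: ler_sum_subpred => [S /andP[]//|S _].
by rewrite mulr_ge0 ?powR_ge0.
Qed.

End layers.

(** * Stopping cubes *)

Section stopping.
Context (R : realType) (T : finType) (lv : T -> nat) (le : rel T).
Hypothesis tT : is_tree lv le.
Implicit Types (phi g v : T -> R) (b : R) (M : nat).

(** Principal cubes, chosen by levels and without recursion: [S] is selected if
    some dyadic level separates it from all its strict ancestors. *)
Definition stopping phi b M : pred T := fun S =>
  [exists i : 'I_M, (b * 2 ^+ i < phi S) &&
    [forall S', le S S' ==> (S' != S) ==> (phi S' <= b * 2 ^+ i)]].

Definition packed v (P : pred T) :=
  forall Q, \sum_(S | P S && le S Q) v S <= 3 * v Q.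

(** The stopping cubes of a fixed level strictly inside [Q] are disjoint, so
    their volume is at most [g Q] over that level; the levels that occur are
    those above the average of [g] on [Q], and sum to a geometric series. *)
Lemma stopping_packed phi g v b M : levels phi b M -> submeasure le g ->
  (forall S, 0 < v S) -> (forall S, phi S = g S / v S) ->
  packed v (stopping phi b M).
Proof.
case: (tT) => rT aT trT lvT nT [b0 lev] [g0 gS] v0 phiE Q.
have bn0 i : 0 < b * 2 ^+ i by rewrite mulr_gt0 ?exprn_gt0.
rewrite (bigID (pred1 Q))/= (_ : 3 = 1 + 2)%R; last by lra.
rewrite mulrDl mul1r; apply: lerD.
  apply: ler_sum_at_most1; first exact: ltW.
    by move=> S /andP[_ /eqP ->].
  by move=> S S' /andP[_ /eqP ->] /andP[_ /eqP ->].
pose A (i : nat) S := [&& le S Q, S != Q, b * 2 ^+ i < phi S &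
    [forall S', le S S' ==> (S' != S) ==> (phi S' <= b * 2 ^+ i)]].
apply: (@le_trans _ _ (\sum_(i < M | phi Q <= b * 2 ^+ i) \sum_(S | A i S) v S)).
  apply: (ler_sum_union (D := fun i : 'I_M => phi Q <= b * 2 ^+ i)
    (A := fun i : 'I_M => A i)) => [S|S]; first exact: ltW.
  move=> /andP[/andP[/existsP[i /andP[bi /forallP ai]] SQ] nSQ].
  exists i; last by rewrite /A SQ nSQ bi; apply/forallP.
  by have := ai Q; rewrite SQ eq_sym nSQ.
apply: (@le_trans _ _ (\sum_(i < M | phi Q <= b * 2 ^+ i) v Q * (phi Q / (b * 2 ^+ i)))).
  apply: ler_sum => i _; rewrite mulrA ler_pdivlMr// phiE [v Q * _]mulrC divfK ?gt_eqF//.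
  apply: le_trans (gS (A i) Q _ _); last first.
  - by move=> S /and4P[].
  - move=> S S' /and4P[SQ nSQ bS /forallP aS] /and4P[_ _ bS' _] SS'.
    apply/eqP; apply: contraTT bS' => nSS'; rewrite -leNgt.
    by have := aS S'; rewrite SS' eq_sym nSS'.
  rewrite mulr_suml; apply: ler_sum => S /and4P[_ _ + _].
  by rewrite phiE ltr_pdivlMr// mulrC => /ltW.
rewrite -mulr_sumr mulrC ler_wpM2r ?(ltW (v0 _))// sum_levels_ge// phiE.
by rewrite divr_ge0// ltW.
Qed.

Lemma stopping_above phi b M Q : levels phi b M -> 0 < phi Q ->
  exists S, [/\ stopping phi b M S, le Q S & phi Q <= 2 * phi S].
Proof.
move=> [b0 lev] Q0; have [i bi ib] := lev _ Q0.
have [S mS QS] := maximal_above tT (P := fun S => b * 2 ^+ i < phi S) bi.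
exists S; have /andP[bS /forallP aS] := mS; split=> //.
  apply/existsP; exists i; rewrite bS /=; apply/forallP => S'.
  apply/implyP => SS'; apply/implyP => nSS'; rewrite leNgt.
  by apply: contra nSS' => bS'; have := aS S'; rewrite bS' SS'.
by apply: le_trans ib _; rewrite exprS mulrCA ler_pM2l// ltW.
Qed.

End stopping.

(** * The tree inequality *)

Section discounted.
Context (R : realType) (T : finType) (lv : T -> nat) (le : rel T).
Hypothesis tT : is_tree lv le.
Implicit Types (mu : T -> R) (P : pred T) (x : R).

(** A measure-like quantity that remembers the mass of all descendants. It is
    additive over a generation up to a factor [x^-d], which geometric gains
    absorb; in return its sum over all cubes is no larger than that of [mu]. *)
Definition discounted x P mu S : R :=
  \sum_(S' | P S' && le S' S) x ^+ (lv S' - lv S) * mu S'.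

Lemma discounted_ge0 x P mu S : 0 <= x -> (forall Q, 0 <= mu Q) ->
  0 <= discounted x P mu S.
Proof. by move=> x0 mu0; rewrite sumr_ge0// => Q _; rewrite mulr_ge0// exprn_ge0. Qed.

Lemma discounted_ge x P mu S : 0 <= x -> (forall Q, 0 <= mu Q) -> P S ->
  mu S <= discounted x P mu S.
Proof.
case: (tT) => rT _ _ _ _ x0 mu0 PS.
rewrite /discounted (bigD1 S) ?PS ?rT//= subnn expr0 mul1r lerDl.
by rewrite sumr_ge0// => Q _; rewrite mulr_ge0// exprn_ge0.
Qed.

Lemma discounted_level x P mu S d : 0 < x -> (forall Q, 0 <= mu Q) ->
  x ^+ d * \sum_(S' | le S' S && (lv S' == lv S + d)%N) discounted x P mu S'
    <= discounted x P mu S.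
Proof.
case: (tT) => rT aT trT lvT nT x0 mu0; have x0' := ltW x0.
rewrite mulr_sumr; under eq_bigr do rewrite mulr_sumr.
rewrite (exchange_big_dep (fun S' => P S' && le S' S))/=; last first.
  by move=> S' Q /andP[S'S _] /andP[PQ QS']; rewrite PQ (trT S').
apply: ler_sum => Q /andP[PQ QS].
apply: ler_sum_at_most1.
- by rewrite mulr_ge0// exprn_ge0.
- move=> S' /andP[/andP[S'S /eqP e] /andP[_ QS']].
  rewrite mulrA -exprD e; have := lvT _ _ QS'; rewrite e => h.
  by rewrite (_ : d + _ = lv Q - lv S)%N//; lia.
- move=> S1 S2 /andP[/andP[_ /eqP e1] /andP[_ Q1]] /andP[/andP[_ /eqP e2] /andP[_ Q2]].
  by apply: (chain_lv_inj tT (@ancestors_chain _ _ _ tT Q)); rewrite // e1 e2.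
Qed.

Lemma discounted_total x P mu : 0 <= x < 1 -> (forall Q, 0 <= mu Q) ->
  \sum_(S | P S) discounted x P mu S <= (1 - x)^-1 * \sum_(S | P S) mu S.
Proof.
case: (tT) => rT aT trT lvT nT x01 mu0.
rewrite (exchange_big_dep P)/=; last by move=> S S' _ /andP[].
rewrite mulr_sumr; apply: ler_sum => Q PQ; rewrite -mulr_suml ler_wpM2r//.
apply: sum_expr_inj => // S S' /andP[PS /andP[_ QS]] /andP[PS' /andP[_ QS']] e.
apply: (chain_lv_inj tT (@ancestors_chain _ _ _ tT Q)) => //.
by have := lvT _ _ QS; have := lvT _ _ QS'; lia.
Qed.

End discounted.

Section exponents.
Context (R : realType).
Implicit Types (g s w nu r b eta : R).

(** Both bounds below interpolate between the hypothesis [g^b s <= w^r nu],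
    raised to the power [eta] or [1 - eta], and the trivial bound. *)
Lemma bump_upper g s w nu r b eta : 0 <= g -> 0 <= s -> 0 < w -> 0 <= nu ->
  0 < eta < 1 -> 1 < r -> g `^ b * s <= w `^ r * nu ->
  (g / w) `^ (r - 1) * s <=
  nu `^ eta * s `^ (1 - eta) * w `^ (eta * r - (r - 1)) * g `^ (r - 1 - eta * b).
Proof.
move=> g0 s0 w0 nu0 /andP[eta0 eta1] r1 h.
move: g0; rewrite le_eqVlt => /predU1P[<-|g0].
  by rewrite mul0r powR0 ?mul0r ?mulr_ge0 ?powR_ge0// gt_eqF// subr_gt0.
move: s0; rewrite le_eqVlt => /predU1P[<-|s0].
  by rewrite mulr0 !mulr_ge0 ?powR_ge0.
rewrite (_ : _ * s = (g `^ b * s) `^ eta *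
    (s `^ (1 - eta) * w `^ (- (r - 1)) * g `^ (r - 1 - eta * b))); last first.
  rewrite -(lnK (x := g))// -(lnK (x := s))// -(lnK (x := w))//.
  rewrite -expRN -!expRD -!expRM -!expRD -!expRM -!expRD; congr expR; ring.
rewrite (_ : _ * w `^ (eta * r - _) * _ = (w `^ r * nu) `^ eta *
    (s `^ (1 - eta) * w `^ (- (r - 1)) * g `^ (r - 1 - eta * b))); last first.
  rewrite [in RHS]powRM ?powR_ge0// -powRrM [w `^ (_ - _)]powRD; last first.
    by rewrite (gt_eqF w0) implybT.
  by rewrite [r * eta]mulrC; ring.
rewrite ler_wpM2r ?mulr_ge0 ?powR_ge0//.
by apply: ge0_ler_powR; rewrite ?nnegrE ?mulr_ge0 ?powR_ge0// ltW.
Qed.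

Lemma bump_lower g s w nu r b eta : 0 <= g -> 0 <= s -> 0 < w -> 0 <= nu ->
  0 < eta < 1 -> g `^ b * s <= w `^ r * nu ->
  (g / w) *
  (nu `^ eta * s `^ (1 - eta) * w `^ (eta * r - (r - 1)) * g `^ (r - 1 - eta * b))
  <= nu * g `^ (r - b).
Proof.
move=> g0 s0 w0 nu0 /andP[eta0 eta1] h.
move: g0; rewrite le_eqVlt => /predU1P[<-|g0].
  by rewrite mul0r mul0r mulr_ge0 ?powR_ge0.
move: s0; rewrite le_eqVlt => /predU1P[<-|s0].
  rewrite [0 `^ _]powR0 ?mulr0 ?mul0r ?mulr0 ?mulr_ge0 ?powR_ge0//.
  by rewrite gt_eqF// subr_gt0.
move: nu0; rewrite le_eqVlt => /predU1P[<-|nu0].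
  by rewrite [0 `^ _]powR0 ?mul0r ?mulr0// gt_eqF.
apply: (@le_trans _ _ ((g `^ b * s) `^ (1 - eta) *
    (nu `^ eta * w `^ (eta * r - r) * g `^ (r - b)))).
  rewrite le_eqVlt; apply/orP; left; apply/eqP.
  rewrite -(lnK (x := g))// -(lnK (x := s))// -(lnK (x := w))// -(lnK (x := nu))//.
  rewrite -expRN -!expRD -!expRM -!expRD -!expRM -!expRD; congr expR; ring.
apply: (@le_trans _ _ ((w `^ r * nu) `^ (1 - eta) *
    (nu `^ eta * w `^ (eta * r - r) * g `^ (r - b)))).
  rewrite ler_wpM2r ?mulr_ge0 ?powR_ge0//.
  apply: ge0_ler_powR; rewrite ?nnegrE ?mulr_ge0 ?powR_ge0 ?subr_ge0 ?(ltW eta1)//;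
    exact: ltW.
rewrite le_eqVlt; apply/orP; left; apply/eqP.
rewrite -(lnK (x := g))// -(lnK (x := w))// -(lnK (x := nu))//.
rewrite -!expRM -!expRD -!expRM -!expRD; congr expR; ring.
Qed.

(** The constant 2 comes from replacing Young's inequality by
    [x^eta y^(1 - eta) <= max(x, y) <= x + y]. *)
Lemma holder_sum (T : finType) (P : pred T) (X Y : T -> R) eta :
  0 < eta < 1 -> (forall S, 0 <= X S) -> (forall S, 0 <= Y S) ->
  \sum_(S | P S) X S `^ eta * Y S `^ (1 - eta) <=
  2 * ((\sum_(S | P S) X S) `^ eta * (\sum_(S | P S) Y S) `^ (1 - eta)).
Proof.
move=> /andP[eta0 eta1] X0 Y0.
set A := \sum_(S | P S) X S; set B := \sum_(S | P S) Y S.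
have e1 : 0 < 1 - eta by rewrite subr_gt0.
have A0 : 0 <= A by rewrite sumr_ge0.
have B0 : 0 <= B by rewrite sumr_ge0.
have XA S : P S -> X S <= A by move=> PS; rewrite /A (bigD1 S)//= lerDl sumr_ge0.
have YB S : P S -> Y S <= B by move=> PS; rewrite /B (bigD1 S)//= lerDl sumr_ge0.
have c0 : 0 <= 2 * (A `^ eta * B `^ (1 - eta)) by rewrite !mulr_ge0 ?powR_ge0.
have [A00|A00] := eqVneq A 0.
  rewrite big1// => S PS; have := XA _ PS; rewrite A00 => XS.
  by rewrite (_ : X S = 0) ?powR0 ?mul0r ?gt_eqF//; apply/eqP; rewrite eq_le X0 XS.
have [B00|B00] := eqVneq B 0.
  rewrite big1// => S PS; have := YB _ PS; rewrite B00 => YS.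
  by rewrite (_ : Y S = 0) ?[0 `^ _]powR0 ?mulr0 ?gt_eqF//; apply/eqP; rewrite eq_le Y0 YS.
have Ap : 0 < A by rewrite lt_neqAle eq_sym A00.
have Bp : 0 < B by rewrite lt_neqAle eq_sym B00.
apply: (@le_trans _ _ (\sum_(S | P S) (A `^ eta * B `^ (1 - eta)) * (X S / A + Y S / B))).
  apply: ler_sum => S _.
  have XA0 : 0 <= X S / A by rewrite divr_ge0.
  have YB0 : 0 <= Y S / B by rewrite divr_ge0.
  have -> : X S `^ eta * Y S `^ (1 - eta) =
      A `^ eta * B `^ (1 - eta) * ((X S / A) `^ eta * (Y S / B) `^ (1 - eta)).
    by rewrite [RHS]mulrACA -!powRM// (mulrC A) (mulrC B) !divfK.
  rewrite ler_wpM2l ?mulr_ge0 ?powR_ge0//.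
  set z := X S / A + Y S / B; have z0 : 0 <= z by rewrite addr_ge0.
  rewrite (_ : z = z `^ eta * z `^ (1 - eta)); last first.
    by rewrite -powRD ?subrKC ?powRr1// (gt_eqF ltr01).
  rewrite ler_pM ?powR_ge0//; apply: ge0_ler_powR;
    rewrite ?nnegrE ?(ltW eta0) ?(ltW e1)//.
    by rewrite /z ler_wpDr.
  by rewrite /z ler_wpDl.
rewrite -mulr_sumr mulrC big_split/= -!mulr_suml !divff//.
Qed.

End exponents.

Definition side (R : realType) (T : finType) (lv : T -> nat) (L : R) Q : R :=
  L * 2^-1 ^+ lv Q.

Section side.
Context (R : realType) (T : finType) (lv : T -> nat).
Implicit Types (L t : R).

Lemma side_gt0 L Q : 0 < L -> 0 < side lv L Q.
Proof. by move=> L0; rewrite mulr_gt0// exprn_gt0// invr_gt0. Qed.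

Lemma side_powR L t Q S : 0 < L -> (lv S <= lv Q)%N ->
  side lv L Q `^ t = side lv L S `^ t * (2 `^ (- t)) ^+ (lv Q - lv S).
Proof.
move=> L0 h; rewrite /side -{1}(subnKC h) exprD mulrA.
rewrite [LHS]powRM; last 2 first.
- by rewrite mulr_ge0 ?(ltW L0)// exprn_ge0// invr_ge0.
- by rewrite exprn_ge0// invr_ge0.
congr (_ * _); rewrite -[RHS]powR_mulrn ?powR_ge0// -powRrM mulNr mulrC.
by rewrite powRN powRrM powR_mulrn// exprVn -powR_inv1 ?powR_ge0 ?exprn_ge0// powRAC powR_inv1 ?powR_ge0.
Qed.

End side.

Section tree_sums.
Context (R : realType) (T : finType) (lv : T -> nat) (le : rel T).
Hypothesis tT : is_tree lv le.
Implicit Types (P C : pred T) (g s a : T -> R) (k eta : R).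

(** With weights growing in the generation, the power of a sum becomes a sum of
    powers, which can be integrated term by term. *)
Lemma tail_sum_powR C (a : T -> R) k beta S : chain lv le C ->
  0 < k < 1 -> 0 < beta -> (forall S, 0 <= a S) ->
  (\sum_(S' | C S' && le S' S) a S') `^ beta <=
  (1 - k `^ beta^-1)^-1 `^ beta *
    \sum_(S' | C S' && le S' S) k^-1 ^+ (lv S' - lv S) * a S' `^ beta.
Proof.
case: (tT) => rT aT trT lvT nT cC /andP[k0 k1] b0 a0.
pose rho := k^-1 `^ beta^-1.
have rho1 : 1 < rho by rewrite powR_gt1 ?invr_gt0// invf_gt1.
have rhoV : k `^ beta^-1 = rho^-1.
  rewrite /rho -powRN -[in LHS](invrK k) -[in LHS]powR_inv1 ?invr_ge0 ?(ltW k0)//.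
  by rewrite -powRrM mulN1r.
rewrite rhoV; apply: le_trans (powR_sum_geometric (f := fun S' => (lv S' - lv S)%N)
    (rho := rho) rho1 b0 a0 _) _.
  move=> S1 S2 /andP[C1 S1S] /andP[C2 S2S] e.
  apply: (chain_lv_inj tT cC) => //.
  by have := lvT _ _ S1S; have := lvT _ _ S2S; lia.
rewrite ler_wpM2l ?powR_ge0//; apply: ler_sum => S' _.
rewrite powRM// ?exprn_ge0 ?(ltW (lt_trans _ rho1))//.
have rb : rho `^ beta = k^-1.
  by rewrite /rho -powRrM mulVf ?gt_eqF// powRr1// invr_ge0 ltW.
rewrite -[rho ^+ _]powR_mulrn ?(ltW (lt_trans _ rho1))// powRAC rb.
by rewrite powR_mulrn// invr_ge0 ltW.
Qed.

Lemma submeasure_mono (m : T -> R) Q S : submeasure le m -> le Q S -> m Q <= m S.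
Proof.
move=> [m0 mS] QS.
have := mS (pred1 Q) S; rewrite big_pred1_eq; apply.
  by move=> S1 S2 /eqP -> /eqP ->.
by move=> S1 /eqP ->.
Qed.

Section bump.
Variables (g s w mu : T -> R) (P : pred T) (k eta e1 e3 : R).
Hypotheses (sg : submeasure le g) (ss : submeasure le s).
Hypotheses (w0 : forall S, 0 < w S) (mu0 : forall S, 0 <= mu S).
Hypotheses (k01 : 0 < k < 1) (eta01 : 0 < eta < 1) (e30 : 0 <= e3).
Hypothesis wk : forall Q S, le Q S ->
  w Q `^ e1 = w S `^ e1 * (k ^+ 4) ^+ (lv Q - lv S).

(** The interpolated majorant
    [(g / w)^(r - 1) s (w^r nu / (g^b s))^eta] of [(g / w)^(r - 1) s],
    with its factors collected so that no exponent is negative. *)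
Definition bump S : R :=
  discounted lv le (k ^+ 2) P mu S `^ eta * s S `^ (1 - eta) *
  w S `^ e1 * g S `^ e3.

Let nu := discounted lv le (k ^+ 2) P mu.

Let nu0 S : 0 <= nu S.
Proof. by apply: discounted_ge0 => //; rewrite exprn_ge0// ltW//; case/andP: k01. Qed.

Lemma bump_ge0 S : 0 <= bump S.
Proof. by rewrite !mulr_ge0 ?powR_ge0. Qed.

(** The factor [w^e1] gains [k^(4d)], the discount loses at most [k^(-2d)]. *)
Lemma bump_level S d :
  \sum_(S' | le S' S && (lv S' == lv S + d)%N) bump S' <= 2 * (k ^+ 2) ^+ d * bump S.
Proof.
have /andP[k0 k1] := k01; have /andP[eta0 eta1] := eta01.
have [g0 gS] := sg; have [s0 sS] := ss.
have kk0 : 0 < k ^+ 2 by rewrite exprn_gt0.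
have kd0 : 0 < (k ^+ 2) ^+ d by rewrite exprn_gt0.
have aA : antichain le (fun S' => le S' S && (lv S' == lv S + d)%N).
  move: (@level_antichain _ _ _ tT (lv S + d)%N); apply: sub_antichain.
  by move=> S' /andP[].
apply: (@le_trans _ _ (\sum_(S' | le S' S && (lv S' == lv S + d)%N)
    (nu S' `^ eta * s S' `^ (1 - eta)) * (w S `^ e1 * (k ^+ 4) ^+ d * g S `^ e3))).
  apply: ler_sum => S' /andP[S'S /eqP e]; rewrite /bump -/nu -mulrA ler_wpM2l//.
    by rewrite mulr_ge0 ?powR_ge0.
  rewrite (wk S'S) e addKn ler_wpM2l ?mulr_ge0 ?powR_ge0 ?exprn_ge0 ?(ltW k0)//.
  by apply: ge0_ler_powR; rewrite ?nnegrE//; exact: submeasure_mono.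
rewrite -mulr_suml.
apply: (@le_trans _ _ (2 * ((((k ^+ 2) ^+ d)^-1 * nu S `^ eta) * s S `^ (1 - eta)) *
   (w S `^ e1 * (k ^+ 4) ^+ d * g S `^ e3))); last first.
  rewrite /bump -/nu -(exprM k 4) -(exprM k 2) (_ : 4 * d = 2 * d + 2 * d)%N; last by lia.
  rewrite exprD le_eqVlt; apply/orP; left; apply/eqP.
  have : k ^+ (2 * d) != 0 by rewrite expf_neq0// gt_eqF.
  move: (k ^+ _) (nu S `^ _) (s S `^ _) (w S `^ _) (g S `^ _) => x y z t v x0.
  by field.
rewrite ler_wpM2r ?mulr_ge0 ?powR_ge0 ?exprn_ge0 ?(ltW k0)//.
apply: le_trans (holder_sum _ eta01 nu0 s0) _.
rewrite ler_wpM2l// ler_pM ?powR_ge0//; last first.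
  apply: ge0_ler_powR; rewrite ?nnegrE ?subr_ge0 ?(ltW eta1) ?sumr_ge0//.
  by apply: sS => // S' /andP[].
apply: (@le_trans _ _ ((((k ^+ 2) ^+ d)^-1 * nu S) `^ eta)).
  apply: ge0_ler_powR; rewrite ?nnegrE ?(ltW eta0) ?sumr_ge0 ?mulr_ge0 ?invr_ge0 ?(ltW kd0)//.
  by rewrite ler_pdivlMl// discounted_level.
rewrite powRM ?invr_ge0 ?(ltW kd0)// ler_wpM2r ?powR_ge0//.
by rewrite ler1_powR ?(ltW eta1)// invf_ge1// exprn_ile1 ?exprn_ge0 ?exprn_ile1 ?ltW.
Qed.

Lemma bump_tail S :
  \sum_(S' | P S' && le S' S) k^-1 ^+ (lv S' - lv S) * bump S' <=
  2 * (1 - k)^-1 * bump S.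
Proof.
case: (tT) => rT aT trT lvT nT.
have /andP[k0 k1] := k01.
have kV n : 0 <= k^-1 ^+ n by rewrite exprn_ge0// invr_ge0 ltW.
pose N := (\sum_S lv S).+1.
have lvN Q : (lv Q < N)%N by rewrite ltnS /N (bigD1 Q)//= leq_addr.
pose A (d : 'I_N) := fun S' => le S' S && (lv S' == lv S + d)%N.
apply: (@le_trans _ _ (\sum_(d < N) \sum_(S' | A d S') k^-1 ^+ (lv S' - lv S) * bump S')).
  apply: (ler_sum_union (D := predT)).
    by move=> S'; rewrite mulr_ge0 ?bump_ge0.
  move=> S' /andP[_ S'S]; have h : (lv S' - lv S < N)%N.
    by apply: leq_ltn_trans (lvN S'); rewrite leq_subr.
  by exists (Ordinal h) => //; rewrite /A S'S/= subnKC ?lvT.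
apply: (@le_trans _ _ (\sum_(d < N) k ^+ d * (2 * bump S))); last first.
  rewrite -mulr_suml [leRHS](_ : _ = (1 - k)^-1 * (2 * bump S)); last by ring.
  apply: ler_wpM2r; first by rewrite pmulr_rge0 ?bump_ge0.
  by apply: geometric_sum_le; rewrite (ltW k0).
apply: ler_sum => d _.
apply: (@le_trans _ _ (k^-1 ^+ d * \sum_(S' | A d S') bump S')).
  rewrite mulr_sumr; apply: ler_sum => S' /andP[_ /eqP ->].
  by rewrite addKn.
apply: le_trans (ler_wpM2l (kV d) (bump_level S d)) _.
rewrite le_eqVlt; apply/orP; left; apply/eqP.
rewrite exprVn -exprM mulnC mulnS muln1 exprD.
have : k ^+ d != 0 by rewrite expf_neq0// gt_eqF.
by move: (k ^+ d) (bump S) => x y x0; field.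
Qed.

End bump.
End tree_sums.

Section carleson_ratio.
Context (R : realType) (T : finType) (lv : T -> nat) (le : rel T).
Hypothesis tT : is_tree lv le.

(** The weak-type bound [u(max cubes of {g/u > l}) <= G / l] integrates because
    [b > 1] and only levels [l < 1] occur. *)
Lemma carleson_ratio (P : pred T) (mu g u : T -> R) (b C G : R) :
  1 < b -> 0 <= C -> 0 <= G -> (forall S, 0 <= mu S) -> (forall S, 0 <= g S) ->
  (forall S, g S <= u S) ->
  (forall A : pred T, antichain le A -> \sum_(S | A S) g S <= G) ->
  (forall Q, \sum_(S | P S && le S Q) mu S <= C * u Q) ->
  \sum_(S | P S) mu S * (g S / u S) `^ b <=
    2 `^ b * (2 `^ (b - 1) / (2 `^ (b - 1) - 1)) * (C * G).
Proof.
move=> b1 C0 G0 mu0 g0 gu AG Cu.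
have b0 : 0 < b by apply: lt_trans b1.
have bb0 : 0 < b - 1 by rewrite subr_gt0.
have u0 S : 0 <= u S by apply: le_trans (gu S).
have gu0 S : 0 <= g S / u S by rewrite divr_ge0.
have gu1 S : g S / u S <= 1.
  have := u0 S; rewrite le_eqVlt => /predU1P[<-|uS]; first by rewrite invr0 mulr0.
  by rewrite ler_pdivrMr// mul1r.
have [l [M lev]] := exists_levels gu0.
have [l0 _] := lev.
have ln0 i : 0 < l * 2 ^+ i by rewrite mulr_gt0 ?exprn_gt0.
have := carleson_layers tT predT b0 lev gu0 mu0 Cu.
rewrite (eq_bigl P); last by move=> S; rewrite andbT.
move=> h; apply: le_trans h _; rewrite [leRHS]mulrCA ler_wpM2l//.
apply: (@le_trans _ _ (\sum_(i < M | l * 2 ^+ i < 1)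
    2 `^ b * (l * 2 ^+ i) `^ (b - 1) * G)).
  rewrite [leRHS]big_mkcond; apply: ler_sum => i _; case: ifPn => li; last first.
    rewrite big_pred0 ?mulr0// => S; apply/negP => /maximal_sub/= liS.
    by move: li; rewrite (lt_le_trans liS).
  rewrite exprS mulrCA [(2 * _) `^ b]powRM ?(ltW (ln0 _))//.
  rewrite -[(l * _) `^ b](mulr_powRB1 (ltW (ln0 i)) b0); set z := l * 2 ^+ i.
  rewrite [leLHS](_ : _ = 2 `^ b * z `^ (b - 1) * (z *
    \sum_(S | maximal le (fun S => predT S && (z < g S / u S)) S) u S)); last by ring.
  rewrite ler_wpM2l ?mulr_ge0 ?powR_ge0// mulr_sumr.
  apply: (le_trans _ (AG _ (maximal_antichain (le := le) (P := _)))).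
  apply: ler_sum => S /maximal_sub/=.
  have := u0 S; rewrite le_eqVlt => /predU1P[<- _|uS]; first by rewrite mulr0.
  by rewrite ltr_pdivlMr// => /ltW.
rewrite -mulr_suml -mulr_sumr mulrC [leRHS]mulrC ler_wpM2l// ler_wpM2l ?powR_ge0//.
by apply: le_trans (sum_levels_le M l0 bb0 ler01) _; rewrite powR1 mulr1.
Qed.

End carleson_ratio.

Section tree_inequality.
Context (R : realType).

(** Each cube is charged to a stopping ancestor whose average is at least half
    of its own, and the factors [side^alpha] below that ancestor sum to a
    geometric series. *)
Lemma stopping_dominates (T : finType) (lv : T -> nat) (le : rel T)
    (phi : T -> R) (l alpha L : R) M (C : pred T) :
  is_tree lv le -> 0 < L -> 0 < alpha -> levels phi l M ->
  (forall Q, 0 <= phi Q) -> chain lv le C -> upclosed le C ->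
  \sum_(Q | C Q) side lv L Q `^ alpha * phi Q <=
  2 / (1 - 2 `^ (- alpha)) *
    \sum_(S | C S && stopping le phi l M S) side lv L S `^ alpha * phi S.
Proof.
move=> tT L0 a0 lev phi0 cC uC; case: (tT) => rT aT trT lvT nT.
pose A S := fun Q => [&& C Q, le Q S & phi Q <= 2 * phi S].
apply: (@le_trans _ _ (\sum_(S | C S && stopping le phi l M S) \sum_(Q | A S Q)
   side lv L Q `^ alpha * phi Q)).
  rewrite (bigID (fun Q => 0 < phi Q))/= [X in _ + X]big1 ?addr0; last first.
    move=> Q /andP[_]; rewrite -leNgt => Q0.
    by rewrite (_ : phi Q = 0) ?mulr0//; apply/eqP; rewrite eq_le Q0 phi0.
  apply: ler_sum_union => [Q|Q /andP[CQ Q0]]; first by rewrite mulr_ge0 ?powR_ge0.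
  have [S [sS QS QS2]] := stopping_above tT lev Q0.
  by exists S; rewrite /A ?CQ ?QS// sS (uC Q).
rewrite mulr_sumr; apply: ler_sum => S /andP[CS sS].
have x01 : 0 <= (2 `^ (- alpha) : R) < 1.
  by rewrite powR_ge0/= powRN invf_lt1 ?powR_gt0// powR_gt1// ltr1n.
apply: (@le_trans _ _ (\sum_(Q | C Q && le Q S) (2 `^ (- alpha)) ^+ (lv Q - lv S) *
    (side lv L S `^ alpha * (2 * phi S)))).
  apply: (@le_trans _ _ (\sum_(Q | A S Q) (2 `^ (- alpha)) ^+ (lv Q - lv S) *
    (side lv L S `^ alpha * (2 * phi S)))).
    apply: ler_sum => Q /and3P[CQ QS h]; rewrite (side_powR _ L0 (lvT _ _ QS)).
    by rewrite mulrA [X in X * _]mulrC -!mulrA ler_wpM2l ?exprn_ge0 ?powR_ge0// ler_wpM2l ?powR_ge0.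
  apply: ler_sum_subpred => [Q /and3P[-> ->//]|Q _].
  by rewrite !mulr_ge0 ?exprn_ge0 ?powR_ge0.
rewrite -mulr_suml [leRHS](_ : _ = (1 - 2 `^ (- alpha))^-1 *
    (side lv L S `^ alpha * (2 * phi S))); last by ring.
rewrite ler_wpM2r ?mulr_ge0 ?powR_ge0//.
apply: sum_expr_inj => // Q Q' /andP[CQ QS] /andP[CQ' Q'S] e.
apply: (chain_lv_inj tT cC) => //.
by rewrite -(subnK (lvT _ _ QS)) e subnK ?lvT.
Qed.

(** Dual testing on a tree. The potential [sum g / side^(n - alpha)] is first
    reduced to stopping cubes [P]; its [r]-th power is expanded along chains as
    [sum_S a_S sum_(S' <= S) k^-d a_S'^(r-1)], and the inner sum, integrated
    against [s], is at most a multiple of [bump S] since [bump] decays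
    geometrically in the generations. As [a_S bump S <= nu_S G^(r - b)], what
    remains is the total of the discounted Carleson measure [nu]. *)
Lemma tree_inequality (n : nat) (alpha r b : R) :
  0 < alpha < n%:R -> 1 < b < r ->
  exists2 c : R, 0 < c &
  forall (T : finType) (lv : T -> nat) (le : rel T) (L : R)
    (g s u mu : T -> R) (C G : R),
    is_tree lv le -> 0 < L -> submeasure le g -> submeasure le s ->
    (forall S, 0 <= mu S) -> (forall S, g S <= u S) -> 0 <= C -> 0 <= G ->
    (forall A : pred T, antichain le A -> \sum_(S | A S) g S <= G) ->
    (forall P, packed le (fun S => side lv L S ^+ n) P ->
      forall Q, \sum_(S | P S && le S Q) mu S <= C * u Q) ->
    (forall S, u S `^ b * s S <= (side lv L S `^ (n%:R - alpha)) `^ r * mu S) ->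
    exists psi : T -> R,
    [/\ (forall S, 0 <= psi S),
        (forall X : pred T, chain lv le X -> upclosed le X ->
          (\sum_(S | X S) g S / side lv L S `^ (n%:R - alpha)) `^ r <=
            \sum_(S | X S) psi S) &
        \sum_S psi S * s S <= c * (C * G `^ (r - b + 1))].
Proof.
move=> /andP[al0 aln] /andP[b1 br].
have r1 : 1 < r by apply: lt_trans br.
have b0 : 0 < b by apply: lt_trans b1.
pose beta := r - 1; have be0 : 0 < beta by rewrite subr_gt0.
(* Needed: [(r - 1) / r < eta] for [0 < e1], [eta <= (r - 1) / b] for [0 <= e3],
   and [eta < 1]; there is such an [eta] because [b < r]. *)
pose m := Num.max b (r - 2^-1).
have mb : b <= m by rewrite le_max lexx.
have mr : m < r by rewrite gt_max br/=; lra.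
have m1 : beta < m by rewrite lt_max; apply/orP; right; rewrite /beta; lra.
have m0 : 0 < m by apply: lt_trans m1.
pose eta := beta / m.
have eta01 : 0 < eta < 1 by rewrite divr_gt0//= ltr_pdivrMr// mul1r.
pose e1 := eta * r - beta.
have e10 : 0 < e1.
  by rewrite /e1 /eta -mulrA -{2}[beta]mulr1 -mulrBr mulr_gt0// subr_gt0 mulrC ltr_pdivlMr ?mul1r.
pose e3 := beta - eta * b.
have e30 : 0 <= e3.
  rewrite /e3 /eta mulrAC subr_ge0 ler_pdivrMr// ler_wpM2l//; exact: ltW.
pose d0 := n%:R - alpha; have d00 : 0 < d0 by rewrite subr_gt0.
(* [side^(d0 e1)] gains [k^4] per generation: two powers pay for the discount,
   one for the weights of [tail_sum_powR], and one makes the sum converge. *)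
pose k : R := 2 `^ (- (d0 * e1 / 4)).
have k01 : 0 < k < 1.
  rewrite powR_gt0//= /k powRN invf_lt1 ?powR_gt0// powR_gt1 ?ltr1n//.
  by rewrite !mulr_gt0.
have /andP[k0 k1] := k01.
have k2 : 0 <= k ^+ 2 < 1 by rewrite exprn_ge0 ?(ltW k0)//= exprn_ilt1 ?(ltW k0).
have k20 : 0 < k ^+ 2 by rewrite exprn_gt0.
have x1 : 0 < 1 - 2 `^ (- alpha) :> R.
  by rewrite subr_gt0 powRN invf_lt1 ?powR_gt0// powR_gt1 ?ltr1n.
pose cA : R := 2 / (1 - 2 `^ (- alpha)); have cA0 : 0 < cA by rewrite divr_gt0.
have kb1 : k `^ beta^-1 < 1.
  by rewrite /k -powRrM mulNr powRN invf_lt1 ?powR_gt0// powR_gt1 ?ltr1n ?mulr_gt0 ?invr_gt0.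
pose cB : R := (1 - k `^ beta^-1)^-1 `^ beta.
have cB0 : 0 < cB by rewrite powR_gt0// invr_gt0 subr_gt0.
pose c0 := cA `^ r * (2 `^ r * cB).
have c00 : 0 < c0.
  by apply: mulr_gt0; [exact: powR_gt0|apply: mulr_gt0 => //; exact: powR_gt0].
have tb : 1 < 2 `^ (b - 1) :> R by rewrite powR_gt1 ?ltr1n ?subr_gt0.
pose cW : R := 2 `^ b * (2 `^ (b - 1) / (2 `^ (b - 1) - 1)).
have cW0 : 0 < cW by rewrite !mulr_gt0 ?powR_gt0 ?invr_gt0 ?subr_gt0.
pose cK : R := 2 * (1 - k)^-1; have cK0 : 0 < cK by rewrite mulr_gt0 ?invr_gt0 ?subr_gt0.
pose cN : R := (1 - k ^+ 2)^-1.
have cN0 : 0 < cN by rewrite invr_gt0 subr_gt0; case/andP: k2.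
exists (c0 * cK * cN * cW); first by do 3!apply: mulr_gt0 => //.
move=> T lv le L g s u mu C G tT L0 sg ss mu0 gu C0 G0 AG car cond.
have [g0 gS] := sg; have [s0 sS] := ss.
case: (tT) => rT aT trT lvT nT.
have u0 S : 0 <= u S by apply: le_trans (gu S).
have l0 S : 0 < side lv L S by exact: side_gt0.
pose v S := side lv L S ^+ n.
have v0 S : 0 < v S by rewrite exprn_gt0.
pose w S := side lv L S `^ d0.
have w0 S : 0 < w S by rewrite powR_gt0.
pose phi S := g S / v S.
have phi0 S : 0 <= phi S by rewrite divr_ge0// ltW.
have [l [M lev]] := exists_levels phi0.
pose P := stopping le phi l M.
have pP : packed le v P by apply: (stopping_packed tT lev sg).
pose a S := g S / w S.
have a0 S : 0 <= a S by rewrite divr_ge0// ltW.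
have aE S : a S = side lv L S `^ alpha * phi S.
  rewrite /a /phi /w /v /d0 powRB ?(gt_eqF (l0 _)) ?implybT//.
  rewrite powR_mulrn ?(ltW (l0 _))// invf_div; field.
  by rewrite expf_neq0 ?gt_eqF// powR_gt0.
pose mut S := mu S * (g S / u S) `^ b.
have mut0 S : 0 <= mut S by rewrite mulr_ge0 ?powR_ge0.
have condt S : g S `^ b * s S <= w S `^ r * mut S.
  have := u0 S; rewrite le_eqVlt => /predU1P[uS|uS].
    have -> : g S = 0 by apply/eqP; rewrite eq_le g0 andbT [in leRHS]uS.
    by rewrite powR0 ?gt_eqF// mul0r !mulr_ge0 ?powR_ge0.
  rewrite -{1}[g S](divfK (lt0r_neq0 uS)) powRM ?divr_ge0// /mut.
  by rewrite mulrA [leRHS]mulrC -mulrA ler_wpM2l ?powR_ge0.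
pose nu := discounted lv le (k ^+ 2) P mut.
have nu0 S : 0 <= nu S by apply: discounted_ge0 => //; exact: ltW.
have condn S : P S -> g S `^ b * s S <= w S `^ r * nu S.
  move=> PS; apply: le_trans (condt S) _; rewrite ler_wpM2l ?powR_ge0//.
  by apply: discounted_ge => //; exact: ltW.
have wk Q S : le Q S -> w Q `^ e1 = w S `^ e1 * (k ^+ 4) ^+ (lv Q - lv S).
  move=> QS; rewrite /w -!powRrM (side_powR _ L0 (lvT _ _ QS)); congr (_ * _ ^+ _).
  by rewrite /k -powR_mulrn ?powR_ge0// -powRrM mulNr divfK.
pose B := bump lv le g s w mut P k eta e1 e3.
have B0 S : 0 <= B S by apply: bump_ge0.
have Bu S : P S -> a S `^ beta * s S <= B S.
  by move=> PS; apply: bump_upper => //; exact: condn.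
have gG S : g S <= G.
  have := AG (pred1 S); rewrite big_pred1_eq; apply.
  by move=> S1 S2 /eqP -> /eqP ->.
have Bl S : P S -> a S * B S <= nu S * G `^ (r - b).
  move=> PS; apply: (@le_trans _ _ (nu S * g S `^ (r - b))).
    by apply: bump_lower => //; exact: condn.
  by rewrite ler_wpM2l// ge0_ler_powR ?nnegrE// subr_ge0 ltW.
pose psi S' := if P S' then c0 * (a S' `^ beta *
  \sum_(S | P S && le S' S) a S * k^-1 ^+ (lv S' - lv S)) else 0.
have kV i : 0 <= k^-1 ^+ i by rewrite exprn_ge0// invr_ge0 ltW.
have psi0 S : 0 <= psi S.
  rewrite /psi; case: ifP => // _; rewrite mulr_ge0 ?(ltW c00)// mulr_ge0 ?powR_ge0//.
  by rewrite sumr_ge0// => S' _; rewrite mulr_ge0.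
exists psi; split=> //.
  move=> X cX uX.
  have cXP : chain lv le (fun S => X S && P S) by move: cX; apply: sub_chain => S /andP[].
  apply: (@le_trans _ _ ((cA * \sum_(S | X S && P S) a S) `^ r)).
    have r0 : 0 <= r by rewrite ltW// (lt_trans _ r1).
    apply: ge0_ler_powR => //; rewrite ?nnegrE.
    - by apply: sumr_ge0 => S _; exact: a0.
    - by apply: mulr_ge0; [exact: ltW|apply: sumr_ge0 => S _; exact: a0].
    have sE (A : pred T) : \sum_(S | A S) a S =
        \sum_(S | A S) side lv L S `^ alpha * phi S by exact: eq_bigr.
    by rewrite -/a !sE; exact: stopping_dominates.
  rewrite powRM ?sumr_ge0 ?(ltW cA0)//.
  apply: le_trans (ler_wpM2l (powR_ge0 _ _) (chain_sum_powR tT cXP r1 a0)) _.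
  rewrite mulrA.
  apply: (@le_trans _ _ (cA `^ r * 2 `^ r * \sum_(S | X S && P S) a S *
     (cB * \sum_(S' | X S' && P S' && le S' S) k^-1 ^+ (lv S' - lv S) * a S' `^ beta))).
    rewrite ler_wpM2l ?mulr_ge0 ?powR_ge0//; apply: ler_sum => S _.
    rewrite ler_wpM2l//; exact: tail_sum_powR.
  under eq_bigr do rewrite mulrCA.
  rewrite -mulr_sumr !mulrA -[_ * cB]mulrA -/c0.
  rewrite [leRHS](bigID P)/= -[leLHS]addr0 lerD//; last by rewrite sumr_ge0.
  under eq_bigr do rewrite mulr_sumr.
  rewrite (exchange_big_dep (fun S' => X S' && P S'))/=; last first.
    by move=> S S' _ /andP[].
  rewrite mulr_sumr; apply: ler_sum => S' /andP[XS' PS'].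
  have -> : psi S' = c0 * (a S' `^ beta *
      \sum_(S | P S && le S' S) a S * k^-1 ^+ (lv S' - lv S)).
    by rewrite /psi PS'.
  rewrite ler_wpM2l ?(ltW c00)// mulr_sumr.
  apply: (@le_trans _ _ (\sum_(S | (X S && P S) && (X S' && P S' && le S' S))
     a S' `^ beta * (a S * k^-1 ^+ (lv S' - lv S)))).
    by apply: ler_sum => S _; rewrite [leLHS]mulrA [leLHS]mulrC.
  apply: ler_sum_subpred => [S /andP[/andP[_ ->] /andP[_ ->]]//|S _].
  by apply: mulr_ge0; [exact: powR_ge0|exact: mulr_ge0].
apply: (@le_trans _ _ (c0 * \sum_(S | P S) a S * (cK * B S))).
  rewrite (bigID P)/= [X in _ + X]big1 ?addr0; last first.
    by move=> S /negPf nP; rewrite /psi nP mul0r.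
  apply: (@le_trans _ _ (\sum_(S' | P S') c0 * \sum_(S | P S && le S' S)
      a S * (k^-1 ^+ (lv S' - lv S) * (a S' `^ beta * s S')))).
    apply: ler_sum => S' PS'; rewrite /psi PS' -[leLHS]mulrA; apply: ler_wpM2l; first exact: ltW.
    rewrite mulrAC mulrC mulr_suml; apply: ler_sum => S _.
    by rewrite -!mulrA.
  rewrite -mulr_sumr ler_wpM2l ?(ltW c00)//.
  rewrite (exchange_big_dep P)/=; last by move=> S S' _ /andP[].
  apply: ler_sum => S PS; rewrite -mulr_sumr ler_wpM2l//.
  have bt : \sum_(S' | P S' && le S' S) k^-1 ^+ (lv S' - lv S) * B S' <= cK * B S.
    exact: bump_tail.
  apply: le_trans bt; rewrite (eq_bigl (fun S' => P S' && le S' S)); last first.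
    by move=> S'; rewrite PS.
  by apply: ler_sum => S' /andP[PS' _]; apply: ler_wpM2l => //; exact: Bu.
apply: (@le_trans _ _ (c0 * (cK * (\sum_(S | P S) nu S) * G `^ (r - b)))).
  rewrite ler_wpM2l ?(ltW c00)// -mulrA mulr_suml mulr_sumr.
  by apply: ler_sum => S PS; rewrite mulrCA ler_wpM2l ?(ltW cK0)// Bl.
have rb : 0 < r - b by rewrite subr_gt0.
have Gr : G `^ (r - b + 1) = G * G `^ (r - b).
  by have := mulr_powRB1 G0 (addr_gt0 rb ltr01); rewrite addrK.
rewrite Gr [leRHS](_ : _ = c0 * (cK * (cN * (cW * (C * G))) * G `^ (r - b))); last first.
  by rewrite -!mulrA; do 5!congr (_ * _); rewrite mulrC.
apply: ler_wpM2l; first exact: ltW.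
apply: ler_wpM2r; first exact: powR_ge0.
apply: ler_wpM2l; first exact: ltW.
apply: le_trans (discounted_total tT P k2 mut0) _.
apply: ler_wpM2l; first exact: ltW.
by apply: (carleson_ratio tT) => //; exact: car.
Qed.

End tree_inequality.

(** * Integrals *)

Section integrals.
Context d (X : measurableType d) (R : realType) (mu : {measure set X -> \bar R}).
Import HBNNSimple.
Local Open Scope ereal_scope.
Implicit Types (D A B : set X).

(** The integral of a nonnegative function is the supremum of the integrals of
    the simple functions below it, so it is monotone and blind to null sets even
    for functions and domains that are not measurable. *)
Lemma ae_le_integral D (f g : X -> \bar R) :
  (forall x, 0 <= f x) -> (forall x, 0 <= g x) ->
  {ae mu, forall x, f x <= g x} ->
  \int[mu]_(x in D) f x <= \int[mu]_(x in D) g x.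
Proof.
move=> f0 g0 [N [mN N0 subN]].
rewrite !(integral_mkcond D) !ge0_integralTE; last 2 first.
- by apply: erestrict_ge0 => x _; exact: g0.
- by apply: erestrict_ge0 => x _; exact: f0.
apply: ge_ereal_sup => _ [h /= hf <-].
have mCN : measurable (~` N) by exact: measurableC.
have -> : sintegral mu h = sintegral mu (proj_nnsfun h mCN).
  rewrite -[LHS](_ : sintegral mu (h \_ setT) = _); last by rewrite patch_setT.
  rewrite -[RHS](_ : sintegral mu (proj_nnsfun h mCN \_ setT) = _); last by rewrite patch_setT.
  rewrite -!integral_nnsfun//; apply: ge0_ae_eq_integral => //.
  - exact/measurable_EFinP.
  - exact/measurable_EFinP.
  - by move=> x _; rewrite lee_fin; exact: fun_ge0.
  - by move=> x _; rewrite lee_fin; exact: fun_ge0.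
  exists N; split=> // x /=; apply: contra_notP => Nx _.
  by rewrite mindicE mem_set ?mulr1.
apply: ereal_sup_ubound; exists (proj_nnsfun h mCN) => // x /=.
rewrite mindicE; have [/set_mem xN|xN] := boolP (x \in ~` N); last first.
  by rewrite mulr0 erestrict_ge0.
rewrite mulr1; apply: le_trans (hf x) _; rewrite /patch; case: ifP => // _.
by apply: contrapT => fg; apply: xN; exact: subN.
Qed.

Lemma ae_eq_integral_nonmeasurable D (f g : X -> \bar R) :
  {ae mu, forall x, f x = g x} ->
  \int[mu]_(x in D) f x = \int[mu]_(x in D) g x.
Proof.
move=> fg; rewrite integralE [RHS]integralE; congr (_ - _); apply/eqP;
  rewrite eq_le; apply/andP; split; apply: ae_le_integral => //;
  by move: fg; apply: filterS => x e; rewrite ?funeposE ?funenegE e.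
Qed.

Lemma subset_integral A B (f : X -> \bar R) : (forall x, 0 <= f x) ->
  A `<=` B -> \int[mu]_(x in A) f x <= \int[mu]_(x in B) f x.
Proof.
move=> f0 AB; rewrite integral_mkcond [leRHS]integral_mkcond.
apply: ae_le_integral.
- exact: erestrict_ge0.
- exact: erestrict_ge0.
by apply: aeW => x; exact: restrict_lee.
Qed.

Section mass.
Variable w : X -> R.
Hypotheses (mw : measurable_fun setT w) (w0 : forall x, (0 <= w x)%R).

Definition mass (v : X -> R) A : R := fine (\int[mu]_(x in A) (v x)%:E).

Let we0 x : 0 <= (w x)%:E. Proof. by rewrite lee_fin. Qed.

Let mwe : measurable_fun setT (EFin \o w). Proof. exact/measurable_EFinP. Qed.

Lemma mass_ge0 A : (0 <= mass w A)%R.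
Proof. by rewrite fine_ge0// integral_ge0. Qed.

Lemma massE A B : A `<=` B -> \int[mu]_(x in B) (w x)%:E < +oo ->
  (mass w A)%:E = \int[mu]_(x in A) (w x)%:E.
Proof.
move=> AB Boo; rewrite fineK// ge0_fin_numE ?integral_ge0//.
by apply: le_lt_trans Boo; exact: subset_integral.
Qed.

Lemma mass_le A B : A `<=` B -> \int[mu]_(x in B) (w x)%:E < +oo ->
  (mass w A <= mass w B)%R.
Proof.
by move=> AB Boo; rewrite -lee_fin (massE AB)// (massE (@subset_refl _ B))// subset_integral.
Qed.

Lemma integral_sum_indic (I : finType) (P : pred I) (F : I -> set X) (c : I -> R) :
  (forall i, (0 <= c i)%R) -> (forall i, measurable (F i)) ->
  \int[mu]_x ((\sum_(i | P i) c i * \1_(F i) x) * w x)%:E =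
  \sum_(i | P i) (c i)%:E * \int[mu]_(x in F i) (w x)%:E.
Proof.
move=> c0 mF.
under eq_integral do rewrite mulr_suml -sumEFin -big_filter.
rewrite -[RHS]big_filter.
rewrite ge0_integral_sum//; last 2 first.
- move=> i; apply/measurable_EFinP; apply: measurable_funM => //.
  by apply: measurable_funM => //; exact: measurable_indic.
- by move=> i x _; rewrite lee_fin !mulr_ge0.
apply: eq_bigr => i _; rewrite [in RHS]integral_mkcond -ge0_integralZl//.
- apply: eq_integral => x _; rewrite /patch indicE.
  by case: (x \in F i); rewrite ?mulr1 ?mulr0 ?mul0r ?mule0// EFinM.
- by apply/(measurable_restrictT (EFin \o w)) => //; exact: measurable_funS mwe.
- by move=> x _; apply: erestrict_ge0.
by rewrite lee_fin.
Qed.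

Lemma integral_sum_mass (I : finType) (P : pred I) (F : I -> set X) (c : I -> R) :
  (forall i, (0 <= c i)%R) -> (forall i, measurable (F i)) ->
  (forall i, \int[mu]_(x in F i) (w x)%:E < +oo) ->
  \int[mu]_x ((\sum_(i | P i) c i * \1_(F i) x) * w x)%:E =
  (\sum_(i | P i) c i * mass w (F i))%:E.
Proof.
move=> c0 mF Foo; rewrite integral_sum_indic// -sumEFin.
by apply: eq_bigr => i _; rewrite EFinM (massE (@subset_refl _ (F i))).
Qed.

Lemma sum_indic_disjoint (I : finType) (P : pred I) (F : I -> set X) B x :
  (forall i, P i -> F i `<=` B) ->
  (forall i j, P i -> P j -> F i x -> F j x -> i = j) ->
  (\sum_(i | P i) (\1_(F i) x : R) <= \1_B x)%R.
Proof.
move=> FB dF; rewrite (bigID (fun i => x \in F i))/= [X in (_ + X)%R]big1 ?addr0; last first.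
  by move=> i /andP[_ /negPf xF]; rewrite indicE xF.
apply: ler_sum_at_most1 => //.
  move=> i /andP[Pi /set_mem xF]; rewrite !indicE mem_set//.
  by rewrite mem_set//; exact: FB xF.
by move=> i j /andP[Pi /set_mem xi] /andP[Pj /set_mem xj]; exact: dF.
Qed.

Lemma sum_mass_le (I : finType) (P : pred I) (F : I -> set X) B :
  (forall i, measurable (F i)) -> measurable B ->
  (forall i, P i -> F i `<=` B) ->
  (forall i j x, P i -> P j -> F i x -> F j x -> i = j) ->
  \int[mu]_(x in B) (w x)%:E < +oo ->
  (\sum_(i | P i) mass w (F i) <= mass w B)%R.
Proof.
move=> mF mB FB dF Boo.
rewrite -lee_fin (massE (@subset_refl _ B))// -sumEFin.
have -> : \sum_(i | P i) (mass w (F i))%:E =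
    \sum_(i | P i) 1%:E * \int[mu]_(x in F i) (w x)%:E.
  by apply: eq_bigr => i Pi; rewrite mul1e (massE (FB i Pi)).
rewrite -(@integral_sum_indic _ P F (fun=> 1%R))//.
rewrite [leRHS]integral_mkcond; apply: ae_le_integral.
- by move=> x; rewrite lee_fin mulr_ge0// sumr_ge0// => i _; rewrite mulr_ge0.
- exact: erestrict_ge0.
apply: aeW => x; under eq_bigr do rewrite mul1r.
have := sum_indic_disjoint (x := x) FB (fun i j Pi Pj => dF i j x Pi Pj).
rewrite /patch indicE; case: (x \in B) => h.
  by rewrite lee_fin ler_piMl.
rewrite lee_fin; apply: mulr_le0_ge0 => //; exact: h.
Qed.

End mass.

End integrals.

(** * Dyadic grids *)

Section half_open_cubes.
Context (R : realType) (n : nat).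
Local Notation Rn := (Rn R n).
Local Notation mu := (lebesgue R n).

Definition hcube (a : Rn) (l : R) : set Rn :=
  [set x | forall i, tnth a i <= tnth x i < tnth a i + l].

Lemma measurable_hcube (a : Rn) (l : R) : measurable (hcube a l).
Proof.
rewrite (_ : hcube a l = \bigcap_(i in [set: 'I_n])
    ((fun x => tnth x i) @^-1` `[tnth a i, (tnth a i + l)%R[%classic)).
  apply: fin_bigcap_measurable => // i _; rewrite -[X in measurable X]setTI.
  apply: measurable_tnth => //; exact: measurable_itv.
apply/seteqP; split => x xP i /=.
  by move=> _; rewrite in_itv/=; exact: xP.
by have := xP i Logic.I; rewrite /= in_itv.
Qed.

Lemma hcube_sub (a : Rn) (l : R) : hcube a l `<=` cube a l.
Proof. by move=> x h i; have /andP[-> /ltW ->] := h i. Qed.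

Lemma bernoulli_inequality (e : R) m : 0 <= e <= 1 -> 1 - m%:R * e <= (1 - e) ^+ m.
Proof.
move=> /andP[e0 e1]; elim: m => [|m ih]; first by rewrite mul0r subr0 expr0.
have e1' : 0 <= 1 - e by rewrite subr_ge0.
rewrite exprS; apply: le_trans (ler_wpM2l e1' ih).
rewrite -subr_ge0 -natr1 (_ : _ - _ = m%:R * e ^+ 2); last by ring.
by rewrite mulr_ge0// sqr_ge0.
Qed.

(** Squeezed between [cube a ((1 - e) l)] and [cube a l]. *)
Lemma lebesgue_hcube (a : Rn) (l : R) : 0 < l -> mu (hcube a l) = (l ^+ n)%:E.
Proof.
move=> l0; have l0' := ltW l0.
have up : (mu (hcube a l) <= (l ^+ n)%:E)%E.
  rewrite -(lebesgue_cube a l0'); apply: le_measure; rewrite ?inE.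
  - exact: measurable_hcube.
  - exact: measurable_cube.
  - exact: hcube_sub.
have fin : mu (hcube a l) \is a fin_num.
  by rewrite ge0_fin_numE//; apply: le_lt_trans up _; rewrite ltry.
move: up; rewrite -(fineK fin); set m := fine _; rewrite lee_fin => up.
congr EFin; apply/eqP; rewrite eq_le up /=.
have ln0 : 0 < l ^+ n by rewrite exprn_gt0.
have low (e : R) : 0 < e < 1 -> (1 - n%:R * e) * l ^+ n <= m.
  move=> /andP[e0 e1]; apply: (@le_trans _ _ (((1 - e) * l) ^+ n)).
    by rewrite exprMn ler_wpM2r ?(ltW ln0)// bernoulli_inequality// !ltW.
  have le0 : 0 <= (1 - e) * l by rewrite mulr_ge0// subr_ge0 ltW.
  rewrite -lee_fin -(lebesgue_cube a le0) (fineK fin).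
  apply: le_measure; rewrite ?inE; [exact: measurable_cube|exact: measurable_hcube|].
  move=> x h i; have /andP[-> /= hx] := h i; apply: le_lt_trans hx _.
  by rewrite ltrD2l -[ltRHS]mul1r ltr_pM2r// gtrBl.
rewrite leNgt; apply/negP => ml.
pose t := 1 - m / l ^+ n.
have t0 : 0 < t by rewrite subr_gt0 ltr_pdivrMr// mul1r.
pose e := Num.min (2^-1) (t / (n.+1%:R)).
have e0 : 0 < e by rewrite lt_min invr_gt0 ltr0n divr_gt0// ltr0n.
have e1 : e < 1 by rewrite gt_min; apply/orP; left; lra.
have e01 : 0 < e < 1 by rewrite e0.
have := low e e01; rewrite leNgt => /negP; apply.
rewrite -ltr_pdivrMr// ltrBrDl -ltrBrDr -/t.
apply: (@le_lt_trans _ _ (n%:R * (t / n.+1%:R))).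
  by rewrite ler_wpM2l// ge_min lexx orbT.
by rewrite mulrCA gtr_pMr// ltr_pdivrMr// mul1r ltr_nat.
Qed.

Lemma integral_hcube (w : Rn -> R) (a : Rn) (l : R) :
  measurable_fun setT w -> (forall x, 0 <= w x) -> 0 < l ->
  (\int[mu]_(x in hcube a l) (w x)%:E = \int[mu]_(x in cube a l) (w x)%:E)%E.
Proof.
move=> mw w0 l0; pose N := cube a l `\` hcube a l.
have mH := measurable_hcube a l; have mC := measurable_cube a l.
have mN : measurable N by exact: measurableD.
have N0 : mu N = 0.
  have Coo : (mu (cube a l) < +oo)%E by rewrite lebesgue_cube ?ltW// ltry.
  have e : (mu (cube a l) - mu (cube a l `&` hcube a l) = 0)%E.
    rewrite (setIidr (@hcube_sub a l)) lebesgue_hcube// lebesgue_cube ?ltW//.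
    by rewrite -EFinB subrr.
  exact: etrans (measureD mC mH Coo) e.
rewrite [RHS](ge0_negligible_integral mN mC _ _ N0).
- congr (integral _ _ _); rewrite /N setDD; apply/esym/setIidr; exact: hcube_sub.
- by apply/measurable_EFinP; exact: measurable_funS mw.
- by move=> x _; rewrite lee_fin.
Qed.

End half_open_cubes.

Section grid.
Context (R : realType) (n D : nat).
Local Notation Rn := (Rn R n).
Variables (o : Rn) (L : R).
Hypothesis L0 : 0 < L.

(** A node is a generation and the integer coordinates of the lower corner, in
    units of the side length. *)
Definition node := ('I_D.+1 * {ffun 'I_n -> 'I_(2 ^ D)})%type.

Definition gen (Q : node) : nat := Q.1.

Definition sub_node : rel node := fun Q S =>
  (gen S <= gen Q)%N && [forall c, Q.2 c %/ 2 ^ (gen Q - gen S) == S.2 c]%N.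

Definition corner (Q : node) : Rn :=
  [tuple (tnth o c + (Q.2 c)%:R * side gen L Q)%R | c < n].

Definition cell (Q : node) : set Rn := hcube (corner Q) (side gen L Q).

Definition pos (x : Rn) (i : nat) (c : 'I_n) : R :=
  (tnth x c - tnth o c) / (L * 2^-1 ^+ i).

Lemma posD x i d c : pos x (i + d) c = pos x i c * 2 ^+ d.
Proof.
rewrite /pos exprD mulrA invfM -exprVn invrK mulrA//.
Qed.

Lemma cellP Q x : cell Q x <->
  forall c, (Q.2 c)%:R <= pos x (gen Q) c < (Q.2 c).+1%:R.
Proof.
have l0 : 0 < L * 2^-1 ^+ gen Q := side_gt0 gen Q L0.
split=> h c; have := h c; rewrite tnth_mktuple /pos -/(side gen L Q);
  rewrite ler_pdivlMr// ltr_pdivrMr// lerBrDl ltrBlDl -natr1 mulrDl mul1r addrA//.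
Qed.

Lemma node_tree : is_tree gen sub_node.
Proof.
split.
- by move=> Q; rewrite /sub_node leqnn subnn expn0; apply/forallP => c; rewrite divn1.
- move=> [i m] [j k]; rewrite /sub_node /gen/= => /andP[/andP[ji /forallP h] /andP[ij _]].
  have e : i = j by apply/val_inj/eqP; rewrite eqn_leq ij.
  congr pair => //; apply/ffunP => c; apply/val_inj/eqP.
  by have := h c; rewrite e subnn expn0 divn1.
- move=> S Q P /andP[SQ /forallP QS] /andP[PS /forallP SP].
  rewrite /sub_node (leq_trans PS SQ); apply/forallP => c.
  rewrite -(eqP (SP c)) -(eqP (QS c)) -divnMA -expnD.
  by rewrite (_ : (gen Q - gen S) + _ = gen Q - gen P)%N//; clear -SQ PS; lia.
- by move=> Q S /andP[].
- move=> Q S S' /andP[SQ /forallP QS] /andP[S'Q /forallP QS'] SS'.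
  rewrite /sub_node SS'; apply/forallP => c.
  rewrite -(eqP (QS c)) -(eqP (QS' c)) -divnMA -expnD.
  by rewrite (_ : (gen Q - gen S') + _ = gen Q - gen S)%N//; clear -S'Q SS'; lia.
Qed.

Lemma cell_sub Q S : sub_node Q S -> cell Q `<=` cell S.
Proof.
move=> /andP[SQ /forallP QS] x /cellP h; apply/cellP => c.
have := QS c; set d := (gen Q - gen S)%N => /eqP <-.
have := h c; rewrite -(subnKC SQ) posD -/d => /andP[h1 h2].
have d0 : 0 < 2 ^+ d :> R by rewrite exprn_gt0.
apply/andP; split.
  rewrite -(ler_pM2r d0); apply: le_trans h1.
  by rewrite -natrX -natrM ler_nat leq_trunc_div.
rewrite -(ltr_pM2r d0); apply: lt_le_trans h2 _.
by rewrite -natrX -natrM ler_nat ltn_ceil// expn_gt0.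
Qed.

Lemma cell_nested Q S x : cell Q x -> cell S x -> (gen S <= gen Q)%N -> sub_node Q S.
Proof.
move=> /cellP hQ /cellP hS SQ; rewrite /sub_node SQ; apply/forallP => c.
set d := (gen Q - gen S)%N; have /andP[s1 s2] := hS c.
have := hQ c; rewrite -(subnKC SQ) posD -/d => /andP[q1 q2].
have d0 : 0 < 2 ^+ d :> R by rewrite exprn_gt0.
have dn : (0 < 2 ^ d)%N by rewrite expn_gt0.
have h1 : (S.2 c * 2 ^ d <= Q.2 c)%N.
  rewrite -ltnS -(ltr_nat R); apply: le_lt_trans q2.
  by rewrite natrM natrX ler_pM2r.
have h2 : (Q.2 c < (S.2 c).+1 * 2 ^ d)%N.
  rewrite -(ltr_nat R); apply: le_lt_trans q1 _.
  by rewrite natrM natrX ltr_pM2r.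
by rewrite eqn_leq -ltnS ltn_divLR// h2 leq_divRL.
Qed.

Lemma cell_chain x : chain gen sub_node (fun Q => `[< cell Q x >]).
Proof. by move=> S S' /asboolP h /asboolP h' SS'; exact: cell_nested h' h SS'. Qed.

Lemma cell_upclosed x : upclosed sub_node (fun Q => `[< cell Q x >]).
Proof. by move=> S S' /asboolP h SS'; apply/asboolP; exact: cell_sub SS' _ h. Qed.

Lemma antichain_cell (A : pred node) Q S x : antichain sub_node A ->
  A Q -> A S -> cell Q x -> cell S x -> Q = S.
Proof.
move=> aA AQ AS Qx Sx; have [SQ|/ltnW QS] := leqP (gen S) (gen Q).
  by apply: aA => //; exact: cell_nested Sx SQ.
by apply/esym/aA => //; exact: cell_nested Qx QS.
Qed.

Lemma measurable_cell Q : measurable (cell Q).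
Proof. exact: measurable_hcube. Qed.

Definition top_cube : set Rn := hcube o L.

Lemma cell_exists (i : 'I_D.+1) (x y : Rn) : top_cube x ->
  (forall c, Num.truncn (pos x i c) = Num.truncn (pos y i c) /\ 0 <= pos y i c) ->
  exists Q, [/\ gen Q = i, cell Q x & cell Q y].
Proof.
move=> hx hy.
have px c : 0 <= pos x i c < 2 ^+ i.
  have /andP[h1 h2] := hx c; have l0 : 0 < L * 2^-1 ^+ i.
    by rewrite mulr_gt0// exprn_gt0// invr_gt0.
  rewrite /pos divr_ge0 ?(ltW l0) ?subr_ge0//= ltr_pdivrMr// exprVn mulrCA divff.
    by rewrite mulr1 ltrBlDl.
  by rewrite expf_neq0.
have tr c : (Num.truncn (pos x i c) < 2 ^ D)%N.
  have /andP[h1 h2] := px c; apply: (@leq_trans (2 ^ i)); last first.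
    by rewrite leq_exp2l// -ltnS.
  rewrite -(ltr_nat R) natrX; apply: le_lt_trans h2.
  by rewrite Num.Theory.truncn_le.
exists (i, [ffun c => Ordinal (tr c)]); split=> //; apply/cellP => c; rewrite ffunE /=.
  by have /andP[h1 _] := px c; rewrite Num.Theory.truncn_le h1 truncnS_gt.
by have [-> h] := hy c; rewrite Num.Theory.truncn_le h truncnS_gt.
Qed.

End grid.

Section shifted_grids.
Context (R : realType).

(** Two grids of step 1 shifted by [2^i / 3] have no points closer than [1/3],
    as 3 does not divide [2^i]: a short interval meets at most one of them. *)
Lemma third_shift (a b : R) i : 0 <= a <= b -> b - a <= 3^-1 ->
  Num.truncn a = Num.truncn b \/
  Num.truncn (a + 2 ^+ i / 3) = Num.truncn (b + 2 ^+ i / 3).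
Proof.
move=> /andP[a0 ab] ba; have b0 : 0 <= b by apply: le_trans ab.
have p0 : 0 <= 2 ^+ i / 3 :> R by rewrite divr_ge0// exprn_ge0.
have ab' : a + 2 ^+ i / 3 <= b + 2 ^+ i / 3 by rewrite lerD2r.
have := le_truncn ab; rewrite leq_eqVlt => /orP[/eqP|]; first by left.
move=> h1; have := le_truncn ab'; rewrite leq_eqVlt => /orP[/eqP|]; first by right.
move: h1; set k := Num.truncn b; set l := Num.truncn (b + _) => h1 h2.
have k1 : a < k%:R by rewrite -truncn_lt_nat.
have k2 : k%:R <= b by rewrite /k Num.Theory.truncn_le.
have l1 : a + 2 ^+ i / 3 < l%:R by rewrite -truncn_lt_nat// addr_ge0.
have l2 : l%:R <= b + 2 ^+ i / 3 by rewrite /l Num.Theory.truncn_le addr_ge0.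
have u1 : (3 * l < 3 * k + 2 ^ i + 1)%N.
  by rewrite -(ltr_nat R) (natrD _ (3 * k + 2 ^ i)) (natrD _ (3 * k)) !natrM natrX; lra.
have u2 : (3 * k + 2 ^ i < 3 * l + 1)%N.
  by rewrite -(ltr_nat R) (natrD _ (3 * k)) (natrD _ (3 * l)) !natrM natrX; lra.
have e : (3 * l = 3 * k + 2 ^ i)%N by lia.
have := dvdn_mulr l (dvdnn 3); rewrite e dvdn_addr ?dvdn_mulr//.
by rewrite Euclid_dvdX.
Qed.

Context (n : nat).
Local Notation Rn := (Rn R n).
Implicit Types (x y : Rn) (L : R) (t : {ffun 'I_n -> bool}).

Definition origin L t : Rn :=
  [tuple (- (L / 2) - (if t c then L / 3 else 0) : R) | c < n].

Definition box L : set Rn := [set x | forall c, - (L / 8) <= tnth x c <= L / 8].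

Lemma eucl_dist_ge x y c : `|tnth x c - tnth y c| <= eucl_dist x y.
Proof.
rewrite /eucl_dist -sqrtr_sqr ler_wsqrtr// (bigD1 c)//= lerDl sumr_ge0// => i _.
exact: sqr_ge0.
Qed.

Lemma box_top L t x : 0 < L -> box L x -> top_cube (origin L t) L x.
Proof.
move=> L0 bx c; have := bx c; rewrite tnth_mktuple => /andP[h1 h2].
by case: (t c); apply/andP; split; lra.
Qed.

Lemma same_cell L D (i : 'I_D.+1) x y : 0 < L -> box L x -> box L y ->
  (forall c, `|tnth x c - tnth y c| <= L * 2^-1 ^+ i / 3) ->
  exists t (Q : node n D),
    [/\ gen Q = i, cell (origin L t) L Q x & cell (origin L t) L Q y].
Proof.
move=> L0 bx bY xy.
have l0 : 0 < L * 2^-1 ^+ i by rewrite mulr_gt0// exprn_gt0// invr_gt0.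
pose P (s : bool) c := Num.truncn ((tnth x c + L / 2 + (if s then L / 3 else 0)) / (L * 2^-1 ^+ i)) =
  Num.truncn ((tnth y c + L / 2 + (if s then L / 3 else 0)) / (L * 2^-1 ^+ i)).
have shiftE (z : R) : (z + L / 3) / (L * 2^-1 ^+ i) =
    z / (L * 2^-1 ^+ i) + 2 ^+ i / 3.
  have := lt0r_neq0 L0; have : 2 ^+ i != 0 :> R by rewrite expf_neq0.
  by rewrite exprVn => h1 h2; field; rewrite h1 h2.
have key (X Y : R) : X <= Y -> - (L / 8) <= X -> Y - X <= L * 2^-1 ^+ i / 3 ->
    exists s : bool,
      Num.truncn ((X + L / 2 + (if s then L / 3 else 0)) / (L * 2^-1 ^+ i)) =
      Num.truncn ((Y + L / 2 + (if s then L / 3 else 0)) / (L * 2^-1 ^+ i)).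
  move=> XY LX YX.
  case: (@third_shift ((X + L / 2) / (L * 2^-1 ^+ i))
      ((Y + L / 2) / (L * 2^-1 ^+ i)) i).
  - rewrite divr_ge0 ?(ltW l0)//=; last by lra.
    by rewrite ler_pM2r ?invr_gt0//; lra.
  - by rewrite -mulrBl ler_pdivrMr//; lra.
  - by move=> e; exists false; rewrite !addr0.
  - by rewrite -!shiftE => e; exists true.
have Pc c : exists s, P s c.
  have := xy c; rewrite ler_norml => /andP[h1 h2].
  have /andP[hx1 hx2] := bx c; have /andP[hy1 hy2] := bY c.
  have [h|/ltW h] := leP (tnth x c) (tnth y c).
    by apply: key => //; lra.
  by have [s Ps] := key _ _ h hy1 h2; exists s.
have [s Ps] : {s : 'I_n -> bool & forall c, P (s c) c}.
  exists (fun c => sval (cid (Pc c))) => c; exact: svalP (cid (Pc c)).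
pose t := [ffun c => s c]; exists t.
have posE z c : pos (origin L t) L z i c =
    (tnth z c + L / 2 + (if s c then L / 3 else 0)) / (L * 2^-1 ^+ i).
  by rewrite /pos tnth_mktuple ffunE opprD !opprK addrA.
have xt := box_top t L0 bx.
have [c|Q [Qi Qx Qy]] := @cell_exists R n D (origin L t) L L0 i x y xt.
  split; first by rewrite !posE; exact: Ps.
  rewrite posE divr_ge0 ?(ltW l0)//; have /andP[h1 h2] := bY c.
  by case: (s c); lra.
by exists Q.
Qed.

(** The cells used are the smallest with one third of the side above all
    coordinates of [x - y]; the next generation violates this in some
    coordinate, so one sixth of their side is below the distance. *)
Lemma kernel_le L D (d0 : R) x y : 0 < L -> 0 < d0 -> box L x -> box L y ->
  L * 2^-1 ^+ D / 6 < eucl_dist x y ->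
  (eucl_dist x y `^ d0)^-1 <= 6 `^ d0 *
    \sum_t \sum_(Q : node n D) (side (@gen n D) L Q `^ d0)^-1 *
      (\1_(cell (origin L t) L Q) x * \1_(cell (origin L t) L Q) y).
Proof.
move=> L0 d00 bx bY dxy.
pose p (i : nat) := (i <= D)%N && [forall c, `|tnth x c - tnth y c| <= L * 2^-1 ^+ i / 3].
have p0 : exists i, p i.
  exists 0%N; rewrite /p leq0n/=; apply/forallP => c.
  have := bx c; have := bY c => /andP[h1 h2] /andP[h3 h4].
  by rewrite expr0 mulr1 ler_norml; apply/andP; split; lra.
have pD i : p i -> (i <= D)%N by case/andP.
case: (ex_maxnP p0 pD) => i /andP[iD /forallP xyi] maxi.
have l0 j : 0 < L * 2^-1 ^+ j :> R by rewrite mulr_gt0// exprn_gt0// invr_gt0.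
have dl : L * 2^-1 ^+ i / 6 < eucl_dist x y.
  move: iD; rewrite leq_eqVlt => /predU1P[->//|iD].
  have : ~~ p i.+1 by apply/negP => /maxi; rewrite ltnn.
  rewrite /p iD negb_forall => /existsP[c]; rewrite -ltNge => h.
  apply: lt_le_trans (eucl_dist_ge x y c); apply: le_lt_trans h.
  by rewrite exprS; lra.
have iD' : (i < D.+1)%N by [].
have [t [Q [Qi Qx Qy]]] := @same_cell L D (Ordinal iD') x y L0 bx bY xyi.
have sE : side (@gen n D) L Q = L * 2^-1 ^+ i by rewrite /side Qi.
have s0 : 0 < L * 2^-1 ^+ i by [].
have q0 : 0 < L * 2^-1 ^+ i / 6 by rewrite divr_gt0.
apply: (@le_trans _ _ (6 `^ d0 * (side (@gen n D) L Q `^ d0)^-1)).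
  apply: (@le_trans _ _ (((L * 2^-1 ^+ i / 6) `^ d0)^-1)).
    rewrite lef_pV2 ?posrE ?powR_gt0//; last exact: lt_trans dl.
    apply: ge0_ler_powR; rewrite ?nnegrE ?(ltW d00) ?(ltW q0) ?(ltW dl)//.
    exact: ltW (lt_trans q0 dl).
  rewrite sE powRM ?(ltW s0) ?invr_ge0// invfM mulrC ler_wpM2r//.
    by rewrite invr_ge0 powR_ge0.
  by rewrite -powR_inv1// -powRrM mulN1r powRN invrK.
rewrite ler_wpM2l ?powR_ge0// (bigD1 t)//= (bigD1 Q)//= -addrA.
rewrite !indicE !mem_set// !mulr1 lerDl addr_ge0//.
  by rewrite sumr_ge0// => S _; rewrite mulr_ge0// invr_ge0 powR_ge0.
rewrite sumr_ge0// => t' _; rewrite sumr_ge0// => S _.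
by rewrite mulr_ge0// invr_ge0 powR_ge0.
Qed.


End shifted_grids.

(** * The weak-type inequality *)

Section grid_testing.
Context (R : realType) (n : nat).
Local Notation Rn := (Rn R n).
Local Notation mu := (lebesgue R n).
Implicit Types (u s f w : Rn -> R).

Definition borel_weight w :=
  [/\ measurable_fun setT w, forall x, 0 <= w x &
      forall a l, 0 < l -> (\int[mu]_(x in cube a l) (w x)%:E < +oo)%E].

Lemma borel_weight_hcube w a l : borel_weight w -> 0 < l ->
  (\int[mu]_(x in hcube a l) (w x)%:E < +oo)%E.
Proof.
move=> [mw w0 woo] l0; apply: le_lt_trans (woo a l l0).
by apply: subset_integral => [x|]; [rewrite lee_fin|exact: hcube_sub].
Qed.

Lemma submeasure_cell w (o : Rn) (L : R) D : 0 < L ->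
  measurable_fun setT w -> (forall x, 0 <= w x) ->
  (forall Q : node n D, (\int[mu]_(x in cell o L Q) (w x)%:E < +oo)%E) ->
  submeasure (@sub_node n D) (fun Q => mass mu w (cell o L Q)).
Proof.
move=> L0 mw w0 woo; split=> [Q|P Q aP PQ]; first exact: mass_ge0.
apply: sum_mass_le => //.
- by move=> S; exact: measurable_cell.
- exact: measurable_cell.
- by move=> S PS; apply: cell_sub => //; exact: PQ.
- by move=> S S' x PS PS'; exact: (antichain_cell L0 aP).
Qed.

Lemma holder_weight (f phi s : Rn -> R) (p r : R) :
  measurable_fun setT f -> measurable_fun setT phi -> measurable_fun setT s ->
  (forall x, 0 <= f x) -> (forall x, 0 <= phi x) -> (forall x, 0 <= s x) ->
  0 < p -> 0 < r -> p^-1 + r^-1 = 1 ->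
  (\int[mu]_x (f x * phi x * s x)%:E <=
    Lp_norm p s f * (\int[mu]_x (phi x `^ r * s x)%:E) `^ r^-1)%E.
Proof.
move=> mf mphi ms f0 phi0 s0 p0 r0 pr.
pose F x := f x * s x `^ p^-1; pose G x := phi x * s x `^ r^-1.
have mpow (g : Rn -> R) a : measurable_fun setT g -> measurable_fun setT (fun x => g x `^ a).
  exact: (@measurableT_comp _ _ _ _ _ _ (@powR R ^~ a)).
have mF : measurable_fun setT F by apply: measurable_funM => //; exact: mpow.
have mG : measurable_fun setT G by apply: measurable_funM => //; exact: mpow.
have F0 x : 0 <= F x by rewrite mulr_ge0 ?powR_ge0.
have G0 x : 0 <= G x by rewrite mulr_ge0 ?powR_ge0.
have := hoelder mu mF mG p0 r0 pr; rewrite Lnorm1.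
rewrite (eq_integral (fun x => (f x * phi x * s x)%:E)); last first.
  move=> x _; rewrite /= ger0_norm ?mulr_ge0 ?powR_ge0// /F /G mulrACA -powRD; last first.
    by rewrite pr oner_eq0.
  by rewrite pr powRr1.
move=> h; apply: le_trans h _; rewrite unlock /Lp_norm le_eqVlt; apply/orP; left.
apply/eqP; congr (_ `^ _ * _ `^ _)%E; apply: eq_integral => x _ /=.
  rewrite ger0_norm// ger0_norm// ?poweR_EFin /F powRM ?powR_ge0//.
  by rewrite -powRrM mulVf ?gt_eqF// powRr1.
rewrite ger0_norm// ?poweR_EFin /G powRM ?powR_ge0//.
by rewrite -powRrM mulVf ?gt_eqF// powRr1.
Qed.

(** The interface between the analysis of the potential and the two
    [A_infinity] constants, which enter only through the choice of [m] and of
    the Carleson constant [C]. *)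
Definition carleson_bound (alpha p q : R) u s (m : set Rn -> R) (C : R) :=
  [/\ forall A, 0 <= m A,
      forall a l, 0 < l ->
        mass mu u (hcube a l) `^ (1 + conj_exp p / q) * mass mu s (hcube a l) <=
        (l `^ (n%:R - alpha)) `^ conj_exp p * m (hcube a l) &
      forall (o : Rn) (L : R) D (P : pred (node n D)), 0 < L ->
        packed (@sub_node n D) (fun S => side (@gen n D) L S ^+ n) P ->
        forall Q, \sum_(S | P S && sub_node S Q) m (cell o L S) <=
          C * mass mu u (cell o L Q)].

Lemma conj_exp_gt1 (p : R) : 1 < p ->
  1 < conj_exp p /\ p^-1 + (conj_exp p)^-1 = 1.
Proof.
move=> p1; have p10 : 0 < p - 1 by rewrite subr_gt0.
have p0 : 0 < p by apply: lt_trans p1.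
split; first by rewrite /conj_exp ltr_pdivlMr// mul1r gtrBl.
by rewrite /conj_exp invf_div; field; rewrite gt_eqF.
Qed.

(** The positive dyadic operator is self-adjoint: Hoelder's inequality moves [f]
    away and leaves the operator applied to [u 1_E], which the tree inequality
    bounds pointwise by [sum psi(Q) 1_Q]. *)
Lemma grid_testing (alpha p q : R) :
  0 < alpha < n%:R -> 1 < p -> p < q ->
  exists2 c : R, 0 < c &
  forall u s f (m : set Rn -> R) (C : R),
    borel_weight u -> borel_weight s -> measurable_fun setT f ->
    (forall x, 0 <= f x) -> 0 <= C -> carleson_bound alpha p q u s m C ->
    (Lp_norm p s f < +oo)%E ->
    forall (o : Rn) (L : R) D (E : set Rn), 0 < L -> measurable E ->
    (\int[mu]_(x in E) (u x)%:E < +oo)%E ->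
    ((\sum_(Q : node n D) ((side (@gen n D) L Q `^ (n%:R - alpha))^-1 *
        mass mu u (cell o L Q `&` E))%:E *
        \int[mu]_(x in cell o L Q) (f x * s x)%:E)
      <= (c * C `^ (conj_exp p)^-1 * mass mu u E `^ (1 - q^-1))%:E * Lp_norm p s f)%E.
Proof.
move=> hal p1 pq; set r := conj_exp p.
have [r1 prE] := conj_exp_gt1 p1; rewrite -/r in r1 prE.
have p0 : 0 < p by apply: lt_trans p1.
have q0 : 0 < q by apply: lt_trans pq.
have r0 : 0 < r by apply: lt_trans r1.
have q1 : 1 < q by apply: lt_trans pq.
pose b := 1 + r / q.
have b1 : 1 < b by rewrite /b ltrDl divr_gt0.
have br : b < r.
  have h : q^-1 < p^-1 by rewrite ltf_pV2.
  have e : b = r * (r^-1 + q^-1) by rewrite /b mulrDr divff ?gt_eqF.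
  by rewrite e gtr_pMr//; lra.
have b1r : 1 < b < r by rewrite b1.
have [c c0 tree] := @tree_inequality R n alpha r b hal b1r.
exists (c `^ r^-1); first by rewrite powR_gt0.
move=> u s f m C bu bs mf f0 C0 [m0 cond car] Foo o L D E L0 mE Eoo.
have [mu_ u0 uoo] := bu; have [ms s0 soo] := bs.
pose l (Q : node n D) := side (@gen n D) L Q.
have l0 Q : 0 < l Q by exact: side_gt0.
have mcell Q := @measurable_cell R n D o L Q.
pose uE x := u x * \1_E x.
have muE : measurable_fun setT uE by apply: measurable_funM => //; exact: measurable_indic.
have uE0 x : 0 <= uE x by rewrite mulr_ge0.
have massuE A : mass mu uE A = mass mu u (A `&` E).
  rewrite /mass integral_mkcondr; congr fine; apply: eq_integral => x _.
  by rewrite /uE /patch indicE; case: (x \in E); rewrite ?mulr1 ?mulr0.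
have uEoo A : (\int[mu]_(x in A) (uE x)%:E < +oo)%E.
  apply: le_lt_trans Eoo; rewrite [leRHS]integral_mkcond [leLHS]integral_mkcond.
  apply: ae_le_integral;
    [by apply: erestrict_ge0 => x _; rewrite lee_fin..|].
  apply: aeW => x; rewrite /uE /patch indicE; case: (x \in E); case: (x \in A);
    by rewrite ?mulr1 ?mulr0 ?lee_fin.
have ucell (Q : node n D) : (\int[mu]_(x in cell o L Q) (u x)%:E < +oo)%E.
  exact: (borel_weight_hcube (corner o L Q) bu (l0 Q)).
have scell (Q : node n D) : (\int[mu]_(x in cell o L Q) (s x)%:E < +oo)%E.
  exact: (borel_weight_hcube (corner o L Q) bs (l0 Q)).
pose g (Q : node n D) := mass mu uE (cell o L Q).
pose G := mass mu u E.
have G0 : 0 <= G by exact: mass_ge0.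
have g0 Q : 0 <= g Q by exact: mass_ge0.
have sg : submeasure (@sub_node n D) g by apply: submeasure_cell.
have ss : submeasure (@sub_node n D) (fun Q => mass mu s (cell o L Q)).
  exact: submeasure_cell.
have gu Q : g Q <= mass mu u (cell o L Q).
  rewrite /g massuE; apply: mass_le => //; exact: subIsetl.
have AG (A : pred (node n D)) : antichain (@sub_node n D) A -> \sum_(S | A S) g S <= G.
  move=> aA; rewrite /G (eq_bigr (fun S => mass mu u (cell o L S `&` E))); last first.
    by move=> S _; rewrite /g massuE.
  apply: (@sum_mass_le _ _ _ mu u mu_ u0 _ A (fun S : node n D => cell o L S `&` E)) => //.
  - by move=> S; exact: measurableI.
  - by move=> S S' x AS AS' [Sx _] [S'x _]; exact: (antichain_cell L0 aA AS AS' Sx S'x).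
have [psi [psi0 psiX psiS]] := tree _ _ _ L g (fun Q => mass mu s (cell o L Q))
  (fun Q => mass mu u (cell o L Q)) (fun Q => m (cell o L Q)) C G
  (node_tree n D) L0 sg ss (fun Q => m0 _) gu C0 G0 AG
  (fun P pP Q => car o L D P L0 pP Q) (fun Q => cond _ _ (l0 Q)).
pose a Q := g Q / l Q `^ (n%:R - alpha).
have a0 Q : 0 <= a Q by rewrite divr_ge0 ?powR_ge0.
pose V x := \sum_Q a Q * \1_(cell o L Q) x.
have V0 x : 0 <= V x by rewrite sumr_ge0// => Q _; rewrite mulr_ge0.
have mV : measurable_fun setT V.
  apply: measurable_sum => Q; apply: measurable_funM => //; exact: measurable_indic.
have VE x : V x = \sum_(Q | `[< cell o L Q x >]) a Q.
  rewrite /V [RHS]big_mkcond; apply: eq_bigr => Q _; rewrite indicE.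
  have [h|h] := boolP (x \in cell o L Q).
    by rewrite mulr1 ifT//; apply/asboolP/set_mem.
  by rewrite mulr0 ifF//; apply/negP => /asboolP/mem_set; rewrite (negPf h).
have Vr x : V x `^ r <= \sum_Q psi Q * \1_(cell o L Q) x.
  rewrite VE; apply: le_trans (psiX _ (@cell_chain _ _ _ o L L0 x) (@cell_upclosed _ _ _ o L L0 x)) _.
  rewrite big_mkcond; apply: ler_sum => Q _; case: asboolP => h.
    by rewrite indicE mem_set ?mulr1.
  by rewrite mulr_ge0.
have sV : (\int[mu]_x (V x `^ r * s x)%:E <= (c * (C * G `^ (r - b + 1)))%:E)%E.
  apply: (@le_trans _ _ (\int[mu]_x ((\sum_Q psi Q * \1_(cell o L Q) x) * s x)%:E)%E).
    apply: ae_le_integral => [x|x|].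
    - by rewrite lee_fin mulr_ge0 ?powR_ge0.
    - by rewrite lee_fin mulr_ge0// sumr_ge0// => Q _; rewrite mulr_ge0.
    - by apply: aeW => x; rewrite lee_fin ler_wpM2r.
  by rewrite integral_sum_mass// lee_fin.
have -> : (\sum_(Q : node n D) ((l Q `^ (n%:R - alpha))^-1 *
    mass mu u (cell o L Q `&` E))%:E * \int[mu]_(x in cell o L Q) (f x * s x)%:E =
    \int[mu]_x (f x * V x * s x)%:E)%E.
  rewrite (eq_integral (fun x => (V x * (f x * s x))%:E)); last first.
    by move=> x _; rewrite mulrA (mulrC (V x)).
  rewrite integral_sum_indic//; last 2 first.
  - exact: measurable_funM.
  - by move=> x; rewrite mulr_ge0.
  by apply: eq_bigr => Q _; rewrite /a /g massuE mulrC.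
apply: le_trans (holder_weight mf mV ms f0 V0 s0 p0 r0 prE) _.
rewrite muleC; apply: lee_wpmul2r; first exact: poweR_ge0.
apply: (@le_trans _ _ ((c * (C * G `^ (r - b + 1)))%:E `^ r^-1)%E).
  apply: gt0_ler_poweR; rewrite ?invr_ge0 ?(ltW r0)//.
  - rewrite in_itv/= leey andbT integral_ge0// => x _.
    by rewrite lee_fin mulr_ge0 ?powR_ge0.
  - by rewrite in_itv/= leey andbT lee_fin !mulr_ge0 ?powR_ge0// ltW.
rewrite poweR_EFin lee_fin powRM ?(ltW c0) ?mulr_ge0 ?powR_ge0//.
rewrite [X in _ * X]powRM ?powR_ge0// -powRrM mulrA.
rewrite (_ : (r - b + 1) / r = 1 - q^-1)//.
by rewrite /b; field; rewrite !gt_eqF.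
Qed.

End grid_testing.

Section weak_type.
Context (R : realType) (n : nat).
Local Notation Rn := (Rn R n).
Local Notation mu := (lebesgue R n).
Implicit Types (u s f w : Rn -> R) (x y : Rn).

Lemma measurable_superlevel d (X : measurableType d) (g : X -> R) (a : R) :
  measurable_fun setT g -> measurable [set x | a < g x].
Proof.
move=> mg; rewrite (_ : [set x | _] = setT `&` g @^-1` `]a, +oo[%classic).
  by apply: mg => //; exact: measurable_itv.
by rewrite setTI; apply/seteqP; split => x /=; rewrite in_itv/= andbT.
Qed.

Lemma box_cube (L : R) : box L = cube [tuple - (L / 8) | c < n] (L / 4) :> set Rn.
Proof.
apply/seteqP; split => x h c; have := h c; rewrite tnth_mktuple => /andP[h1 h2];
  apply/andP; split; lra.
Qed.

Lemma measurable_eucl_dist x : measurable_fun setT (eucl_dist x).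
Proof.
rewrite (_ : eucl_dist x = (fun y => (\sum_(i < n) (tnth x i - tnth y i) ^+ 2) `^ 2^-1)).
  apply: (@measurableT_comp _ _ _ _ _ _ (@powR R ^~ 2^-1)) => //.
  apply: measurable_sum => i; apply: measurable_funX; apply: measurable_funB => //.
  exact: measurable_tnth.
apply/funext => y; rewrite powR12_sqrt// sumr_ge0// => i _; exact: sqr_ge0.
Qed.

(** Exhaustion of the kernel: the [N]-th piece is within reach of grids of
    finite depth. *)
Definition piece x (N : nat) : set Rn :=
  [set y | box (8 * 2 ^+ N) y /\ 2^-1 ^+ N < eucl_dist x y].

Lemma exp2_half (N : nat) : 2^-1 ^+ N = (2 ^+ N)^-1 :> R.
Proof. by rewrite exprVn. Qed.

Lemma box_mono N M x : (N <= M)%N -> box (8 * 2 ^+ N) x -> box (8 * 2 ^+ M : R) x.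
Proof.
move=> NM h c; have := h c.
have : 2 ^+ N <= 2 ^+ M :> R by rewrite ler_weXn2l// ler1n.
by move=> e /andP[h1 h2]; apply/andP; split; lra.
Qed.

Lemma box_exists x : exists N, box (8 * 2 ^+ N : R) x.
Proof.
pose S : R := \sum_c `|tnth x c|.
have [N SN] : exists N, S <= 2 ^+ N.
  exists (Num.truncn S).+1; apply: ltW; apply: lt_le_trans (truncnS_gt _) _.
  by rewrite -natrX ler_nat; exact/ltnW/ltn_expl.
exists N => c; rewrite mulrAC divff// mul1r -ler_norml; apply: le_trans SN.
by rewrite /S (bigD1 c)//= lerDl sumr_ge0.
Qed.

Lemma measurable_piece x N : measurable (piece x N).
Proof.
rewrite /piece; have -> : [set y | box (8 * 2 ^+ N) y /\ 2^-1 ^+ N < eucl_dist x y] =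
    box (8 * 2 ^+ N) `&` [set y | 2^-1 ^+ N < eucl_dist x y] by [].
apply: measurableI; first by rewrite box_cube; exact: measurable_cube.
by apply: measurable_superlevel; exact: measurable_eucl_dist.
Qed.

Lemma piece_nondecreasing x : nondecreasing_seq (piece x).
Proof.
move=> N M NM; apply/subsetPset => y [h1 h2]; split; first exact: box_mono h1.
apply: le_lt_trans h2; rewrite !exp2_half lef_pV2 ?posrE ?exprn_gt0//.
by rewrite ler_weXn2l// ler1n.
Qed.

Lemma eucl_dist_ge0 x y : 0 <= eucl_dist x y.
Proof. exact: sqrtr_ge0. Qed.

Lemma bigcup_piece x y : 0 < eucl_dist x y -> (\bigcup_N piece x N) y.
Proof.
move=> d0; have [N bN] := box_exists y.
have [M dM] : exists M, 2^-1 ^+ M < eucl_dist x y.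
  exists (Num.truncn (eucl_dist x y)^-1).+1.
  rewrite exp2_half invf_plt ?posrE ?exprn_gt0//.
  apply: lt_le_trans (truncnS_gt _) _.
  by rewrite -natrX ler_nat; exact/ltnW/ltn_expl.
exists (maxn N M) => //; split; first exact: box_mono (leq_maxl _ _) bN.
apply: le_lt_trans dM; rewrite !exp2_half lef_pV2 ?posrE ?exprn_gt0//.
by rewrite ler_weXn2l ?leq_maxr// ler1n.
Qed.

Lemma riesz_gt (alpha t : R) (h : Rn -> R) x : alpha < n%:R ->
  measurable_fun setT h -> (forall y, 0 <= h y) ->
  (t%:E < riesz alpha h x)%E ->
  exists N0, forall N, (N0 <= N)%N ->
    (t%:E < \int[mu]_(y in piece x N) (h y / (eucl_dist x y `^ (n%:R - alpha)))%:E)%E.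
Proof.
move=> aln mh h0; set d0 := n%:R - alpha; have d00 : d0 != 0 by rewrite subr_eq0 gt_eqF.
pose K y := h y / (eucl_dist x y `^ d0).
have K0 y : 0 <= K y by rewrite divr_ge0 ?powR_ge0.
have mK : measurable_fun setT K.
  apply: measurable_funM => //.
  rewrite (_ : (fun y => _) = (fun y => eucl_dist x y `^ (- d0))); last first.
    by apply/funext => y; rewrite powRN.
  apply: (@measurableT_comp _ _ _ _ _ _ (@powR R ^~ (- d0))) => //.
  exact: measurable_eucl_dist.
have mKe : measurable_fun setT (EFin \o K) by exact/measurable_EFinP.
have -> : (riesz alpha h x = \int[mu]_(y in \bigcup_N piece x N) (K y)%:E)%E.
  rewrite [RHS]integral_mkcond; apply: eq_integral => y _; rewrite /patch.
  case: ifPn => // /negP yN; rewrite -/(K y); congr EFin.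
  have : eucl_dist x y = 0.
    apply/eqP; rewrite eq_le eucl_dist_ge0 andbT leNgt; apply/negP => d.
    by apply: yN; apply/mem_set; exact: bigcup_piece.
  by rewrite /K => ->; rewrite powR0// invr0 mulr0.
have nd := @piece_nondecreasing x; have mp := @measurable_piece x.
have ndK : nondecreasing_seq (fun N => \int[mu]_(y in piece x N) (K y)%:E)%E.
  move=> N M NM; apply: subset_integral; first by move=> y; rewrite lee_fin.
  by apply/subsetPset; exact: nd.
have c1 := @ge0_nondecreasing_set_cvg_integral _ _ _ _ (EFin \o K) mu nd mp.
have c2 : (\int[mu]_(y in piece x N) (K y)%:E)%E @[N --> \oo] -->
    (\int[mu]_(y in \bigcup_N piece x N) (K y)%:E)%E.
  apply: c1; first by move=> i; exact: measurable_funS mKe.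
  by move=> i y _; rewrite lee_fin.
have c3 := ereal_nondecreasing_cvgn ndK.
rewrite (cvg_unique _ c2 c3)//= => /ereal_sup_gt[_ [N0 _ <-] tN0].
by exists N0 => N NN; apply: lt_le_trans tN0 _; exact: ndK.
Qed.

(** Dividing by [G^(1 - 1/q)], where [G = 0] is harmless. *)
Lemma weak_level (t A q G : R) : 0 < t -> 0 <= A -> 0 <= G -> 1 < q ->
  t * G <= A * G `^ (1 - q^-1) -> G <= (A / t) `^ q.
Proof.
move=> t0 A0; rewrite le_eqVlt => /predU1P[<- _ _|G0 q1 h]; first exact: powR_ge0.
have q0 : 0 < q by apply: lt_trans q1.
have : G `^ q^-1 <= A / t.
  rewrite ler_pdivlMr// mulrC -(ler_pM2r (powR_gt0 (1 - q^-1) G0)).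
  by rewrite -mulrA -powRD ?subrKC ?powRr1 ?(ltW G0)// gt_eqF ?implybT.
have AT : 0 <= A / t by rewrite divr_ge0// ltW.
move=> /(ge0_ler_powR (ltW q0) _ _); rewrite !nnegrE powR_ge0 AT => /(_ isT isT).
by rewrite -powRrM mulVf ?gt_eqF// powRr1// ltW.
Qed.

Lemma integral_lty_of_Lp (p : R) s f (A : set Rn) : 1 < p ->
  measurable_fun setT f -> measurable_fun setT s -> measurable A ->
  (forall x, 0 <= f x) -> (forall x, 0 <= s x) -> (Lp_norm p s f < +oo)%E ->
  (\int[mu]_(x in A) (s x)%:E < +oo)%E ->
  (\int[mu]_(x in A) (f x * s x)%:E < +oo)%E.
Proof.
move=> p1 mf ms mA f0 s0 Foo soo; have [r1 pr] := conj_exp_gt1 p1.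
have p0 : 0 < p by apply: lt_trans p1.
have r0 : 0 < conj_exp p by apply: lt_trans r1.
rewrite integral_mkcond (eq_integral (fun x => (f x * \1_A x * s x)%:E)); last first.
  by move=> x _; rewrite /patch indicE; case: (x \in A); rewrite ?mulr1// mulr0 mul0r.
have mA' : measurable_fun setT (\1_A : Rn -> R) by exact: measurable_indic.
apply: le_lt_trans (holder_weight mf mA' ms f0 _ s0 p0 r0 pr) _ => //.
apply: lte_mul_pinfty => //; first exact: poweR_ge0.
  by rewrite ge0_fin_numE ?poweR_ge0.
apply: poweR_lty; move: soo; rewrite integral_mkcond; apply: le_lt_trans.
rewrite le_eqVlt; apply/orP; left; apply/eqP; apply: eq_integral => x _.
rewrite /patch indicE; case: (x \in A); first by rewrite powR1 mul1r.
by rewrite powR0 ?mul0r// gt_eqF.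
Qed.

(** Chebyshev on the simple majorants of the truncated potentials, one for each
    grid, and the dual testing estimate on their superlevel sets. *)
Lemma weak_type_borel (alpha p q : R) :
  0 < alpha < n%:R -> 1 < p -> p < q ->
  exists2 c : R, 0 < c &
  forall u s f (m : set Rn -> R) (C : R),
    borel_weight u -> borel_weight s -> measurable_fun setT f ->
    (forall x, 0 <= f x) -> 0 <= C -> carleson_bound alpha p q u s m C ->
    (Lp_norm p s f < +oo)%E ->
    (weakLp_norm q u (riesz alpha (f \* s)%R) <=
      (c * C `^ (conj_exp p)^-1)%:E * Lp_norm p s f)%E.
Proof.
move=> hal p1 pq; have [c1 c10 gt] := @grid_testing R n alpha p q hal p1 pq.
have q1 : 1 < q by apply: lt_trans pq.
have q0 : 0 < q by apply: lt_trans q1.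
pose d0 := n%:R - alpha.
have aln : alpha < n%:R by case/andP: hal.
have d00 : 0 < d0 by rewrite subr_gt0.
pose M : R := #|{ffun 'I_n -> bool}|%:R.
have M0 : 0 < M.
  rewrite ltr0n; apply/card_gt0P; by exists [ffun=> true].
exists (6 `^ d0 * M * c1); first by rewrite mulr_gt0// mulr_gt0// powR_gt0.
move=> u s f m C bu bs mf f0 C0 cb Foo.
have [mu_ u0 uoo] := bu; have [ms s0 soo] := bs.
pose F := fine (Lp_norm p s f).
have FE : Lp_norm p s f = F%:E.
  by rewrite fineK// ge0_fin_numE// poweR_ge0.
have F0 : 0 <= F by rewrite fine_ge0// poweR_ge0.
pose A := 6 `^ d0 * M * c1 * C `^ (conj_exp p)^-1 * F.
have A0 : 0 <= A.
  by rewrite /A !mulr_ge0 ?powR_ge0 ?(ltW c10)// (ltW M0).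
pose h x := f x * s x.
have mh : measurable_fun setT h by exact: measurable_funM.
have h0 x : 0 <= h x by rewrite mulr_ge0.
rewrite FE -EFinM -/A.
apply: ge_ereal_sup => _ [t /= t0 <-].
(* The box of the [N]-th piece has one eighth of the side of the grid, and cells
   of depth [2 N + 1] have side [4 / 2^N], short enough for [kernel_le]. *)
pose L N : R := 8 * 2 ^+ N; have L0 N : 0 < L N by rewrite mulr_gt0// exprn_gt0.
pose D N := (N + N).+1.
pose I N := ({ffun 'I_n -> bool} * node n (D N))%type.
pose ce N (i : I N) := cell (origin (L N) i.1) (L N) i.2.
have mce N i : measurable (@ce N i) by exact: measurable_cell.
have l0 N Q : 0 < side (@gen n (D N)) (L N) Q by exact: side_gt0.
have sce N i : (\int[mu]_(x in @ce N i) (s x)%:E < +oo)%E.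
  exact: (borel_weight_hcube (corner _ _ _) bs (l0 N i.2)).
have hce N i : (\int[mu]_(x in @ce N i) (h x)%:E < +oo)%E.
  by apply: (integral_lty_of_Lp p1).
pose k N (i : I N) := 6 `^ d0 * ((side (@gen n (D N)) (L N) i.2 `^ d0)^-1 * mass mu h (ce N i)).
have k0 N i : 0 <= k N i by rewrite !mulr_ge0 ?powR_ge0 ?invr_ge0 ?powR_ge0 ?mass_ge0.
pose Phi N x := \sum_i k N i * \1_(ce N i) x.
have mPhi N : measurable_fun setT (Phi N).
  by apply: measurable_sum => i; apply: measurable_funM => //; exact: measurable_indic.
pose E N := box (L N) `&` [set x | t < Phi N x].
have mE N : measurable (E N).
  apply: measurableI; last exact: measurable_superlevel.
  by rewrite box_cube; exact: measurable_cube.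
have uE N : (\int[mu]_(x in E N) (u x)%:E < +oo)%E.
  apply: (@le_lt_trans _ _ (\int[mu]_(x in box (L N)) (u x)%:E)%E).
    by apply: subset_integral => [x|]; [rewrite lee_fin|exact: subIsetl].
  by rewrite box_cube; apply: uoo; rewrite divr_gt0.
have testE N : mass mu u (E N) <= (A / t) `^ q.
  apply: weak_level => //; first exact: mass_ge0.
  pose uE_ x := u x * \1_(E N) x.
  have muE : measurable_fun setT uE_ by apply: measurable_funM => //; exact: measurable_indic.
  have uE0 x : 0 <= uE_ x by rewrite mulr_ge0.
  have massuE B : (\int[mu]_(x in B) (uE_ x)%:E = \int[mu]_(x in B `&` E N) (u x)%:E)%E.
    rewrite integral_mkcondr; apply: eq_integral => x _.
    by rewrite /uE_ /patch indicE; case: (x \in E N); rewrite ?mulr1 ?mulr0.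
  have uEoo B : (\int[mu]_(x in B) (uE_ x)%:E < +oo)%E.
    rewrite massuE; apply: le_lt_trans (uE N).
    by apply: subset_integral => [x|]; [rewrite lee_fin|exact: subIsetr].
  rewrite -lee_fin EFinM (massE u0 (@subset_refl _ (E N)))//.
  apply: (@le_trans _ _ (\int[mu]_x (Phi N x * uE_ x)%:E)%E).
    rewrite -[in leLHS](setTI (E N)) -massuE -ge0_integralZl//; last 3 first.
    - exact/measurable_EFinP.
    - by move=> x _; rewrite lee_fin.
    - by rewrite lee_fin ltW.
    apply: ae_le_integral => [x|x|].
    - by rewrite mule_ge0 ?lee_fin// ltW.
    - by rewrite lee_fin mulr_ge0// sumr_ge0// => i _; rewrite mulr_ge0.
    apply: aeW => x; rewrite -EFinM lee_fin /uE_ indicE.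
    have [/set_mem[_ /= tx]|] := boolP (x \in E N); last by rewrite !mulr0.
    by rewrite ler_wpM2r ?mulr1// ltW.
  rewrite integral_sum_mass//.
  have step (T : {ffun 'I_n -> bool}) :
      \sum_(Q : node n (D N)) (side (@gen n (D N)) (L N) Q `^ d0)^-1 *
        mass mu u (cell (origin (L N) T) (L N) Q `&` E N) *
        mass mu h (cell (origin (L N) T) (L N) Q) <=
      c1 * C `^ (conj_exp p)^-1 * mass mu u (E N) `^ (1 - q^-1) * F.
    rewrite -lee_fin [leRHS]EFinM -FE.
    apply: le_trans (gt u s f m C bu bs mf f0 C0 cb Foo (origin (L N) T) _ (D N) _ (L0 N) (mE N) (uE N)).
    rewrite -sumEFin; apply: lee_sum => Q _; rewrite EFinM; apply: lee_wpmul2l.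
      by rewrite lee_fin mulr_ge0 ?mass_ge0// invr_ge0 powR_ge0.
    by rewrite (massE h0 (@subset_refl _ _))//; exact: (hce N (T, Q)).
  rewrite lee_fin.
  have -> : \sum_i k N i * mass mu uE_ (ce N i) = \sum_T \sum_Q k N (T, Q) *
      mass mu u (ce N (T, Q) `&` E N).
    rewrite pair_bigA/=; apply: eq_bigr => -[T Q] _ /=.
    by congr (_ * _); rewrite /mass massuE.
  apply: (@le_trans _ _ (\sum_(T : {ffun 'I_n -> bool}) 6 `^ d0 *
     (c1 * C `^ (conj_exp p)^-1 * mass mu u (E N) `^ (1 - q^-1) * F))).
    apply: ler_sum => T _; apply: le_trans (ler_wpM2l (powR_ge0 6 d0) (step T)).
    rewrite mulr_sumr; apply: ler_sum => Q _; rewrite /k/= -!mulrA.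
    by rewrite [X in _ * (_ * X)]mulrC.
  rewrite sumr_const -[X in X <= _]mulr_natl (_ : _%:R = M); last first.
    by congr _%:R; exact: eq_card.
  rewrite /A le_eqVlt; apply/orP; left; apply/eqP.
  by move: (mass _ _ _ `^ _) (C `^ _) (6 `^ _) => ? ? ?; ring.
(* No measurability of the potential is needed: its superlevel set lies in the
   lower limit of the sets [E N]. *)
have sub : [set x | (t%:E < `|riesz alpha (f \* s)%R x|)%E] `<=`
    \bigcup_N \bigcap_(j in [set j | (N <= j)%N]) E j.
  move=> x /=; rewrite gee0_abs; last first.
    by apply: integral_ge0 => y _; rewrite lee_fin divr_ge0 ?powR_ge0// mulr_ge0.
  move=> tx; have [N0 hN0] := riesz_gt aln mh h0 tx; have [N1 bx] := box_exists x.
  exists (maxn N0 N1) => // N /=; rewrite geq_max => /andP[N0N N1N].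
  have bxN : box (L N) x by exact: box_mono bx.
  split=> //=; rewrite -lte_fin; apply: lt_le_trans (hN0 N N0N) _.
  apply: (@le_trans _ _ (\int[mu]_y ((\sum_i (6 `^ d0 *
      ((side (@gen n (D N)) (L N) i.2 `^ d0)^-1 * \1_(ce N i) x)) * \1_(ce N i) y) * h y)%:E)%E).
    rewrite integral_mkcond; apply: ae_le_integral => [y|y|].
    - by apply: erestrict_ge0 => z _; rewrite lee_fin divr_ge0 ?powR_ge0.
    - rewrite lee_fin mulr_ge0// sumr_ge0// => i _.
      by rewrite !mulr_ge0 ?powR_ge0 ?invr_ge0 ?powR_ge0.
    apply: aeW => y; rewrite /patch; case: ifPn => [/set_mem[bY dy]|_]; last first.
      rewrite lee_fin mulr_ge0// sumr_ge0// => i _.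
      by rewrite !mulr_ge0 ?powR_ge0 ?invr_ge0 ?powR_ge0.
    rewrite lee_fin mulrC ler_wpM2r//.
    have dL : L N * 2^-1 ^+ D N / 6 < eucl_dist x y.
      apply: le_lt_trans dy; rewrite /L /D exprS exprD exp2_half.
      have : 2 ^+ N != 0 :> R by rewrite expf_neq0.
      have : 0 < 2 ^+ N :> R by rewrite exprn_gt0.
      move: (2 ^+ N) => z z0 zn; rewrite (_ : _ / 6 = 2 / 3 * z^-1); last by field.
      by rewrite ler_piMl// ?invr_ge0 ?(ltW z0)//; lra.
    apply: le_trans (kernel_le (L0 N) d00 bxN bY dL) _.
    rewrite pair_bigA/= mulr_sumr le_eqVlt; apply/orP; left; apply/eqP.
    by apply: eq_bigr => -[T Q] _ /=; rewrite !mulrA.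
  rewrite integral_sum_mass//; last first.
    by move=> i; rewrite !mulr_ge0 ?powR_ge0 ?invr_ge0 ?powR_ge0.
  rewrite lee_fin le_eqVlt; apply/orP; left; apply/eqP; apply: eq_bigr => i _.
  by rewrite /k -!mulrA; congr (_ * (_ * _)); rewrite mulrC.
pose Gs N := \bigcap_(j in [set j | (N <= j)%N]) E j.
have mG N : measurable (Gs N) by apply: bigcap_measurable => [|j _]; [exists N => /=|exact: mE].
have ndG : nondecreasing_seq Gs.
  move=> N N' NN'; apply/subsetPset => x Gx j /= N'j; apply: Gx => /=.
  exact: leq_trans N'j.
have level : (wmeas u [set x | (t%:E < `|riesz alpha (f \* s)%R x|)%E] <= ((A / t) `^ q)%:E)%E.
  apply: (@le_trans _ _ (\int[mu]_(x in \bigcup_N Gs N) (u x)%:E)%E).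
    by apply: subset_integral => // x; rewrite lee_fin.
  have c1' := @ge0_nondecreasing_set_cvg_integral _ _ _ _ (EFin \o u) mu ndG mG.
  have c2 : (\int[mu]_(y in Gs N) (u y)%:E)%E @[N --> \oo] -->
      (\int[mu]_(y in \bigcup_N Gs N) (u y)%:E)%E.
    apply: c1'; last by move=> i y _; rewrite lee_fin.
    by move=> i; apply/measurable_EFinP; exact: measurable_funS mu_.
  rewrite -(cvg_lim _ c2)//; apply: lime_le; first by apply/cvg_ex; eexists; exact: c2.
  apply: nearW => N; apply: (@le_trans _ _ (\int[mu]_(y in E N) (u y)%:E)%E).
    apply: subset_integral => [x|x Gx]; first by rewrite lee_fin.
    by apply: Gx => /=.
  by rewrite -(massE u0 (@subset_refl _ (E N)))// lee_fin.
apply: (@le_trans _ _ (t%:E * ((A / t) `^ q)%:E `^ q^-1)%E).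
  apply: lee_wpmul2l; first by rewrite lee_fin ltW.
  apply: gt0_ler_poweR => //; rewrite ?invr_ge0 ?(ltW q0)// in_itv/= leey andbT.
    by apply: integral_ge0 => x _; rewrite lee_fin.
  by rewrite lee_fin powR_ge0.
rewrite poweR_EFin -EFinM lee_fin -powRrM mulfV ?gt_eqF// powRr1; last first.
  by rewrite divr_ge0// ltW.
by rewrite mulrC divfK// gt_eqF.
Qed.

End weak_type.

(** * Carleson bounds from the two [A_infinity] constants *)

Lemma sum_levels_linear (R : realType) (b z : R) M : 0 < b -> 0 <= z ->
  \sum_(i < M | b * 2 ^+ i < z) (b * 2 ^+ i) <= 2 * z.
Proof.
move=> b0 z0; have := sum_levels_le M b0 ltr01 z0.
have e : (2 : R) `^ 1 / (2 `^ 1 - 1) = 2 by rewrite powRr1//; field.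
rewrite e powRr1//; apply: le_trans; apply: ler_sum => i _.
by rewrite powRr1// mulr_ge0 ?exprn_ge0// ltW.
Qed.

Section maximal_function.
Context (R : realType) (n : nat).

Lemma mem_cubes (a : Rn R n) (l : R) : 0 < l -> cubes (cube a l).
Proof. by move=> ll; exists a, l. Qed.

Lemma avg_ge0 (w : Rn R n -> R) Q : (forall x, 0 <= w x) -> (0 <= avg w Q)%E.
Proof.
by move=> w0; rewrite /avg mule_ge0 ?inve_ge0 ?integral_ge0// => x _; rewrite lee_fin.
Qed.

Lemma HLmax_ge0 (f : Rn R n -> R) x : (0 <= HLmax f x)%E.
Proof.
apply: le_trans (ereal_sup_ubound _); last first.
  exists (cube x 1); last reflexivity.
  by split=> [|c]; [exact: mem_cubes|rewrite lexx lerDl ler01].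
exact: avg_ge0.
Qed.

End maximal_function.

Section carleson_bounds.
Context (R : realType) (n : nat).
Local Notation Rn := (Rn R n).
Local Notation mu := (lebesgue R n).
Implicit Types (u w : Rn -> R).
Variables (D : nat) (o : Rn) (L : R).
Hypothesis L0 : 0 < L.
Local Notation node := (node n D).
Local Notation vol := (fun Q : node => side (@gen n D) L Q ^+ n).

Let l0 (Q : node) : 0 < side (@gen n D) L Q. Proof. exact: side_gt0. Qed.

Let v0 (Q : node) : 0 < vol Q. Proof. exact: exprn_gt0. Qed.

Lemma lebesgue_cell (Q : node) : mu (cell o L Q) = (vol Q)%:E.
Proof. exact: lebesgue_hcube. Qed.

Lemma integral_cst1 (A : set Rn) : measurable A ->
  (\int[mu]_(x in A) (cst (1 : R) x)%:E = mu A)%E.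
Proof.
move=> mA; transitivity (\int[mu]_(x in A) cst 1%E x)%E => //.
by rewrite integral_cst// mul1e.
Qed.

Lemma mass_cst1 (Q : node) : mass mu (cst 1) (cell o L Q) = vol Q.
Proof.
by rewrite /mass integral_cst1 ?lebesgue_cell//; exact: measurable_cell.
Qed.

Lemma cst1_lty (Q : node) : (\int[mu]_(x in cell o L Q) (cst (1 : R) x)%:E < +oo)%E.
Proof.
by rewrite integral_cst1 ?lebesgue_cell ?ltry//; exact: measurable_cell.
Qed.

Lemma mass_hcube w (Q : node) : borel_weight w ->
  (mass mu w (cell o L Q))%:E = wmeas w (cube (corner o L Q) (side (@gen n D) L Q)).
Proof.
move=> bw; have [mw w0 woo] := bw.
rewrite (massE w0 (@subset_refl _ _)); last exact: borel_weight_hcube.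
exact: integral_hcube.
Qed.

(** On the maximal cubes where the average of [u] exceeds a level, the maximal
    function exceeds it as well. *)
Lemma carleson_maximal u (a : R) (P : pred node) (Q : node) :
  borel_weight u -> 0 <= a -> (AM_const u <= a%:E)%E ->
  packed (@sub_node n D) vol P ->
  \sum_(S | P S && sub_node S Q) mass mu u (cell o L S) <=
    12 * a * mass mu u (cell o L Q).
Proof.
move=> bu a0 ua pP; have [mu_ u0 uoo] := bu.
have tT := node_tree n D.
pose U (S : node) := mass mu u (cell o L S).
have U0 S : 0 <= U S by exact: mass_ge0.
have Uoo (S : node) : (\int[mu]_(x in cell o L S) (u x)%:E < +oo)%E.
  exact: (borel_weight_hcube (corner o L S) bu (l0 S)).
pose phi S := U S / vol S.
have phi0 S : 0 <= phi S by rewrite divr_ge0// ltW.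
have [b [M lev]] := exists_levels phi0; have [b0 _] := lev.
have bn0 i : 0 < b * 2 ^+ i by rewrite mulr_gt0// exprn_gt0.
pose Ma i S := maximal (@sub_node n D) (fun S => sub_node S Q && (b * 2 ^+ i < phi S)) S.
pose CQ := cube (corner o L Q) (side (@gen n D) L Q).
pose Z := HLmax (u \* \1_CQ).
have Z0 y : (0 <= Z y)%E by exact: HLmax_ge0.
have phiZ (S : node) y : sub_node S Q -> cell o L S y -> ((phi S)%:E <= Z y)%E.
  move=> SQ Sy; pose CS := cube (corner o L S) (side (@gen n D) L S).
  apply: (@le_trans _ _ (avg (fun x => `|(u \* \1_CQ) x|) CS)); last first.
    apply: ereal_sup_ubound => /=; exists CS => //; split; last exact: hcube_sub.
    exact: mem_cubes.
  rewrite /avg lebesgue_cube ?(ltW (l0 S))// inver gt_eqF ?v0// /phi mulrC EFinM.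
  apply: lee_wpmul2l; first by rewrite lee_fin invr_ge0 ltW.
  rewrite (massE u0 (@subset_refl _ _) (Uoo S)).
  rewrite [leLHS]integral_mkcond [leRHS]integral_mkcond.
  apply: ae_le_integral; [by apply: erestrict_ge0 => x _; rewrite lee_fin..|].
  apply: aeW => x; rewrite /patch; case: ifPn => [/set_mem Sx|_]; last first.
    by case: ifP => // _; rewrite lee_fin.
  rewrite mem_set; last exact: hcube_sub.
  rewrite lee_fin /= indicE mem_set ?mulr1 ?ler_norm//.
  by apply: hcube_sub; apply: (cell_sub L0 SQ).
have main : \sum_(S | P S && sub_node S Q) U S <=
    3 * \sum_(i < M) (b * 2 ^+ i.+1) * \sum_(S | Ma i S) vol S.
  have := @carleson_layers R node (@gen n D) (@sub_node n D) tT phi vol vol P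
    (fun S => sub_node S Q) 3 1 b M ltr01 lev phi0 (fun S => ltW (v0 S)) pP.
  rewrite (eq_bigr U); last first.
    by move=> S _; rewrite powRr1// /phi mulrC divfK// gt_eqF ?v0.
  move=> h; apply: le_trans h _; rewrite ler_wpM2l//; apply: ler_sum => i _.
  by rewrite powRr1// ltW.
have Zint : ((\sum_(i < M) (b * 2 ^+ i) / 2 * \sum_(S | Ma i S) vol S)%:E <=
    \int[mu]_(x in CQ) Z x)%E.
  pose I := ('I_M * node)%type.
  pose k (i : I) := b * 2 ^+ i.1 / 2.
  have k0 i : 0 <= k i by rewrite divr_ge0// ltW.
  have -> : \sum_(i < M) (b * 2 ^+ i) / 2 * \sum_(S | Ma i S) vol S =
      \sum_(i : I | Ma i.1 i.2) k i * mass mu (cst 1) (cell o L i.2).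
    under eq_bigr do rewrite mulr_sumr.
    rewrite (pair_big_dep xpredT (fun i : 'I_M => Ma i) (fun i S => b * 2 ^+ i / 2 * vol S))/=.
    by apply: eq_bigr => i _; rewrite mass_cst1.
  rewrite -integral_sum_mass//; last 2 first.
  - by move=> i; exact: measurable_cell.
  - by move=> i; exact: cst1_lty.
  rewrite [leRHS]integral_mkcond; apply: ae_le_integral => [x|x|].
  - by rewrite lee_fin mulr1 sumr_ge0// => i _; rewrite mulr_ge0.
  - exact: erestrict_ge0.
  apply: aeW => y; rewrite mulr1.
  rewrite -(pair_big_dep xpredT (fun i : 'I_M => Ma i)
    (fun i S => b * 2 ^+ i / 2 * \1_(cell o L S) y))/=.
  under eq_bigr do rewrite -mulr_sumr.
  rewrite /patch; case: ifPn => [yQ|/negP yQ]; last first.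
    rewrite lee_fin big1// => i _; rewrite big1 ?mulr0// => S /maximal_sub/= /andP[SQ _].
    rewrite indicE; case: (boolP (y \in _)) => // /set_mem yS; exfalso; apply: yQ.
    by apply/mem_set/hcube_sub; apply: (cell_sub L0 SQ).
  have [->|Zfin] := eqVneq (Z y) +oo%E; first by rewrite leey.
  have ZE : (Z y = (fine (Z y))%:E)%E by rewrite fineK// ge0_fin_numE// ltey.
  rewrite ZE lee_fin; set z := fine (Z y).
  have z0 : 0 <= z by rewrite fine_ge0.
  apply: (@le_trans _ _ (\sum_(i < M | b * 2 ^+ i < z) (b * 2 ^+ i) / 2)).
    rewrite [leRHS]big_mkcond; apply: ler_sum => i _; case: ifPn => bz; last first.
      rewrite big1 ?mulr0// => S /maximal_sub/= /andP[SQ bS].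
      rewrite indicE; case: (boolP (y \in _)) => // /set_mem yS; exfalso.
      move/negP: bz; apply; apply: lt_le_trans bS _.
      by rewrite -lee_fin -ZE; exact: phiZ.
    rewrite ler_piMr ?divr_ge0 ?(ltW (bn0 i))//.
    apply: (@le_trans _ _ (\1_(setT : set Rn) y)); last by rewrite indicE in_setT.
    apply: sum_indic_disjoint => // S S' MS MS'.
    exact: (antichain_cell L0 (@maximal_antichain _ _ _) MS MS').
  have := sum_levels_linear M b0 z0; rewrite -mulr_suml.
  by move: (\sum_(i < M | _) _) => X h; rewrite ler_pdivrMr// mulrC.
have ZU : (\int[mu]_(x in CQ) Z x <= (a * U Q)%:E)%E.
  have [UQ|UQ] := eqVneq (U Q) 0.
    have -> : Z = (fun=> 0%E).
      apply/funext => y; apply/eqP; rewrite eq_le Z0 andbT.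
      apply: ge_ereal_sup => _ [A [[x [l [ll ->]] Ay] <-]].
      rewrite /avg (_ : \int[mu]_(z in _) _ = 0)%E ?mule0//.
      apply/eqP; rewrite eq_le integral_ge0 ?andbT; last by move=> z _; rewrite lee_fin.
      rewrite -[leRHS](_ : (U Q)%:E = _); last by rewrite UQ.
      rewrite /U mass_hcube// /wmeas.
      rewrite [leLHS]integral_mkcond [leRHS]integral_mkcond.
      apply: ae_le_integral; [by apply: erestrict_ge0 => z _; rewrite lee_fin..|].
      apply: aeW => z; rewrite /patch -/CQ /= indicE.
      by case: (z \in cube _ _); case: (z \in CQ);
        rewrite ?mulr1 ?mulr0 ?normr0 ?lee_fin ?ger0_norm.
    by rewrite integral0 UQ mulr0.
  have UQ0 : 0 < U Q by rewrite lt_neqAle eq_sym UQ U0.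
  have : ((wmeas u CQ)^-1 * \int[mu]_(x in CQ) Z x <= a%:E)%E.
    apply: le_trans ua; apply: ereal_sup_ubound; exists CQ => //.
    exact: mem_cubes.
  rewrite -(mass_hcube Q bu) -/(U Q) inver (negPf UQ) => h.
  have := lee_wpmul2l (_ : (0 <= (U Q)%:E)%E) h; rewrite lee_fin => /(_ (U0 _)).
  by rewrite muleA -EFinM divff// mul1e -EFinM mulrC.
have fin := le_trans Zint ZU; rewrite lee_fin in fin.
apply: le_trans main _.
rewrite (_ : 12 * a * _ = 12 * (a * U Q)); last by rewrite mulrA.
apply: le_trans (ler_wpM2l _ fin) => //.
rewrite (_ : \sum_(i < M) b * 2 ^+ i.+1 * _ =
    4 * \sum_(i < M) b * 2 ^+ i / 2 * \sum_(S | Ma i S) vol S); last first.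
  by rewrite mulr_sumr; apply: eq_bigr => i _; rewrite exprS; field.
by rewrite mulrA (_ : 3 * 4 = 12 :> R)//; ring.
Qed.

End carleson_bounds.

Section carleson_sqrt.
Context (R : realType) (n : nat).
Local Notation Rn := (Rn R n).
Local Notation mu := (lebesgue R n).
Implicit Types (u w h : Rn -> R).

Lemma measurable_sqrt_fun u : measurable_fun setT u -> (forall x, 0 <= u x) ->
  measurable_fun setT (fun x => Num.sqrt (u x)).
Proof.
move=> mu_ u0; rewrite (_ : (fun x => _) = (fun x => u x `^ 2^-1)).
  exact: (@measurableT_comp _ _ _ _ _ _ (@powR R ^~ 2^-1)).
by apply/funext => x; rewrite powR12_sqrt.
Qed.

Lemma borel_weight_sqrt u : borel_weight u ->
  borel_weight (fun x => Num.sqrt (u x)).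
Proof.
move=> [mu_ u0 uoo]; split=> [|x|a l ll].
- exact: measurable_sqrt_fun.
- exact: sqrtr_ge0.
have mC := measurable_cube a l.
apply: (@le_lt_trans _ _ (\int[mu]_(x in cube a l) ((u x)%:E + cst 1%E x))%E).
  apply: ae_le_integral => [x|x|].
  - by rewrite lee_fin sqrtr_ge0.
  - by rewrite /= lee_fin addr_ge0.
  apply: aeW => x; rewrite /= lee_fin.
  have := sqr_sqrtr (u0 x); have := sqrtr_ge0 (u x).
  move: (Num.sqrt (u x)) => y y0 <-; rewrite -subr_ge0.
  have -> : y ^+ 2 + 1 - y = (y - 2^-1) ^+ 2 + 3 / 4 by field.
  by rewrite addr_ge0 ?sqr_ge0.
rewrite ge0_integralD//.
- have -> : (\int[mu]_(x in cube a l) cst 1%E x = (l ^+ n)%:E)%E.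
    by rewrite -(lebesgue_cube a (ltW ll)); exact: integral_cst1.
  by rewrite lte_add_pinfty ?ltry// uoo.
- by move=> x _; rewrite lee_fin.
- by apply/measurable_EFinP; exact: measurable_funS mu_.
Qed.

Variables (D : nat) (o : Rn) (L : R).
Hypothesis L0 : 0 < L.
Local Notation node := (node n D).
Local Notation vol := (fun Q : node => side (@gen n D) L Q ^+ n).

Let l0 (Q : node) : 0 < side (@gen n D) L Q. Proof. exact: side_gt0. Qed.

Let v0 (Q : node) : 0 < vol Q. Proof. exact: exprn_gt0. Qed.

Lemma mass_truncate h (S : node) (c : R) : borel_weight h -> 0 <= c ->
  mass mu h (cell o L S) <=
    mass mu h (cell o L S `&` [set x | c < h x]) + c * vol S.
Proof.
move=> bh c0; have [mh h0 hoo] := bh.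
have hS : (\int[mu]_(x in cell o L S) (h x)%:E < +oo)%E.
  exact: (borel_weight_hcube (corner o L S) bh (l0 S)).
have mS := @measurable_cell R n D o L S.
have mG := measurable_superlevel c mh.
have lE : wmeas (cst 1) (cell o L S) = (vol S)%:E.
  by rewrite /wmeas integral_cst1 ?lebesgue_cell.
rewrite -lee_fin EFinD EFinM -lE (massE h0 (@subset_refl _ _) hS).
rewrite (massE h0 (@subIsetl _ _ _) hS) /wmeas integral_mkcondr.
have -> : (c%:E * \int[mu]_(x in cell o L S) (cst (1 : R) x)%:E =
    \int[mu]_(x in cell o L S) (c%:E * (cst (1 : R) x)%:E))%E.
  by rewrite ge0_integralZl//; exact: (measurable_cst 1%E).
rewrite -ge0_integralD//; last 4 first.
- by move=> x _; apply: erestrict_ge0 => z _; rewrite lee_fin.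
- apply/measurable_restrict => //; apply/measurable_EFinP; exact: measurable_funS mh.
- by move=> x _; rewrite /= mule1 lee_fin.
- exact: (measurable_cst (c%:E * 1%:E)%E).
apply: ae_le_integral => [x|x|].
- by rewrite lee_fin.
- by rewrite adde_ge0 ?mule1 ?lee_fin//; apply: erestrict_ge0 => z _; rewrite lee_fin.
apply: aeW => x; rewrite /patch; case: ifPn => [_|/negP xG].
  by rewrite mule1 leeDl ?lee_fin.
by rewrite add0e mule1 lee_fin leNgt; apply/negP => cx; apply: xG; exact/mem_set.
Qed.

(** The [L^2] maximal inequality for [h = sqrt u], in the form of a Carleson
    embedding: where the average of [h] exceeds a level, half of it comes from
    the set where [h] exceeds half of the level. *)
Lemma carleson_sqrt u (P : pred node) (Q : node) : borel_weight u ->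
  packed (@sub_node n D) vol P ->
  \sum_(S | P S && sub_node S Q)
    mass mu (fun x => Num.sqrt (u x)) (cell o L S) ^+ 2 / vol S <=
    96 * mass mu u (cell o L Q).
Proof.
move=> bu pP; have [mu_ u0 uoo] := bu.
have bh := borel_weight_sqrt bu; have [mh h0 hoo] := bh.
set h := fun x => Num.sqrt (u x) in bh mh h0 hoo *; have {}h0 x : 0 <= h x by exact: h0.
have tT := node_tree n D.
pose H (S : node) := mass mu h (cell o L S).
have H0 S : 0 <= H S by exact: mass_ge0.
have Hoo (S : node) : (\int[mu]_(x in cell o L S) (h x)%:E < +oo)%E.
  exact: (borel_weight_hcube (corner o L S) bh (l0 S)).
pose phi S := H S / vol S.
have phi0 S : 0 <= phi S by rewrite divr_ge0// ltW.
have [b [M lev]] := exists_levels phi0; have [b0 _] := lev.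
have bn0 i : 0 < b * 2 ^+ i by rewrite mulr_gt0// exprn_gt0.
pose Ma i S := maximal (@sub_node n D) (fun S => sub_node S Q && (b * 2 ^+ i < phi S)) S.
pose G (i : nat) : set Rn := [set x | b * 2 ^+ i / 2 < h x].
have mG i : measurable (G i) by exact: measurable_superlevel.
have main : \sum_(S | P S && sub_node S Q) H S ^+ 2 / vol S <=
    3 * \sum_(i < M) (b * 2 ^+ i.+1) ^+ 2 * \sum_(S | Ma i S) vol S.
  have := @carleson_layers R node (@gen n D) (@sub_node n D) tT phi vol vol P
    (fun S => sub_node S Q) 3 2 b M (ltr0n R 2) lev phi0 (fun S => ltW (v0 S)) pP.
  rewrite (eq_bigr (fun S => H S ^+ 2 / vol S)); last first.
    move=> S _; rewrite powR_mulrn// /phi; have := lt0r_neq0 (v0 S).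
    by move: (vol S) (H S) => x y x0; field.
  move=> h1; apply: le_trans h1 _; rewrite ler_wpM2l//; apply: ler_sum => i _.
  by rewrite powR_mulrn// ltW.
have layer (i : 'I_M) : \sum_(S | Ma i S) vol S <=
    2 / (b * 2 ^+ i) * mass mu h (cell o L Q `&` G i).
  rewrite mulrAC ler_pdivlMr// mulr_suml.
  apply: (@le_trans _ _ (\sum_(S | Ma i S) 2 * mass mu h (cell o L S `&` G i))).
    apply: ler_sum => S /maximal_sub/= /andP[_]; rewrite /phi ltr_pdivlMr// => /ltW bS.
    have c0 : 0 <= b * 2 ^+ i / 2 by rewrite divr_ge0// ltW.
    have := le_trans bS (mass_truncate S bh c0).
    rewrite -/(G i); move: (mass _ _ _) (vol S) (b * 2 ^+ i) => x y z; lra.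
  rewrite -mulr_sumr ler_wpM2l//.
  apply: (@sum_mass_le _ _ _ mu h mh h0 _ (Ma i) (fun S : node => cell o L S `&` G i)).
  - by move=> S; apply: measurableI => //; exact: measurable_cell.
  - by apply: measurableI => //; exact: measurable_cell.
  - move=> S /maximal_sub/= /andP[SQ _]; apply: setSI; exact: cell_sub.
  - move=> S S' x MS MS' [Sx _] [S'x _].
    exact: (antichain_cell L0 (@maximal_antichain _ _ _) MS MS' Sx S'x).
  - apply: le_lt_trans (Hoo Q); apply: subset_integral => [x|]; last exact: subIsetl.
    by rewrite lee_fin.
have sumG : \sum_(i < M) b * 2 ^+ i * mass mu h (cell o L Q `&` G i) <=
    4 * mass mu u (cell o L Q).
  have uQ := borel_weight_hcube (corner o L Q) bu (l0 Q).
  rewrite -lee_fin EFinM (massE u0 (@subset_refl _ _) uQ).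
  rewrite -(@integral_sum_mass _ _ _ mu h mh h0 _ xpredT
    (fun i : 'I_M => cell o L Q `&` G i) (fun i => b * 2 ^+ i)); last 3 first.
  - by move=> i; rewrite ltW.
  - by move=> i; apply: measurableI => //; exact: measurable_cell.
  - move=> i; apply: le_lt_trans (Hoo Q); apply: subset_integral => [x|]; last exact: subIsetl.
    by rewrite lee_fin.
  have mQ := @measurable_cell R n D o L Q.
  have mR : measurable_fun setT ((fun x => (u x)%:E) \_ (cell o L Q)).
    apply/(measurable_restrictT (EFin \o u)) => //.
    by apply/measurable_EFinP; exact: measurable_funS mu_.
  have R0 x : (0 <= ((fun x => (u x)%:E) \_ (cell o L Q)) x)%E.
    by apply: erestrict_ge0 => z _; rewrite lee_fin.
  rewrite [in leRHS]integral_mkcond -ge0_integralZl//.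
  apply: ae_le_integral => [x|x|].
  - by rewrite lee_fin mulr_ge0// sumr_ge0// => i _; rewrite mulr_ge0// ltW.
  - by rewrite mule_ge0// ?lee_fin//; apply: erestrict_ge0 => z _; rewrite lee_fin.
  apply: aeW => x; rewrite /patch; case: ifPn => [xQ|/negP xQ]; last first.
    rewrite mule0 lee_fin big1 ?mul0r// => i _.
    rewrite indicE (_ : (_ \in _) = false) ?mulr0//.
    by apply/negP => /set_mem[Qx _]; apply: xQ; exact/mem_set.
  rewrite -EFinM lee_fin.
  apply: (@le_trans _ _ (2 * (2 * h x) * h x)).
    rewrite ler_wpM2r//.
    have h20 : 0 <= 2 * h x by rewrite mulr_ge0.
    apply: le_trans (sum_levels_linear M b0 h20).
    rewrite [leRHS]big_mkcond; apply: ler_sum => i _; rewrite indicE in_setI xQ/=.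
    case: (boolP (x \in G i)) => [/set_mem/= xG|_]; last first.
      by rewrite mulr0; case: ifP => // _; exact: ltW.
    have bh2 : b * 2 ^+ i < 2 * h x.
      by have : b * 2 ^+ i / 2 < h x := xG; lra.
    by rewrite mulr1 bh2.
  rewrite -mulrA -mulrA -expr2 /h sqr_sqrtr// mulrA.
  by rewrite -natrM.
apply: le_trans main _.
apply: (@le_trans _ _ (3 * \sum_(i < M) 8 * (b * 2 ^+ i * mass mu h (cell o L Q `&` G i)))).
  rewrite ler_wpM2l//; apply: ler_sum => i _.
  apply: le_trans (ler_wpM2l (sqr_ge0 _) (layer i)) _.
  have -> : b * 2 ^+ i.+1 = 2 * (b * 2 ^+ i) by rewrite exprS mulrCA.
  rewrite le_eqVlt; apply/orP; left; apply/eqP.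
  have := lt0r_neq0 (bn0 i); move: (b * 2 ^+ i) (mass _ _ _) => y z y0; field.
  exact: y0.
rewrite -mulr_sumr mulrA (_ : 96 = 3 * 8 * 4 :> R); last by ring.
by rewrite -[leRHS]mulrA ler_wpM2l.
Qed.

End carleson_sqrt.

Section jensen.
Context (R : realType) (n : nat).
Local Notation Rn := (Rn R n).
Local Notation mu := (lebesgue R n).
Implicit Types (u w : Rn -> R).

Lemma le_integral_pointwise d (X : measurableType d) (m : {measure set X -> \bar R})
    (D : set X) (f g : X -> \bar R) : (forall x, f x <= g x)%E ->
  (\int[m]_(x in D) f x <= \int[m]_(x in D) g x)%E.
Proof.
move=> fg; rewrite integralE [leRHS]integralE; apply: leeB;
  apply: ae_le_integral => // ; apply: aeW => x; rewrite ?funeposE ?funenegE.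
- by rewrite ge_max !le_max fg lexx orbT.
- by rewrite ge_max !le_max leeN2 fg lexx orbT.
Qed.

Variables (a : Rn) (l : R).
Hypothesis ll : 0 < l.
Local Notation Q := (cube a l).
Local Notation v := (l ^+ n).

Let v0 : 0 < v. Proof. exact: exprn_gt0. Qed.

Let mQ : measurable Q. Proof. exact: measurable_cube. Qed.

Lemma integral_cube_mass w : borel_weight w ->
  (\int[mu]_(x in Q) (w x)%:E = (mass mu w (hcube a l))%:E)%E.
Proof.
move=> bw; have [mw w0 woo] := bw.
rewrite (massE w0 (@subset_refl _ _)); last exact: borel_weight_hcube.
by rewrite integral_hcube.
Qed.

Lemma avg_cube w : borel_weight w ->
  avg w Q = (mass mu w (hcube a l) / v)%:E.
Proof.
move=> bw; rewrite /avg integral_cube_mass// lebesgue_cube ?ltW// inver gt_eqF//.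
by rewrite -EFinM mulrC.
Qed.

Lemma mass_sqrt_gt0 u : borel_weight u -> 0 < mass mu u (hcube a l) ->
  0 < mass mu (fun x => Num.sqrt (u x)) (hcube a l).
Proof.
move=> bu U0; have bh := borel_weight_sqrt bu.
have [mu_ u0 uoo] := bu; have [mh h0 hoo] := bh.
rewrite lt_neqAle mass_ge0// andbT; apply/negP => /eqP H0.
have hQ := integral_cube_mass bh; rewrite -H0 in hQ.
have mhQ : measurable_fun Q (fun x => (Num.sqrt (u x))%:E).
  by apply/measurable_EFinP; exact: measurable_funS mh.
have /(ae_eq_integral_abs mu mQ mhQ) hae : (\int[mu]_(x in Q) `|(Num.sqrt (u x))%:E| = 0)%E.
  by rewrite -[RHS]hQ; apply: eq_integral => x _; rewrite gee0_abs// lee_fin.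
have : (\int[mu]_(x in Q) (u x)%:E = 0)%E.
  rewrite integral_mkcond (ae_eq_integral_nonmeasurable setT (g := fun=> 0%E)) ?integral0//.
  move: hae; apply: filterS => x; rewrite /patch; case: ifPn => // /set_mem Qx /(_ Qx).
  move=> [s0]; have := sqr_sqrtr (u0 x); rewrite s0 expr0n/= => <-.
  by [].
rewrite (integral_cube_mass bu) => -[U00].
by rewrite U00 ltxx in U0.
Qed.

(** Jensen's inequality for the logarithm of [sqrt u], from the tangent line
    [ln t <= t - 1] at the average of [sqrt u]. *)
Lemma Aexp_ge u : borel_weight u -> 0 < mass mu u (hcube a l) ->
  ((mass mu u (hcube a l) * v /
     mass mu (fun x => Num.sqrt (u x)) (hcube a l) ^+ 2)%:E <= Aexp u Q)%E.
Proof.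
move=> bu U0; have H0 := mass_sqrt_gt0 bu U0; have bh := borel_weight_sqrt bu.
have [mu_ u0 uoo] := bu; have [mh h0 hoo] := bh.
set H := mass mu _ _ in H0 *; set U := mass mu u _ in U0 *.
pose c := H / v; have c0 : 0 < c by rewrite divr_gt0.
pose g x := 2 / c * Num.sqrt (u x) + (2 * ln c - 2).
have lg x : (lne (u x)%:E <= (g x)%:E)%E.
  have := u0 x; rewrite le_eqVlt => /predU1P[<-|ux].
    by rewrite le0_lneNy// leNye.
  rewrite lne_EFin// lee_fin /g.
  have s0 : 0 < Num.sqrt (u x) by rewrite sqrtr_gt0.
  have -> : ln (u x) = 2 * (ln (Num.sqrt (u x) / c) + ln c).
    rewrite ln_div ?posrE// subrK -{1}(sqr_sqrtr (u0 x)) lnXn//.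
    by rewrite mulr_natl.
  have : ln (Num.sqrt (u x) / c) <= Num.sqrt (u x) / c - 1.
    have := @le_ln1Dx R (Num.sqrt (u x) / c - 1); rewrite subrKC; apply.
    by rewrite ltrBrDl subrr divr_gt0.
  rewrite (_ : 2 / c * Num.sqrt (u x) = 2 * (Num.sqrt (u x) / c)); last by ring.
  lra.
have int1 : mu.-integrable Q (EFin \o (fun x => 2 / c * Num.sqrt (u x))).
  apply/integrableP; split.
    apply/measurable_EFinP; apply: measurable_funM; first exact: measurable_cst.
    exact: measurable_funS mh.
  rewrite (eq_integral (fun x => (2 / c)%:E * (Num.sqrt (u x))%:E)%E); last first.
    by move=> x _; rewrite /= ger0_norm ?EFinM// mulr_ge0// divr_ge0// ltW.
  rewrite ge0_integralZl//; last 2 first.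
  - by apply/measurable_EFinP; exact: measurable_funS mh.
  - by rewrite lee_fin divr_ge0// ltW.
  by rewrite (integral_cube_mass bh) -EFinM ltry.
have icst (k : R) : (\int[mu]_(x in Q) k%:E = (k * v)%:E)%E.
  transitivity (k%:E * mu Q)%E; first exact: integral_cst.
  by rewrite lebesgue_cube ?ltW.
have int2 : mu.-integrable Q (EFin \o cst (2 * ln c - 2)).
  apply/integrableP; split; first by apply/measurable_EFinP; exact: measurable_cst.
  by rewrite (eq_integral (fun=> `|2 * ln c - 2|%:E))// icst ltry.
have intg : (\int[mu]_(x in Q) (g x)%:E = (2 * ln c * v)%:E)%E.
  under eq_integral do rewrite /g EFinD.
  rewrite (@integralD _ _ _ mu Q mQ _ _ int1 int2) /= icst.
  have -> : (\int[mu]_(x in Q) (2 / c * Num.sqrt (u x))%:E = (2 / c * H)%:E)%E.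
    under eq_integral do rewrite EFinM.
    rewrite ge0_integralZl//; last 2 first.
    - by apply/measurable_EFinP; exact: measurable_funS mh.
    - by rewrite lee_fin divr_ge0// ltW.
    by rewrite (integral_cube_mass bh) -EFinM.
  rewrite -EFinD; congr EFin; rewrite /c.
  have := lt0r_neq0 v0; have := lt0r_neq0 H0; move: (ln _) => k h1 h2.
  by field; rewrite h1 h2.
have L : (((l ^+ n)%:E)^-1 * \int[mu]_(x in Q) lne (u x)%:E <= (2 * ln c)%:E)%E.
  apply: (@le_trans _ _ (((l ^+ n)%:E)^-1 * (2 * ln c * v)%:E)%E).
    apply: lee_wpmul2l; first by rewrite inve_ge0 lee_fin ltW.
    by rewrite -intg; exact: le_integral_pointwise.
  by rewrite inver gt_eqF// -EFinM lee_fin mulrC mulfK// gt_eqF.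
rewrite /Aexp avg_cube// -/U lebesgue_cube ?(ltW ll)//.
apply: (@le_trans _ _ ((U / v)%:E * expeR (- (2 * ln c)%:E))%E); last first.
  apply: lee_wpmul2l; first by rewrite lee_fin divr_ge0// ltW.
  by rewrite lee_expeR leeN2.
rewrite /= -EFinM lee_fin expRN (_ : 2 * ln c = ln c + ln c); last by ring.
rewrite expRD lnK ?posrE// /c.
have := lt0r_neq0 v0; have := lt0r_neq0 H0 => h1 h2.
rewrite le_eqVlt; apply/orP; left; apply/eqP; field.
by rewrite h1 h2.
Qed.

End jensen.

Section testing_ratio.
Context (R : realType) (n : nat).
Local Notation Rn := (Rn R n).
Local Notation mu := (lebesgue R n).
Implicit Types (u s w : Rn -> R).

Lemma powRV (x t : R) : 0 <= x -> x^-1 `^ t = (x `^ t)^-1.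
Proof. by move=> x0; rewrite -powR_inv1// -powRrM mulN1r powRN. Qed.

Lemma normalized_ratio (l S U x y alpha : R) : (0 < n)%N -> 0 < l -> 0 <= S -> 0 <= U ->
  (l ^+ n) `^ (alpha / n%:R + x + y - 1) * (S / l ^+ n) `^ x * (U / l ^+ n) `^ y =
  (l `^ (n%:R - alpha))^-1 * S `^ x * U `^ y.
Proof.
move=> n0 l0 S0 U0; have v0 : 0 < l ^+ n by rewrite exprn_gt0.
have vn := lt0r_neq0 v0.
rewrite !powRM ?invr_ge0 ?(ltW v0)// !powRV ?(ltW v0)//.
have -> : alpha / n%:R + x + y - 1 = (alpha / n%:R - 1) + x + y by ring.
rewrite [_ `^ (_ + y)]powRD ?vn ?implybT// [_ `^ (_ + x)]powRD ?vn ?implybT//.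
have -> : (l ^+ n) `^ (alpha / n%:R - 1) = (l `^ (n%:R - alpha))^-1.
  rewrite -powR_mulrn ?(ltW l0)// -powRrM -powRN; congr (_ `^ _).
  by field; rewrite pnatr_eq0 -lt0n.
have : (l ^+ n) `^ x != 0 by rewrite gt_eqF// powR_gt0.
have : (l ^+ n) `^ y != 0 by rewrite gt_eqF// powR_gt0.
have : l `^ (n%:R - alpha) != 0 by rewrite gt_eqF// powR_gt0.
move: (_ `^ x) (_ `^ y) (l `^ _) (S `^ x) (U `^ y) => X Y W A B w0 y0 x0.
by field; rewrite w0 x0 y0.
Qed.

Lemma conj_expV (p : R) : 1 < p -> (conj_exp p)^-1 = 1 - p^-1.
Proof. by move=> p1; have [_ <-] := conj_exp_gt1 p1; ring. Qed.

Lemma conj_expK (p : R) : 1 < p -> conj_exp (conj_exp p) = p.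
Proof.
move=> p1; have p10 : p - 1 != 0 by rewrite gt_eqF// subr_gt0.
rewrite /conj_exp; have -> : p / (p - 1) - 1 = (p - 1)^-1 by field.
by rewrite invrK divfK.
Qed.

Section cube.
Variables (u s : Rn -> R) (a : Rn) (l : R) (alpha p q : R).
Hypotheses (bu : borel_weight u) (bs : borel_weight s) (ll : 0 < l).
Hypotheses (n0 : (0 < n)%N) (p1 : 1 < p) (q1 : 1 < q).
Local Notation U := (mass mu u (hcube a l)).
Local Notation S := (mass mu s (hcube a l)).

Let U0 : 0 <= U. Proof. by apply: mass_ge0; have [] := bu. Qed.

Let S0 : 0 <= S. Proof. by apply: mass_ge0; have [] := bs. Qed.

Lemma Apq_dual_cube :
  Apq alpha (conj_exp q) (conj_exp p) s u (cube a l) =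
  ((l `^ (n%:R - alpha))^-1 * S `^ (conj_exp p)^-1 * U `^ q^-1)%:E.
Proof.
rewrite /Apq conj_expK// !avg_cube// lebesgue_cube ?(ltW ll)// !poweR_EFin -!EFinM.
congr EFin; rewrite -(normalized_ratio _ _ _ n0 ll S0 U0); congr (_ `^ _ * _ * _).
by rewrite (conj_expV q1); ring.
Qed.

Lemma Apq_cube :
  Apq alpha p q u s (cube a l) =
  ((l `^ (n%:R - alpha))^-1 * S `^ (conj_exp p)^-1 * U `^ q^-1)%:E.
Proof.
rewrite /Apq !avg_cube// lebesgue_cube ?(ltW ll)// !poweR_EFin -!EFinM.
congr EFin; rewrite mulrAC -(normalized_ratio _ _ _ n0 ll S0 U0); congr (_ `^ _ * _ * _).
by rewrite (conj_expV p1); ring.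
Qed.

(** The testing ratio to the power [p'], multiplied out. *)
Lemma ratio_powR (z K : R) : 0 <= z -> 0 <= K ->
  (l `^ (n%:R - alpha))^-1 * S `^ (conj_exp p)^-1 * U `^ q^-1 * z `^ (conj_exp p)^-1 <= K ->
  U `^ (1 + conj_exp p / q) * S * z <= (l `^ (n%:R - alpha)) `^ conj_exp p * (K `^ conj_exp p * U).
Proof.
move=> z0 K0 h; have [r1 _] := conj_exp_gt1 p1; set r := conj_exp p in r1 h *.
have r0 : 0 < r by apply: lt_trans r1.
have q0 : 0 < q by apply: lt_trans q1.
have w0 : 0 < l `^ (n%:R - alpha) by rewrite powR_gt0.
have {}h : S `^ r^-1 * U `^ q^-1 * z `^ r^-1 <= l `^ (n%:R - alpha) * K.
  by rewrite -ler_pdivrMl// !mulrA.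
have lhs0 : 0 <= S `^ r^-1 * U `^ q^-1 * z `^ r^-1 by rewrite !mulr_ge0 ?powR_ge0.
have rhs0 : 0 <= l `^ (n%:R - alpha) * K by rewrite mulr_ge0 ?(ltW w0).
have := ge0_ler_powR (ltW r0) lhs0 rhs0 h.
rewrite !powRM ?mulr_ge0 ?powR_ge0// -(powRrM S) -(powRrM U) -(powRrM z).
rewrite mulVf ?gt_eqF// !powRr1// [q^-1 * r]mulrC => {}h.
have e : U `^ (1 + r / q) = U * U `^ (r / q).
  have b0 : 0 < 1 + r / q by rewrite addr_gt0// divr_gt0.
  by rewrite -(mulr_powRB1 U0 b0) (addrC 1) addrK.
rewrite e (_ : _ * S * z = (S * U `^ (r / q) * z) * U); last by ring.
by rewrite mulrA ler_wpM2r.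
Qed.

End cube.

End testing_ratio.

Section carleson_instances.
Context (R : realType) (n : nat).
Local Notation Rn := (Rn R n).
Local Notation mu := (lebesgue R n).
Implicit Types (u s : Rn -> R).
Variables (alpha p q : R).
Hypotheses (n0 : (0 < n)%N) (p1 : 1 < p) (q1 : 1 < q).

Lemma carleson_bound_maximal u s (K a : R) :
  borel_weight u -> borel_weight s -> 0 <= K -> 0 <= a ->
  (forall Q, cubes Q -> (Apq alpha (conj_exp q) (conj_exp p) s u Q <= K%:E)%E) ->
  (AM_const u <= a%:E)%E ->
  carleson_bound alpha p q u s
    (fun A => K `^ conj_exp p * mass mu u A) (12 * a * K `^ conj_exp p).
Proof.
move=> bu bs K0 a0 hK ha; have [mu_ u0 uoo] := bu; split.
- by move=> A; rewrite mulr_ge0 ?powR_ge0 ?mass_ge0.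
- move=> b l ll; have := hK _ (mem_cubes b ll).
  rewrite Apq_dual_cube// lee_fin => h.
  have := @ratio_powR R n u s b l alpha p q bu bs ll p1 q1 1 K ler01 K0.
  by rewrite powR1 !mulr1; apply.
- move=> o L D P L0 pP Q; rewrite -mulr_sumr.
  apply: le_trans (ler_wpM2l (powR_ge0 _ _) (carleson_maximal o L0 Q bu a0 ha pP)) _.
  by rewrite mulrA [X in X * _]mulrC.
Qed.

(** Up to [K^p'], [m A] is [|A|] times the squared average of [sqrt u]: it
    dominates [|A|] times the geometric mean of [u], and is governed by an [L^2]
    maximal inequality. *)
Lemma carleson_bound_exp u s (K : R) :
  borel_weight u -> borel_weight s -> 0 <= K ->
  (forall Q, cubes Q -> (Apq alpha (conj_exp q) (conj_exp p) s u Q *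
    Aexp u Q `^ (conj_exp p)^-1 <= K%:E)%E) ->
  carleson_bound alpha p q u s
    (fun A => K `^ conj_exp p *
      (mass mu (fun x => Num.sqrt (u x)) A ^+ 2 / fine (mu A)))
    (96 * K `^ conj_exp p).
Proof.
move=> bu bs K0 hK; have [mu_ u0 uoo] := bu.
have [r1 _] := conj_exp_gt1 p1.
split.
- by move=> A; rewrite mulr_ge0 ?powR_ge0// divr_ge0 ?sqr_ge0// fine_ge0.
- move=> b l ll; have := hK _ (mem_cubes b ll).
  rewrite Apq_dual_cube// lebesgue_hcube//=.
  set U := mass mu u _; set H := mass mu (fun x => Num.sqrt (u x)) _; set S := mass mu s _.
  have U0 : 0 <= U by exact: mass_ge0.
  have S0 : 0 <= S by apply: mass_ge0; have [] := bs.
  have v0 : 0 < l ^+ n by rewrite exprn_gt0.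
  have [U00 _|Un0] := eqVneq U 0.
    rewrite U00 powR0; last first.
      by rewrite gt_eqF// addr_gt0// divr_gt0 ?(lt_trans _ r1) ?(lt_trans _ q1).
    rewrite mul0r mulr_ge0 ?powR_ge0// mulr_ge0 ?powR_ge0//.
    by rewrite divr_ge0 ?sqr_ge0// ltW.
  have Ugt0 : 0 < U by rewrite lt_neqAle eq_sym Un0.
  have H0 : 0 < H by exact: mass_sqrt_gt0.
  pose z := U * l ^+ n / H ^+ 2.
  have z0 : 0 <= z by rewrite divr_ge0 ?mulr_ge0 ?sqr_ge0// ltW.
  have zA : (z%:E <= Aexp u (cube b l))%E by exact: Aexp_ge.
  have ri : 0 <= (conj_exp p)^-1 by rewrite invr_ge0 ltW// (lt_trans _ r1).
  move=> h; have {}h : (l `^ (n%:R - alpha))^-1 * S `^ (conj_exp p)^-1 * U `^ q^-1 *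
      z `^ (conj_exp p)^-1 <= K.
    rewrite -lee_fin EFinM; apply: le_trans h; apply: lee_wpmul2l.
      by rewrite lee_fin !mulr_ge0 ?powR_ge0// invr_ge0 powR_ge0.
    rewrite -poweR_EFin; apply: gt0_ler_poweR => //; rewrite in_itv/= leey andbT ?lee_fin//.
    by apply: le_trans zA; rewrite lee_fin.
  have {}h := ratio_powR bu bs ll p1 q1 z0 K0 h.
  rewrite -/U -/S in h.
  have zgt0 : 0 < z by rewrite divr_gt0 ?mulr_gt0 ?exprn_gt0.
  rewrite -(ler_pM2r zgt0).
  apply: le_trans h _; rewrite le_eqVlt; apply/orP; left; apply/eqP.
  rewrite /z; have h1 := lt0r_neq0 H0; have h2 := lt0r_neq0 v0.
  by move: (_ `^ conj_exp p) (K `^ _) => X Y; field; rewrite h1 h2.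
- move=> o L D P L0 pP Q; rewrite -mulr_sumr.
  rewrite (eq_bigr (fun S => mass mu (fun x => Num.sqrt (u x)) (cell o L S) ^+ 2 /
      side (@gen n D) L S ^+ n)); last first.
    by move=> S _; rewrite lebesgue_cell.
  apply: le_trans (ler_wpM2l (powR_ge0 _ _) (carleson_sqrt o L0 Q bu pP)) _.
  by rewrite mulrCA mulrA.
Qed.

End carleson_instances.

(** * Reduction to Borel weights *)

Section borel_representatives.
Context (R : realType) (n : nat).
Local Notation Rn := (Rn R n).
Local Notation mu := (lebesgue R n).
Implicit Types (u s w f : Rn -> R).

Lemma lebesgue_measurable_borel f : lebesgue_measurable f -> (forall x, 0 <= f x) ->
  exists f', [/\ measurable_fun setT f', forall x, 0 <= f' x &
    {ae mu, forall x, f x = f' x}].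
Proof.
move=> [h mh fh] f0; exists (fun x => Num.max (h x) 0); split.
- by apply: measurable_maxr => //; exact: measurable_cst.
- by move=> x; rewrite le_max lexx orbT.
- by move: fh; apply: filterS => x fx; rewrite -fx max_l.
Qed.

Lemma weight_borel w : weight w ->
  exists2 w', borel_weight w' & {ae mu, forall x, w x = w' x}.
Proof.
move=> [lw w0 woo]; have [w' [mw' w'0 ww']] := lebesgue_measurable_borel lw w0.
exists w' => //; split=> // a l ll; have := woo _ (mem_cubes a ll).
rewrite /wmeas (ae_eq_integral_nonmeasurable _ (g := fun x => (w' x)%:E))//.
by move: ww'; apply: filterS => x ->.
Qed.

Section congruence.
Variables (w w' : Rn -> R).
Hypothesis ww' : {ae mu, forall x, w x = w' x}.

Lemma ae_wmeas A : wmeas w A = wmeas w' A.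
Proof. by apply: ae_eq_integral_nonmeasurable; move: ww'; apply: filterS => x ->. Qed.

Lemma ae_avg Q : avg w Q = avg w' Q.
Proof. by rewrite /avg -/(wmeas w Q) ae_wmeas. Qed.

Lemma ae_Aexp Q : Aexp w Q = Aexp w' Q.
Proof.
rewrite /Aexp ae_avg; congr (_ * expeR (- (_ * _)))%E.
by apply: ae_eq_integral_nonmeasurable; move: ww'; apply: filterS => x ->.
Qed.

Lemma ae_AM_const : AM_const w = AM_const w'.
Proof.
have H Q x : HLmax (w \* \1_Q) x = HLmax (w' \* \1_Q) x.
  rewrite /HLmax; congr ereal_sup; apply: eq_imagel => A _.
  rewrite /avg; congr (_ * _)%E; apply: ae_eq_integral_nonmeasurable.
  by move: ww'; apply: filterS => y /= ->.
pose F v Q := ((wmeas v Q)^-1 * \int[mu]_(x in Q) HLmax (v \* \1_Q)%R x)%E.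
have FE : F w = F w'.
  apply/funext => Q; rewrite /F (ae_wmeas Q).
  have HQ : HLmax (w \* \1_Q)%R = HLmax (w' \* \1_Q)%R by apply/funext => x; exact: H.
  by rewrite HQ.
have AE v : AM_const v = ereal_sup (F v @` @cubes R n) by [].
by rewrite (AE w) (AE w') FE.
Qed.

End congruence.

Lemma ae_Apq alpha p q u u' s s' Q : {ae mu, forall x, u x = u' x} ->
  {ae mu, forall x, s x = s' x} -> Apq alpha p q u s Q = Apq alpha p q u' s' Q.
Proof. by move=> uu' ss'; rewrite /Apq (ae_avg uu') (ae_avg ss'). Qed.

Lemma riesz_weak_norm_le (alpha p q : R) :
  0 < alpha < n%:R -> 1 < p -> p < q ->
  exists2 c : R, 0 < c &
  forall u s u' s' (m : set Rn -> R) (C : R),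
    borel_weight u' -> borel_weight s' ->
    {ae mu, forall x, u x = u' x} -> {ae mu, forall x, s x = s' x} ->
    0 <= C -> carleson_bound alpha p q u' s' m C ->
    (riesz_weak_norm alpha p q u s <= (c * C `^ (conj_exp p)^-1)%:E)%E.
Proof.
move=> hal p1 pq; have [c c0 wt] := @weak_type_borel R n alpha p q hal p1 pq.
exists c => // u s u' s' m C bu bs uu' ss' C0 cb.
apply: ereal_inf_lbound; split; first by rewrite lee_fin mulr_ge0 ?powR_ge0// ltW.
move=> f lf f0 Foo; have [f' [mf' f'0 ff']] := lebesgue_measurable_borel lf f0.
have Lp : Lp_norm p s f = Lp_norm p s' f'.
  rewrite /Lp_norm; congr (_ `^ _)%E; apply: ae_eq_integral_nonmeasurable.
  by move: ff' ss'; apply: filterS2 => x -> ->.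
have rE : riesz alpha (f \* s)%R = riesz alpha (f' \* s')%R.
  apply/funext => x; apply: ae_eq_integral_nonmeasurable.
  by move: ff' ss'; apply: filterS2 => y /= -> ->.
rewrite Lp rE (_ : weakLp_norm q u _ = weakLp_norm q u' (riesz alpha (f' \* s')%R)).
  by apply: (wt u' s' f' m C bu bs mf' f'0 C0 cb); rewrite -Lp.
rewrite /weakLp_norm; congr ereal_sup; apply: eq_imagel => t _.
by rewrite (ae_wmeas uu').
Qed.

End borel_representatives.

Local Open Scope ereal_scope.

Theorem theorem2p2 (R : realType) (n : nat) (alpha p q : R)
    (halpha : (0 < alpha < n%:R)%R) (hp : (1 < p)%R) (hpq : (p < q)%R) :
  exists2 c : R, (0 < c)%R &
    forall u sigma : Rn R n -> R,
      weight u -> weight sigma ->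
      Apq_const alpha p q u sigma < +oo ->
      Ainfty u ->
      riesz_weak_norm alpha p q u sigma <=
        c%:E * ereal_sup
          [set Apq alpha (conj_exp q) (conj_exp p) sigma u Q
               * Aexp u Q `^ (conj_exp p)^-1 | Q in @cubes R n]
      /\
      riesz_weak_norm alpha p q u sigma <=
        c%:E * (Apq_const alpha (conj_exp q) (conj_exp p) sigma u
                * AM_const u `^ (conj_exp p)^-1).
Proof.
have q1 : (1 < q)%R by apply: lt_trans hpq.
have n0 : (0 < n)%N.
  by rewrite -(ltr_nat R); have /andP[a0 an] := halpha; apply: lt_trans an.
have [r1 _] := conj_exp_gt1 hp; have r0 : (0 < conj_exp p)%R by apply: lt_trans r1.
have ri : (0 < (conj_exp p)^-1)%R by rewrite invr_gt0.
have [c c0 main] := @riesz_weak_norm_le R n alpha p q halpha hp hpq.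
pose cf := (c * 96 `^ (conj_exp p)^-1)%R.
have cf0 : (0 < cf)%R by rewrite mulr_gt0// powR_gt0.
exists cf => // u sigma wu ws Afin _.
have [u' bu uu'] := weight_borel wu; have [s' bs ss'] := weight_borel ws.
have cube1 : @cubes R n (cube [tuple 0%R | i < n] 1) by apply: mem_cubes.
have Apq_eq Q : cubes Q -> Apq alpha (conj_exp q) (conj_exp p) sigma u Q =
    Apq alpha p q u sigma Q.
  move=> [a [l [ll ->]]]; rewrite (ae_Apq _ _ _ _ ss' uu') (ae_Apq _ _ _ _ uu' ss').
  by rewrite Apq_dual_cube// Apq_cube.
have Apq_ge0 Q : cubes Q -> 0 <= Apq alpha (conj_exp q) (conj_exp p) sigma u Q.
  by move=> _; rewrite /Apq !mule_ge0 ?poweR_ge0.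
have Kpow (k K : R) : (0 <= k)%R -> (0 <= K)%R ->
    (c * (k * K `^ conj_exp p) `^ (conj_exp p)^-1)%R =
    (c * k `^ (conj_exp p)^-1 * K)%R.
  move=> k0 K0; rewrite powRM ?powR_ge0// -powRrM mulfV ?gt_eqF// powRr1//.
  by rewrite mulrA.
have first : riesz_weak_norm alpha p q u sigma <= cf%:E * ereal_sup
    [set Apq alpha (conj_exp q) (conj_exp p) sigma u Q
         * Aexp u Q `^ (conj_exp p)^-1 | Q in @cubes R n].
  set B := ereal_sup _.
  have B0 : 0 <= B.
    apply: le_trans (ereal_sup_ubound _); last by exists (cube [tuple 0%R | i < n] 1).
    by rewrite mule_ge0 ?poweR_ge0// Apq_ge0.
  have [->|Boo] := eqVneq B +oo; first by rewrite gt0_muley ?lte_fin// leey.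
  have BE : B = (fine B)%:E by rewrite fineK// ge0_fin_numE// ltey.
  have K0 : (0 <= fine B)%R by rewrite fine_ge0.
  have hK Q : cubes Q -> Apq alpha (conj_exp q) (conj_exp p) s' u' Q *
      Aexp u' Q `^ (conj_exp p)^-1 <= (fine B)%:E.
    move=> cQ; rewrite -BE -(ae_Apq _ _ _ _ ss' uu') -(ae_Aexp uu').
    by apply: ereal_sup_ubound; exists Q.
  have cb := carleson_bound_exp n0 hp q1 bu bs K0 hK.
  have C0 : (0 <= 96 * fine B `^ conj_exp p)%R by rewrite mulr_ge0 ?powR_ge0.
  apply: le_trans (main u sigma u' s' _ _ bu bs uu' ss' C0 cb) _.
  by rewrite Kpow// BE -EFinM.
split=> //.
set K1 := Apq_const alpha (conj_exp q) (conj_exp p) sigma u; set A := AM_const u.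
have K1E : K1 = Apq_const alpha p q u sigma.
  by congr ereal_sup; apply: eq_imagel => Q; exact: Apq_eq.
have K10 : 0 <= K1.
  apply: le_trans (ereal_sup_ubound _); last by exists (cube [tuple 0%R | i < n] 1).
  exact: Apq_ge0.
have K1fin : K1 = (fine K1)%:E by rewrite fineK// ge0_fin_numE// K1E.
have A0 : 0 <= A.
  apply: le_trans (ereal_sup_ubound _); last by exists (cube [tuple 0%R | i < n] 1).
  have [_ w0 _] := wu; rewrite mule_ge0 ?inve_ge0 ?integral_ge0// => x _.
    by rewrite lee_fin.
  exact: HLmax_ge0.
have [Aoo|Aoo] := eqVneq A +oo.
  have [K10'|K1n] := eqVneq K1 0; last first.
    have K1p : 0 < K1 by rewrite lt_neqAle eq_sym K1n.
    by rewrite Aoo poweRyr ?gt_eqF// gt0_muley// gt0_muley ?lte_fin// leey.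
  (* [0 * +oo = 0] on the right, so the maximal function is of no use: the first
     bound takes over, its right-hand side being [0] as well. *)
  apply: le_trans first _; rewrite K10' mul0e mule0.
  rewrite (_ : ereal_sup _ = 0) ?mule0//; apply/eqP; rewrite eq_le.
  have Apq0 Q : cubes Q -> Apq alpha (conj_exp q) (conj_exp p) sigma u Q = 0.
    move=> cQ; apply/eqP; rewrite eq_le Apq_ge0// andbT -K10'.
    by apply: ereal_sup_ubound; exists Q.
  apply/andP; split.
    by apply: ge_ereal_sup => _ [Q cQ <-]; rewrite Apq0// mul0e.
  by apply: ereal_sup_ubound; exists (cube [tuple 0%R | i < n] 1) => //; rewrite Apq0// mul0e.
have AE : A = (fine A)%:E by rewrite fineK// ge0_fin_numE// ltey.
have a0 : (0 <= fine A)%R by rewrite fine_ge0.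
have k0 : (0 <= fine K1)%R by rewrite fine_ge0.
have hK Q : cubes Q -> Apq alpha (conj_exp q) (conj_exp p) s' u' Q <= (fine K1)%:E.
  by move=> cQ; rewrite -K1fin -(ae_Apq _ _ _ _ ss' uu'); apply: ereal_sup_ubound; exists Q.
have hA : AM_const u' <= (fine A)%:E by rewrite -(ae_AM_const uu') -AE.
have cb := carleson_bound_maximal n0 hp q1 bu bs k0 a0 hK hA.
have C0 : (0 <= 12 * fine A * fine K1 `^ conj_exp p)%R by rewrite !mulr_ge0 ?powR_ge0.
apply: le_trans (main u sigma u' s' _ _ bu bs uu' ss' C0 cb) _.
rewrite Kpow ?mulr_ge0// K1fin AE poweR_EFin -!EFinM lee_fin /cf.
rewrite [X in (_ <= X)%R](_ : _ = c * (96 `^ (conj_exp p)^-1 * fine A `^ (conj_exp p)^-1) * fine K1)%R; last by ring.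
rewrite -powRM// ler_wpM2r// ler_wpM2l ?(ltW c0)//.
apply: ge0_ler_powR; rewrite ?nnegrE ?mulr_ge0 ?(ltW ri)//.
by rewrite ler_wpM2r// ler_nat.
Qed.
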